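(* Consider a fully stochastic function-constrained variational inequality and let $\{(x^{t+1},\lambda^{t+1})\}$ be generated by the Partial Operator Extrapolation method (both described in the context). Let $B\ge1$ be a constant and abbreviate $$A:=B\big(3M_g+4\|\sigma_{\mathfrak G}\|(1+\sigma_{\mathfrak g})\big)+H+\sigma,\qquad C:=2M_g+5\|\sigma_{\mathfrak G}\|+\sigma_{\mathfrak g}.$$ Set $\theta_t=1$, $\eta_t=\eta$, $\tau_t=\tau$ for all $t$, where $$\eta=\frac{\sqrt{2T}\,A}{D_X}+\frac{25L}{3},\qquad \tau=\frac{2\sqrt{2T}\,C\,D_X}{B},$$ and let $$R_f:=\frac{\eta}{\tau}\|x^*-x^0\|^2+3\|\lambda^*\|^2+2\sigma_{\mathfrak g}^2+9(H^2+2\sigma^2).$$ Then $$\mathbb E\Big[\sup_{x\in\widetilde X}\langle F(x),\bar x_T-x\rangle\Big]\le D_X\Big[\frac{3\sqrt2\,A}{2\sqrt T}+\frac{\sigma_{\mathfrak g}^2B}{2\sqrt{2T}\,C\,D_X^2}+\frac{25(H^2+2\sigma^2)}{6\sqrt{2T}\,A}+\frac{H^2+2\sigma^2}{T\sqrt{2T}\,A}+\frac{\sigma^2}{2\sqrt{2T}\,A}+\frac{(15M_g^2+28\|\sigma_{\mathfrak G}\|^2)(\|\lambda^*\|^2+2R_fe)}{3\sqrt{2T}\,A}\Big]+\frac{25LD_X^2}{2T},$$ and $$\begin{aligned}\mathbb E\big\|[g(\bar x_T)]_+\big\|\le{}&\frac{A}{\sqrt{2T}\,D_X}\|x^*-x^0\|^2+\frac{25L}{6T}\|x^*-x^0\|^2+\frac{\sqrt2\,C(\|\lambda^*\|+1)^2D_X}{\sqrt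 T\,B}+\frac{\sigma_{\mathfrak g}^2B}{2\sqrt{2T}\,C\,D_X}+\frac{(H^2+2\sigma^2)D_X}{T\sqrt{2T}\,A}\\&+\frac{15M_g^2D_X(\|\lambda^*\|+1)^2}{\sqrt{2T}\,A}+\frac{10M_g^2D_X(\|\lambda^*\|^2+2R_fe)}{\sqrt{2T}\,A}+\frac{25D_X\big[2(H^2+2\sigma^2)+\|\sigma_{\mathfrak G}\|^2(\|\lambda^*\|^2+2R_fe)\big]}{3\sqrt{2T}\,A}+\frac{(\|\lambda^*\|+1)\sigma_{\mathfrak g}}{\sqrt T},\end{aligned}$$ where $e$ is Euler's number.
   Context: Setting. $\|\cdot\|$ is the Euclidean norm. $X\subset\mathbb R^n$ is convex and compact with diameter $D_X=\max_{x_1,x_2\in X}\|x_1-x_2\|$. $F:X\to\mathbb R^n$ is monotone ($\langle F(x_1)-F(x_2),x_1-x_2\rangle\ge0$) and $\|F(x_1)-F(x_2)\|\le L\|x_1-x_2\|+H$ on $X$. $g_j:X\to\mathbb R$, $j=1,\dots,m$, are continuous convex functions, $M_{g_j}$-Lipschitz on $X$. $\partial g_j(x)$ denotes, at relative interior points $x$ of $X$, the set of subgradients lying in the linear span of $X-X$, and at other points of $X$ the set of limits of such subgradients along sequences of relative interior points converging to $x$; then every $g_j'(x)\in\partial g_j(x)$ has $\|g_j'(x)\|\le M_{g_j}$. A selection $g_j'(x)\in\partial g_j(x)$ is fixed. $g=(g_1,\dots,g_m)^T$, $g'(x)=[g_1'(x),\dots,g_m'(x)]\in\mathbb R^{n\times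 m}$, $M_g=(\sum_jM_{g_j}^2)^{1/2}$, $\widetilde X=X\cap\{g(x)\le\mathbf 0\}$; $[\cdot]_+$ is the componentwise positive part. Standing assumption: there are $x^*\in\widetilde X$ solving $\langle F(x^* ),x-x^*\rangle\ge0\ \forall x\in\widetilde X$ and $\lambda^*\in\mathbb R^m_+$ with $\mathbf 0\in F(x^* )+\sum_j\lambda_j^*\partial g_j(x^* )+N_X(x^* )$ (Minkowski sum, $N_X$ the normal cone) and $\lambda^*_jg_j(x^* )=0$ for all $j$. Stochastic oracle. For $x\in X$ (with $\xi$ independent of the search point $x$): $\mathbb E[\mathfrak F(x,\xi)]=F(x)$, $\mathbb E\|\mathfrak F(x,\xi)-F(x)\|^2\le\sigma^2$; $\mathfrak g(x,\xi)=[\mathfrak g_1(x,\xi),\dots,\mathfrak g_m(x,\xi)]^T$ with $\mathbb E[\mathfrak g(x,\xi)]=g(x)$, $\mathbb E\|\mathfrak g(x,\xi)-g(x)\|^2\le\sigma_{\mathfrak g}^2$; $\mathfrak G(x,\xi)=[\mathfrak G_1(x,\xi),\dots,\mathfrak G_m(x,\xi)]\in\mathbb R^{n\times m}$ with $\mathbb E[\mathfrak G_j(x,\xi)]=g_j'(x)$, $\mathbb E\|\mathfrak G_j(x,\xi)-g_j'(x)\|^2\le\sigma_j^2$. $\sigma_{\mathfrak G}=[\sigma_1,\dots,\sigma_m]^T$. Moreover $\mathfrak g_j(\cdot,\xi)$ is a convex lower semicontinuous function for every $\xi$ and $j$. The samples $\xi^t,\bar\xi^t$, $t\ge0$, are mutually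 independent copies of $\xi$; $\mathfrak F^t:=\mathfrak F(x^t,\xi^t)$. Partial Operator Extrapolation method. Input $x^0\in X$, $\lambda^0=\mathbf 0$; set $x^{-1}=x^0$, $\mathfrak F^{-1}=\mathfrak F^0$. For $t=0,\dots,T-1$: $\lambda^{t+1}=\arg\min_{\lambda\ge\mathbf 0}-\langle\mathfrak g(x^t,\bar\xi^t),\lambda\rangle+\frac{\tau_t}{2}\|\lambda-\lambda^t\|^2$; $x^{t+1}=\arg\min_{x\in X}\langle(1+\theta_t)\mathfrak F^t-\theta_t\mathfrak F^{t-1}+\mathfrak G(x^t,\xi^t)\lambda^{t+1},x\rangle+\frac{\eta_t}{2}\|x-x^t\|^2$. Output $\bar x_T=\frac1T\sum_{t=0}^{T-1}x^{t+1}$. *)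

(* Defs.v *)
From HB Require Import structures.
From mathcomp Require Import all_boot all_order all_algebra.
From mathcomp Require Import all_classical all_reals all_analysis.

Set Implicit Arguments.
Unset Strict Implicit.
Unset Printing Implicit Defensive.

Import Order.TTheory GRing.Theory Num.Theory.
Import numFieldNormedType.Exports.

Local Open Scope classical_set_scope.
Local Open Scope ring_scope.

Section Euclidean.
Context {R : realType}.

Definition dot {n : nat} (u v : 'cV[R]_n) : R := \sum_i u i 0 * v i 0.

(* The library norm `|u| on matrices is the max norm; it only provides the
   topology here. *)
Definition norm2 {n : nat} (u : 'cV[R]_n) : R := Num.sqrt (dot u u).

Definition diameter {n : nat} (X : set 'cV[R]_n) : R :=
  sup [set norm2 (z.1 - z.2) | z in X `*` X].

Definition nonneg_orthant {m : nat} : set 'cV[R]_m :=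
  [set l | forall j, 0 <= l j 0].

Definition pos_part {m : nat} (v : 'cV[R]_m) : 'cV[R]_m :=
  map_mx (fun a => Num.max a 0) v.

Definition is_argmin {n : nat} (S : set 'cV[R]_n) (f : 'cV[R]_n -> R)
    (x : 'cV[R]_n) : Prop :=
  S x /\ forall y, S y -> f x <= f y.

Definition normal_cone {n : nat} (X : set 'cV[R]_n) (x : 'cV[R]_n)
    : set 'cV[R]_n :=
  [set w | forall y, X y -> dot w (y - x) <= 0].

Definition feasible {n m : nat} (X : set 'cV[R]_n) (g : 'cV[R]_n -> 'cV[R]_m)
    : set 'cV[R]_n :=
  [set x | X x /\ forall j, g x j 0 <= 0].

(* Linear span of X - X. *)
Definition dir_span {n : nat} (X : set 'cV[R]_n) : set 'cV[R]_n :=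
  [set v | exists (k : nat) (c : 'I_k -> R) (a b : 'I_k -> 'cV[R]_n),
     (forall i, X (a i) /\ X (b i)) /\ v = \sum_i c i *: (a i - b i)].

(* The affine hull of X is x + dir_span X for any x in X. *)
Definition relint {n : nat} (X : set 'cV[R]_n) : set 'cV[R]_n :=
  [set x | X x /\ exists2 e : R, 0 < e &
     forall v, dir_span X v -> norm2 v < e -> X (x + v)].

Definition span_subgradient {n : nat} (X : set 'cV[R]_n) (f : 'cV[R]_n -> R)
    (x : 'cV[R]_n) : set 'cV[R]_n :=
  [set v | dir_span X v /\ forall y, X y -> f x + dot v (y - x) <= f y].

Definition subdiff {n : nat} (X : set 'cV[R]_n) (f : 'cV[R]_n -> R)
    (x : 'cV[R]_n) : set 'cV[R]_n :=
  [set v |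
     (relint X x /\ span_subgradient X f x v) \/
     [/\ X x, ~ relint X x &
       exists y_ v_ : nat -> 'cV[R]_n,
         [/\ forall k, relint X (y_ k),
             forall k, span_subgradient X f (y_ k) (v_ k),
             y_ @ \oo --> x & v_ @ \oo --> v]]].

End Euclidean.

Definition borelV (R : realType) (n : nat) :=
  g_sigma_algebraType (@open 'cV[R]_n).

Definition mutually_independent (R : realType) (d d' : measure_display)
    (Om : measurableType d) (Xi : measurableType d') (P : probability Om R)
    (I : eqType) (Z : I -> Om -> Xi) : Prop :=
  forall (J : seq I) (E : I -> set Xi), uniq J ->
    (forall i, measurable (E i)) ->
    P (\bigcap_(i in [set` J]) Z i @^-1` E i) =
    (\prod_(i <- J) P (Z i @^-1` E i))%E.

Definition identically_distributed (R : realType) (d d' : measure_display)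
    (Om : measurableType d) (Xi : measurableType d') (P : probability Om R)
    (I : eqType) (Z : I -> {RV P >-> Xi}) (mu : probability Xi R) : Prop :=
  forall i (E : set Xi), measurable E -> distribution P (Z i) E = mu E.

Definition sample_family (T : Type) (s sbar : nat -> T) (i : nat + nat) : T :=
  match i with inl t => s t | inr t => sbar t end.

(* O is a stochastic oracle for f on X, the sample having law mu.  The
   componentwise expectations being finite numbers, the components are
   integrable: in \bar R, +oo - +oo is -oo.  Joint measurability makes the
   oracle's output at a random search point a random variable. *)
Definition unbiased_oracle (R : realType) (n p : nat) (X : set 'cV[R]_n)
    (d' : measure_display) (Xi : measurableType d') (mu : probability Xi R)
    (O : 'cV[R]_n -> Xi -> 'cV[R]_p) (f : 'cV[R]_n -> 'cV[R]_p) (sigma : R)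
    : Prop :=
  [/\ forall i, measurable_fun ((X : set (borelV R n)) `*` [set: Xi])
        (fun z : borelV R n * Xi => O z.1 z.2 i 0),
      forall x, X x -> forall i, 'E_mu[fun s => (O x s i 0)%R]%E = (f x i 0)%:E &
      forall x, X x ->
        ('E_mu[fun s => (norm2 (O x s - f x) ^+ 2)%R] <= (sigma ^+ 2)%:E)%E].

(* One realization of the Partial Operator Extrapolation method for T steps, with
   stepsizes theta, eta, tau and samples s, sbar. *)
Definition poe_run (R : realType) (n m : nat) (Xi : Type) (X : set 'cV[R]_n)
    (FF : 'cV[R]_n -> Xi -> 'cV[R]_n) (gg : 'cV[R]_n -> Xi -> 'cV[R]_m)
    (GG : 'cV[R]_n -> Xi -> 'M[R]_(n, m)) (theta eta tau : nat -> R)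
    (T : nat) (x0 : 'cV[R]_n) (s sbar : nat -> Xi)
    (x : nat -> 'cV[R]_n) (l : nat -> 'cV[R]_m) : Prop :=
  let Fs t := FF (x t) (s t) in
  let Fprev t := if t is t'.+1 then Fs t' else Fs 0%N in
  [/\ x 0%N = x0, l 0%N = 0 &
      forall t, (t < T)%N ->
        is_argmin nonneg_orthant
          (fun k => - dot (gg (x t) (sbar t)) k
                    + tau t / 2 * norm2 (k - l t) ^+ 2) (l t.+1) /\
        is_argmin X
          (fun y => dot ((1 + theta t) *: Fs t - theta t *: Fprev t
                         + GG (x t) (s t) *m l t.+1) y
                    + eta t / 2 * norm2 (y - x t) ^+ 2) (x t.+1)].

Definition ergodic_average (R : realType) (n : nat) (T : nat)
    (x : nat -> 'cV[R]_n) : 'cV[R]_n :=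
  T%:R^-1 *: \sum_(t < T) x t.+1.

(* Main.v *)
Require Import Defs.
From HB Require Import structures.
From mathcomp Require Import all_boot all_order all_algebra.
From mathcomp Require Import all_classical all_reals all_analysis.
From mathcomp Require Import measurable_realfun ring lra.
Set Implicit Arguments.
Unset Strict Implicit.
Unset Printing Implicit Defensive.
Import Order.TTheory GRing.Theory Num.Theory.
Import numFieldNormedType.Exports.
Local Open Scope classical_set_scope.
Local Open Scope ring_scope.

(** The proof compares every iterate with a point [y] of [X] and a multiplier
    [lam >= 0] through the gap
    [<F (x t.+1), x t.+1 - y> + <lam, g (x t.+1)> - <l t.+1, g y>].

    Along a single trajectory ([gap_sum_le]) the optimality conditions of the
    two proximal steps are added up.  The distances to [y] and [lam]
    telescope, and so does the extrapolation, because
    [Fs t + (Fs t - Fs t.-1)] differs from [Fs t.+1] by a difference of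
    consecutive increments.  What remains is products of errors with the step
    length [|x t.+1 - x t|]; Young's inequality pays for them with the negative
    quadratic of the proximal step.  The result is: initial distance, plus
    squared errors divided by the stepsizes, plus terms linear in the noise.

    The linear terms have mean zero.  The iterates at time [t] are functions of
    the samples drawn before ([iterates_adapted]), a fresh sample is
    independent of these ([info_independent]), so it can be integrated out
    first ([fresh_sample_tonelli]); hence a fresh noise is orthogonal to every
    integrable function of the past ([noise_orthogonal]).  The same argument
    bounds the mean squares of the noises ([noise_second_moment]) and shows
    that the noises of different times are orthogonal, so that the norm of
    their sum over [T] steps is of order [sqrt T].

    The squared errors contain [|l t|^2], whose mean is not known beforehand.
    At the saddle point [(xstar, lstar)] the gap is nonnegative, so the
    trajectory bound controls the mean of [|lstar - l t|^2] by a
    constant plus a multiple of the average of the mean of [|l t|^2]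
    ([multiplier_energy_le]).  The stepsizes make this multiple smaller
    than 1, so the estimate can be solved ([Stepsizes]).  The solution
    exceeds the quantity [lam] of the theorem at most by multiples of
    [T sigma_g^2 / tau^2] and [T V / (eta tau)], and these are absorbed by the
    slack in the coefficients of the [sigma_g^2] and [V] terms of the two
    bounds.

    For the optimality gap, [lam = 0] and [y] is an arbitrary feasible point.
    The supremum is inside the expectation, so the noise paired with [y] does
    not average out; it is rewritten as the inner product of [y - x0] with the
    cumulated noise, and the diameter bounds the former.  For the
    infeasibility, [y = xstar] and [lam] has norm [|lstar| + 1] and points along
    the violation at the averaged iterate, so that the gap dominates
    the norm of the violation. *)

(** * Euclidean geometry of column vectors *)

Section EuclideanGeometry.
Context {R : realType}.
Implicit Types n m : nat.

Lemma dotC n (u v : 'cV[R]_n) : dot u v = dot v u.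
Proof. by apply: eq_bigr => i _; rewrite mulrC. Qed.

Lemma dotDl n (u v w : 'cV[R]_n) : dot (u + v) w = dot u w + dot v w.
Proof. by rewrite -big_split; apply: eq_bigr => i _; rewrite mxE mulrDl. Qed.

Lemma dotZl n a (u w : 'cV[R]_n) : dot (a *: u) w = a * dot u w.
Proof. by rewrite mulr_sumr; apply: eq_bigr => i _; rewrite mxE mulrA. Qed.

Lemma dotNl n (u w : 'cV[R]_n) : dot (- u) w = - dot u w.
Proof. by rewrite -scaleN1r dotZl mulN1r. Qed.

Lemma dotBl n (u v w : 'cV[R]_n) : dot (u - v) w = dot u w - dot v w.
Proof. by rewrite dotDl dotNl. Qed.

Lemma dot0l n (w : 'cV[R]_n) : dot 0 w = 0.
Proof. by rewrite -(scale0r 0) dotZl mul0r. Qed.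

Lemma dotDr n (u v w : 'cV[R]_n) : dot w (u + v) = dot w u + dot w v.
Proof. by rewrite dotC dotDl !(dotC w). Qed.

Lemma dotZr n a (u w : 'cV[R]_n) : dot w (a *: u) = a * dot w u.
Proof. by rewrite dotC dotZl (dotC w). Qed.

Lemma dotNr n (u w : 'cV[R]_n) : dot w (- u) = - dot w u.
Proof. by rewrite dotC dotNl (dotC w). Qed.

Lemma dotBr n (u v w : 'cV[R]_n) : dot w (u - v) = dot w u - dot w v.
Proof. by rewrite dotDr dotNr. Qed.

Lemma dot0r n (w : 'cV[R]_n) : dot w 0 = 0.
Proof. by rewrite dotC dot0l. Qed.

Lemma dot_suml n (I : Type) (r : seq I) (Q : pred I) (f : I -> 'cV[R]_n) w :
  dot (\sum_(i <- r | Q i) f i) w = \sum_(i <- r | Q i) dot (f i) w.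
Proof.
by elim/big_rec2: _ => [|i a b _ <-]; rewrite ?dot0l ?dotDl.
Qed.

Lemma dot_sumr n (I : Type) (r : seq I) (Q : pred I) (f : I -> 'cV[R]_n) w :
  dot w (\sum_(i <- r | Q i) f i) = \sum_(i <- r | Q i) dot w (f i).
Proof. by rewrite dotC dot_suml; apply: eq_bigr => i _; rewrite dotC. Qed.

Lemma dot_ge0 n (u : 'cV[R]_n) : 0 <= dot u u.
Proof. by apply: sumr_ge0 => i _; rewrite -expr2 sqr_ge0. Qed.

Lemma norm2_ge0 n (u : 'cV[R]_n) : 0 <= norm2 u.
Proof. exact: sqrtr_ge0. Qed.
Hint Resolve norm2_ge0 : core.

Lemma norm2_sqr n (u : 'cV[R]_n) : norm2 u ^+ 2 = dot u u.
Proof. by rewrite sqr_sqrtr // dot_ge0. Qed.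

Lemma norm2_sqrE n (u : 'cV[R]_n) : norm2 u ^+ 2 = \sum_i u i 0 ^+ 2.
Proof. by rewrite norm2_sqr; apply: eq_bigr => i _; rewrite expr2. Qed.

Lemma norm2_eq0 n (u : 'cV[R]_n) : norm2 u = 0 -> u = 0.
Proof.
move=> u0; have : norm2 u ^+ 2 = 0 by rewrite u0 expr0n.
rewrite norm2_sqrE => /eqP; rewrite psumr_eq0; last by move=> *; exact: sqr_ge0.
move=> /allP H; apply/matrixP => i j; rewrite (ord1 j) mxE.
by have := H i (mem_index_enum _); rewrite sqrf_eq0 => /eqP.
Qed.

Lemma norm2N n (u : 'cV[R]_n) : norm2 (- u) = norm2 u.
Proof. by rewrite /norm2 dotNl dotNr opprK. Qed.

Lemma norm2Z n a (u : 'cV[R]_n) : 0 <= a -> norm2 (a *: u) = a * norm2 u.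
Proof.
by move=> a0; rewrite /norm2 dotZl dotZr mulrA -expr2 sqrtrM ?sqr_ge0//
  sqrtr_sqr ger0_norm.
Qed.

Lemma norm2B n (u v : 'cV[R]_n) : norm2 (u - v) = norm2 (v - u).
Proof. by rewrite -norm2N opprB. Qed.

Lemma coord_le_norm2 n (u : 'cV[R]_n) i : `|u i 0| <= norm2 u.
Proof.
rewrite -(ler_pXn2r (ltn0Sn 1)) ?nnegrE// norm2_sqrE real_normK ?num_real//.
by rewrite (bigD1 i)//= lerDl sumr_ge0// => j _; rewrite sqr_ge0.
Qed.

Lemma young (a u v : R) : 0 < a -> u * v <= u ^+ 2 / (4 * a) + a * v ^+ 2.
Proof.
move=> a0.
have : 0 <= (u - 2 * a * v) ^+ 2 / (4 * a).
  by rewrite divr_ge0 ?sqr_ge0// mulr_ge0// ltW.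
suff -> : (u - 2 * a * v) ^+ 2 / (4 * a) =
  u ^+ 2 / (4 * a) + a * v ^+ 2 - u * v by rewrite subr_ge0.
by field; rewrite gt_eqF.
Qed.

Lemma dot_le_norm2 n (u v : 'cV[R]_n) : dot u v <= norm2 u * norm2 v.
Proof.
have [v0|v0] := eqVneq (norm2 v) 0.
  by rewrite (norm2_eq0 v0) dot0r mulr_ge0.
have v1 : 0 < norm2 v by rewrite lt_def v0 norm2_ge0.
have [u0|u0] := eqVneq (norm2 u) 0.
  by rewrite (norm2_eq0 u0) dot0l mulr_ge0.
have u1 : 0 < norm2 u by rewrite lt_def u0 norm2_ge0.
have := dot_ge0 (norm2 v *: u - norm2 u *: v).
rewrite !(dotBl, dotBr, dotZl, dotZr) (dotC v u) -!norm2_sqr.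
move=> H.
have : 0 <= (2 * (norm2 u * norm2 v)) * (norm2 u * norm2 v - dot u v).
  by apply: le_trans H _; rewrite le_eqVlt; apply/orP; left; apply/eqP; ring.
by rewrite pmulr_rge0 ?subr_ge0// !mulr_gt0.
Qed.

Lemma abs_dot_le n (u v : 'cV[R]_n) : `|dot u v| <= norm2 u * norm2 v.
Proof.
rewrite ler_norml dot_le_norm2 andbT lerNl -dotNl.
by rewrite -(norm2N u) dot_le_norm2.
Qed.

Lemma norm2D n (u v : 'cV[R]_n) : norm2 (u + v) <= norm2 u + norm2 v.
Proof.
rewrite -(ler_pXn2r (ltn0Sn 1)) ?nnegrE ?addr_ge0//.
rewrite norm2_sqr dotDl !dotDr (dotC v u) sqrrD -!norm2_sqr.
have := dot_le_norm2 u v; lra.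
Qed.

Lemma norm2_sum n (I : Type) (r : seq I) (Q : pred I) (f : I -> 'cV[R]_n) :
  norm2 (\sum_(i <- r | Q i) f i) <= \sum_(i <- r | Q i) norm2 (f i).
Proof.
elim/big_rec2: _ => [|i a b _ ba]; first by rewrite /norm2 dot0l sqrtr0.
by rewrite (le_trans (norm2D _ _))// lerD2l.
Qed.

Lemma norm2_triangle n (u v w : 'cV[R]_n) :
  norm2 (u - w) <= norm2 (u - v) + norm2 (v - w).
Proof. by apply: le_trans (norm2D _ _); rewrite addrA subrK. Qed.

Lemma mulmx_colE n m (K : 'M[R]_(n, m)) (l : 'cV[R]_m) :
  K *m l = \sum_j l j 0 *: col j K.
Proof.
apply/matrixP => i j; rewrite (ord1 j) mxE summxE.
by apply: eq_bigr => k _; rewrite !mxE mulrC.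
Qed.

(** Cauchy-Schwarz across the columns: the column norms form a vector whose
    own norm dominates the operator norm. *)
Lemma norm2_mulmx_le n m (K : 'M[R]_(n, m)) (l : 'cV[R]_m) :
  norm2 (K *m l) ^+ 2 <= (\sum_j norm2 (col j K) ^+ 2) * norm2 l ^+ 2.
Proof.
pose c : 'cV[R]_m := \col_j norm2 (col j K).
pose a : 'cV[R]_m := \col_j `|l j 0|.
have -> : \sum_j norm2 (col j K) ^+ 2 = norm2 c ^+ 2.
  by rewrite norm2_sqrE; apply: eq_bigr => j _; rewrite mxE.
have -> : norm2 l ^+ 2 = norm2 a ^+ 2.
  by rewrite !norm2_sqrE; apply: eq_bigr => j _;
     rewrite mxE real_normK ?num_real.
rewrite -exprMn ler_pXn2r ?nnegrE ?mulr_ge0//.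
apply: le_trans (dot_le_norm2 _ _); rewrite mulmx_colE.
apply: le_trans (norm2_sum _ _ _) _; apply: ler_sum => j _; rewrite !mxE.
have -> : norm2 (l j 0 *: col j K) = norm2 (`|l j 0| *: col j K).
  by case: (ger0P (l j 0)) => // _; rewrite scaleNr norm2N.
by rewrite norm2Z// mulrC.
Qed.

End EuclideanGeometry.
#[local] Hint Resolve norm2_ge0 : core.
(** * Convexity, subgradients and proximal steps *)

Section ConvexSets.
Context {R : realType}.
Implicit Types n m : nat.

Lemma convex_combo n (X : set 'cV[R]_n) (x y : 'cV[R]_n) (s : R) :
  convex_set X -> X x -> X y -> 0 <= s -> s <= 1 ->
  X (s *: x + (1 - s) *: y).
Proof.
move=> cX Xx Xy s0 s1.
by have := cX x y (Itv01 s0 s1) (mem_set Xx) (mem_set Xy); rewrite inE.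
Qed.

Lemma convex_fun_combo n (X : set 'cV[R]_n) (f : 'cV[R]_n -> R)
    (x y : 'cV[R]_n) (s : R) :
  convex_function X f -> X x -> X y -> 0 <= s -> s <= 1 ->
  f (s *: x + (1 - s) *: y) <= s * f x + (1 - s) * f y.
Proof.
move=> cf Xx Xy s0 s1.
exact: (cf (Itv01 s0 s1) x y (mem_set Xx) (mem_set Xy)).
Qed.

Lemma ergodic_averageS n (x : nat -> 'cV[R]_n) (k : nat) :
  ergodic_average k.+2 x = (k.+2%:R^-1 : R) *: x k.+2
    + (1 - k.+2%:R^-1) *: ergodic_average k.+1 x.
Proof.
rewrite /ergodic_average big_ord_recr/= scalerDr scalerA addrC; congr (_ + _).
congr (_ *: _); rewrite -(natr1 k.+1); field.
by rewrite nat1r natr1 !pnatr_eq0.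
Qed.

Lemma ergodic_average1 n (x : nat -> 'cV[R]_n) : ergodic_average 1 x = x 1%N.
Proof. by rewrite /ergodic_average big_ord1 invr1 scale1r. Qed.

(** Jensen's inequality for running averages, by peeling off the last
    point: [k.+2^-1] is its weight in the next average. *)
Lemma jensen_average n (X : set 'cV[R]_n) (f : 'cV[R]_n -> R)
    (x : nat -> 'cV[R]_n) (T : nat) :
  convex_set X -> convex_function X f -> (0 < T)%N ->
  (forall t, (t < T)%N -> X (x t.+1)) ->
  X (ergodic_average T x) /\
  f (ergodic_average T x) <= T%:R^-1 * \sum_(t < T) f (x t.+1).
Proof.
move=> cX cf; case: T => // T _; elim: T => [|T IH] Xx.
  by rewrite ergodic_average1 big_ord1 invr1 mul1r; split => //; apply: Xx.
have [|Xa fa] := IH; first by move=> t tT; apply: Xx; rewrite ltnW.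
have s0 : 0 <= T.+2%:R^-1 :> R by rewrite invr_ge0.
have s1 : T.+2%:R^-1 <= 1 :> R by rewrite invf_le1// ler1n.
have XT := Xx T.+1 (ltnSn _).
rewrite ergodic_averageS; split; first exact: convex_combo.
apply: (le_trans (convex_fun_combo cf XT Xa s0 s1)).
rewrite big_ord_recr/= mulrDr addrC lerD2r.
have s2 : 0 <= 1 - T.+2%:R^-1 :> R by rewrite subr_ge0.
apply: le_trans (ler_wpM2l s2 fa) _; rewrite mulrA.
rewrite le_eqVlt; apply/orP; left; apply/eqP; congr (_ * _).
rewrite -(natr1 T.+1); field.
by rewrite nat1r natr1 !pnatr_eq0.
Qed.

Lemma convex_average n (X : set 'cV[R]_n) (x : nat -> 'cV[R]_n) (T : nat) :
  convex_set X -> (0 < T)%N -> (forall t, (t < T)%N -> X (x t.+1)) ->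
  X (ergodic_average T x).
Proof.
move=> cX T0 Xx; have := @jensen_average n X (fun=> 0) x T cX.
case=> // t u v _ _; change ((0 : R) <= t%:num * 0 + (1 - t%:num) * 0).
by rewrite !mulr0 addr0.
Qed.

Lemma cvg_dot n (u_ v_ : nat -> 'cV[R]_n) (u v : 'cV[R]_n) :
  u_ @ \oo --> u -> v_ @ \oo --> v ->
  (fun k => dot (u_ k) (v_ k)) @ \oo --> dot u v.
Proof.
move=> cu cv.
have := @cvg_big R 'I_n +%R 0 xpredT (@add_continuous R) nat \oo
  (index_enum _) (fun i k => u_ k i 0 * v_ k i 0) (fun i => u i 0 * v i 0) _.
apply=> i _; apply: cvgM.
- exact: (cvg_comp _ (fun x : 'cV[R]_n => x i 0) cu
            (@coord_continuous _ _ _ i 0 u)).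
- exact: (cvg_comp _ (fun x : 'cV[R]_n => x i 0) cv
            (@coord_continuous _ _ _ i 0 v)).
Qed.

Lemma norm2_continuous n : continuous (@norm2 R n).
Proof.
move=> x; apply: (@continuous_comp _ _ _ (fun x : 'cV[R]_n => dot x x)
  (@Num.sqrt R) x); last exact: sqrt_continuous.
move: x; have := @continuous_big R 'I_n +%R 0 xpredT (@add_continuous R) 'cV[R]_n
  (index_enum _) (fun i y => y i 0 * y i 0).
apply=> i _ y.
by apply: (@cvgM R _ (nbhs y)); exact: coord_continuous.
Qed.

Lemma subr_continuous n (q : 'cV[R]_n) :
  continuous (fun x : 'cV[R]_n => x - q).
Proof.
move=> x.
have H := (@cvgB R 'cV[R]_n _ (nbhs x) (nbhs_filter x) id (cst q) x q).
by apply: H; [exact: cvg_id|apply: (cvg_cst q)].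
Qed.

Lemma dist_continuous n (q : 'cV[R]_n) :
  continuous (fun x : 'cV[R]_n => norm2 (x - q)).
Proof.
move=> x; apply: (@continuous_comp _ _ _ (fun x : 'cV[R]_n => x - q)
  (@norm2 R n) x); [exact: subr_continuous|exact: norm2_continuous].
Qed.

Lemma cvg_norm2 n (u_ : nat -> 'cV[R]_n) (u : 'cV[R]_n) :
  u_ @ \oo --> u -> (fun k => norm2 (u_ k)) @ \oo --> norm2 u.
Proof. by move=> cu; exact: (cvg_comp _ _ cu (@norm2_continuous n u)). Qed.

Lemma compact_dist_bounded n (X : set 'cV[R]_n) : compact X ->
  exists K : R, forall x y, X x -> X y -> norm2 (x - y) <= K.
Proof.
move=> cX; have [X0|/set0P[x0 X0]] := eqVneq X set0.
  by exists 0 => x y; rewrite X0.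
have [||c _ cmax] := @compact_EVT_max _ R (fun x : 'cV[R]_n => norm2 (x - x0)) X _ cX.
- by exists x0.
- by apply: continuous_subspaceT; exact: dist_continuous.
exists (norm2 (c - x0) + norm2 (c - x0)) => x y Xx Xy.
apply: (le_trans (norm2_triangle x x0 y)); rewrite (norm2B x0).
by apply: lerD; apply: cmax; exact: mem_set.
Qed.

(** [diameter] is a supremum in [R], hence the need for a bound on the
    distances before it dominates each of them. *)
Lemma le_diameter n (X : set 'cV[R]_n) x y : compact X -> X x -> X y ->
  norm2 (x - y) <= diameter X.
Proof.
move=> /compact_dist_bounded[K HK] Xx Xy; apply: ub_le_sup; last by exists (x, y).
by exists K => _ [[a b] [Xa Xb] <-]; exact: HK.
Qed.

End ConvexSets.

Section Subgradients.
Context {R : realType}.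

(** A limit of Lipschitz-bounded subgradients is again a Lipschitz-bounded
    subgradient, so both facts reduce to relative interior points.  There the
    bound comes from testing the subgradient along itself: a small step in
    direction [v] stays in [X] because [v] lies in the span of [X - X]. *)
Lemma subdiffP n (X : set 'cV[R]_n) (f : 'cV[R]_n -> R) (M : R) x v :
  0 <= M ->
  (forall x1 x2, X x1 -> X x2 -> `|f x1 - f x2| <= M * norm2 (x1 - x2)) ->
  subdiff X f x v ->
  (forall y, X y -> f x + dot v (y - x) <= f y) /\ norm2 v <= M.
Proof.
move=> M0 fL.
have int z w : relint X z -> span_subgradient X f z w ->
    (forall y, X y -> f z + dot w (y - z) <= f y) /\ norm2 w <= M.
  move=> [Xz [e e0 He]] [sw Hw]; split => //.
  have [w0|w0] := eqVneq (norm2 w) 0; first by rewrite w0.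
  have w1 : 0 < norm2 w by rewrite lt_def w0 norm2_ge0.
  pose s := e / (2 * norm2 w).
  have s0 : 0 < s by rewrite divr_gt0// mulr_gt0.
  have Xs : X (z + s *: w).
    apply: He.
      case: sw => k [c [a [b [ab ->]]]].
      exists k, (fun i => s * c i), a, b; split => //.
      by rewrite scaler_sumr; apply: eq_bigr => i _; rewrite scalerA.
    rewrite (norm2Z _ (ltW s0)) /s.
    have -> : e / (2 * norm2 w) * norm2 w = e / 2 by field.
    lra.
  have := Hw _ Xs; have := fL _ _ Xs Xz.
  have -> : z + s *: w - z = s *: w by rewrite addrC addKr.
  rewrite dotZr -norm2_sqr (norm2Z _ (ltW s0)) => h1 h2.
  have h3 : s * norm2 w ^+ 2 <= M * (s * norm2 w).
    by apply: le_trans (le_trans (ler_norm _) h1); rewrite lerBrDl.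
  have sw0 : 0 < s * norm2 w by rewrite mulr_gt0.
  rewrite -(ler_pM2r sw0).
  by apply: le_trans h3; rewrite expr2 mulrCA.
case=> [[]|[Xx _ [y_ [v_ [ry sv cy cv]]]]]; first exact: int.
have cf : (fun k => f (y_ k)) @ \oo --> f x.
  have cn : (fun k => M * norm2 (y_ k - x)) @ \oo --> (0 : R).
    have -> : (0 : R) = M * norm2 (x - x).
      by rewrite subrr /norm2 dot0l sqrtr0 mulr0.
    apply: cvgM; first exact: cvg_cst.
    by apply: cvg_norm2; apply: cvgB => //; exact: cvg_cst.
  have cn' : (fun k => f x - M * norm2 (y_ k - x)) @ \oo --> f x.
    by rewrite -[X in _ --> X]subr0; apply: cvgB => //; exact: cvg_cst.
  have cn'' : (fun k => f x + M * norm2 (y_ k - x)) @ \oo --> f x.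
    by rewrite -[X in _ --> X]addr0; apply: cvgD => //; exact: cvg_cst.
  apply: (squeeze_cvgr _ cn' cn''); near=> k.
  by have := fL _ _ (ry k).1 Xx; rewrite ler_norml => /andP[]; lra.
split.
- move=> y Xy.
  have c : (fun k => f (y_ k) + dot (v_ k) (y - y_ k)) @ \oo
      --> f x + dot v (y - x).
    apply: cvgD => //; apply: cvg_dot => //.
    by apply: cvgB => //; exact: cvg_cst.
  apply: (cvgr_to_le c); near=> k.
  by have [] := int _ _ (ry k) (sv k) => + _; exact.
- apply: (cvgr_to_le (cvg_norm2 cv)); near=> k.
  by have [] := int _ _ (ry k) (sv k).
Unshelve. all: by end_near. Qed.

End Subgradients.

Section Prox.
Context {R : realType}.

(** Division by [s] and [s -> 0]; the explicit [s = - a / (b - a)] replaces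
    the limit. *)
Lemma slope_ge0 (a b : R) : 0 <= b ->
  (forall s, 0 < s -> s <= 1 -> 0 <= s * a + s ^+ 2 * b) -> 0 <= a.
Proof.
move=> b0 H; rewrite leNgt; apply/negP => a0.
have ba : 0 < b - a by lra.
pose s := - a / (b - a).
have s0 : 0 < s by rewrite divr_gt0// oppr_gt0.
have s1 : s <= 1 by rewrite ler_pdivrMr// mul1r; lra.
have := H _ s0 s1; rewrite expr2 -mulrA -mulrDr pmulr_rge0//.
have -> : a + s * b = - (a ^+ 2 / (b - a)) by rewrite /s; field; rewrite gt_eqF.
by rewrite oppr_ge0 leNgt divr_gt0// exprn_even_gt0//= lt_eqF.
Qed.

Lemma argmin_vi n (S : set 'cV[R]_n) (c p x : 'cV[R]_n) (eta : R) :
  convex_set S -> 0 < eta ->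
  is_argmin S (fun y => dot c y + eta / 2 * norm2 (y - p) ^+ 2) x ->
  forall y, S y -> 0 <= dot (c + eta *: (x - p)) (y - x).
Proof.
move=> cS eta0 [Sx xmin] y Sy.
apply: (@slope_ge0 _ (eta / 2 * norm2 (y - x) ^+ 2)).
  by rewrite mulr_ge0 ?divr_ge0 ?sqr_ge0// ltW.
move=> s s0 s1.
have := xmin _ (convex_combo cS Sy Sx (ltW s0) s1).
have -> : s *: y + (1 - s) *: x = x + s *: (y - x).
  by rewrite scalerBl scale1r scalerBr addrCA.
have -> : x + s *: (y - x) - p = (x - p) + s *: (y - x) by rewrite addrAC.
rewrite -subr_ge0 !norm2_sqr; move: (x - p) (y - x) => u v.
rewrite !(dotDl, dotDr, dotZl, dotZr) (dotC v u) => h.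
apply: (le_trans h); rewrite le_eqVlt; apply/orP; left; apply/eqP.
by field.
Qed.

(** The three-point inequality of a proximal step: its optimality condition,
    rewritten by the cosine law. *)
Lemma prox_ineq n (S : set 'cV[R]_n) (c p x : 'cV[R]_n) (eta : R) :
  convex_set S -> 0 < eta ->
  is_argmin S (fun y => dot c y + eta / 2 * norm2 (y - p) ^+ 2) x ->
  forall y, S y -> dot c (x - y) <=
    eta / 2 * (norm2 (y - p) ^+ 2 - norm2 (y - x) ^+ 2 - norm2 (x - p) ^+ 2).
Proof.
move=> cS eta0 xm y Sy; have := argmin_vi cS eta0 xm Sy.
have -> : y - p = (y - x) + (x - p) by rewrite addrA subrK.
have -> : x - y = - (y - x) by rewrite opprB.
rewrite !norm2_sqr; move: (x - p) (y - x) => u v.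
rewrite !(dotDl, dotDr, dotZl, dotZr, dotNr) (dotC v u) => h; lra.
Qed.

(** Euclidean projection, specified by its variational characterization so
    that the optimality condition of a proximal step identifies it. *)
Definition is_proj n (S : set 'cV[R]_n) (q x : 'cV[R]_n) : Prop :=
  S x /\ forall y, S y -> dot (q - x) (y - x) <= 0.

Lemma is_proj_nonexpansive n (S : set 'cV[R]_n) (q q' x x' : 'cV[R]_n) :
  is_proj S q x -> is_proj S q' x' -> norm2 (x - x') <= norm2 (q - q').
Proof.
move=> [Sx H] [Sx' H'].
have [d0|d0] := eqVneq (norm2 (x - x')) 0; first by rewrite d0 norm2_ge0.
have d1 : 0 < norm2 (x - x') by rewrite lt_def d0 norm2_ge0.
rewrite -(ler_pM2r d1) -expr2 norm2_sqr; apply: le_trans (dot_le_norm2 _ _).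
have := H _ Sx'; have := H' _ Sx; rewrite !(dotBl, dotBr).
rewrite (dotC x' x); lra.
Qed.

Lemma is_proj_unique n (S : set 'cV[R]_n) (q x x' : 'cV[R]_n) :
  is_proj S q x -> is_proj S q x' -> x = x'.
Proof.
move=> h h'; have := is_proj_nonexpansive h h'.
rewrite subrr [X in _ <= X]/norm2 dot0l sqrtr0 => h0.
by apply/eqP; rewrite -subr_eq0; apply/eqP/norm2_eq0/eqP;
  rewrite eq_le h0 norm2_ge0.
Qed.

(** A proximal step projects the explicit gradient step; together with
    [proj_continuous] this makes the primal iterates Borel functions of the
    data. *)
Lemma is_proj_argmin n (S : set 'cV[R]_n) (c p x : 'cV[R]_n) (eta : R) :
  convex_set S -> 0 < eta ->
  is_argmin S (fun y => dot c y + eta / 2 * norm2 (y - p) ^+ 2) x ->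
  is_proj S (p - eta^-1 *: c) x.
Proof.
move=> cS eta0 xm; split; first by case: xm.
move=> y Sy; have := argmin_vi cS eta0 xm Sy.
have -> : c + eta *: (x - p) = - eta *: (p - eta^-1 *: c - x).
  by apply/matrixP => i j; rewrite !mxE; field; rewrite gt_eqF.
by rewrite dotZl mulNr oppr_ge0 pmulr_rle0.
Qed.

Lemma is_proj_exists n (S : set 'cV[R]_n) (q : 'cV[R]_n) :
  convex_set S -> compact S -> S !=set0 -> exists x, is_proj S q x.
Proof.
move=> cS kS S0.
have [x [Sx xmin]] : exists x : 'cV[R]_n,
    S x /\ forall t, S t -> norm2 (x - q) <= norm2 (t - q).
  have [|x /set_mem Sx xmin] :=
    @compact_EVT_min _ R (fun x : 'cV[R]_n => norm2 (x - q)) S S0 kS.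
    by apply: continuous_subspaceT; exact: dist_continuous.
  by exists x; split => // t /mem_set; exact: xmin.
exists x; have -> : q = q - (2 : R)^-1 *: 0 by rewrite scaler0 subr0.
apply: is_proj_argmin => //; split => // y Sy.
rewrite !dot0l !add0r divff ?mul1r ?pnatr_eq0//.
by rewrite (ler_pXn2r (ltn0Sn 1)) ?nnegrE; [exact: xmin|exact: norm2_ge0|exact: norm2_ge0].
Qed.

(** Chosen through the variational characterization; 0 is the default where
    no projection exists. *)
Definition proj n (S : set 'cV[R]_n) (q : 'cV[R]_n) : 'cV[R]_n :=
  xget 0 (is_proj S q).

Lemma projP n (S : set 'cV[R]_n) (q : 'cV[R]_n) :
  convex_set S -> compact S -> S !=set0 -> is_proj S q (proj S q).
Proof. by move=> cS kS S0; apply: xgetPex; exact: is_proj_exists. Qed.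

Lemma proj_continuous n (S : set 'cV[R]_n) :
  convex_set S -> compact S -> S !=set0 -> continuous (proj S).
Proof.
move=> cS kS S0 q A /nbhs_ballP[e /= e0 eA].
have : nbhs q [set q' | norm2 (q' - q) < e].
  have := @dist_continuous R n q q _ (nbhsx_ballx _ _ e0).
  apply: (@filterS _ (nbhs q) (nbhs_filter q)) => q' /=.
  rewrite /ball/= subrr.
  have -> : norm2 (0 : 'cV[R]_n) = 0 by rewrite /norm2 dot0l sqrtr0.
  by rewrite sub0r normrN ger0_norm// norm2_ge0.
apply: (@filterS _ (nbhs q) (nbhs_filter q)) => q' /= h; apply: eA; split => // i j.
rewrite (ord1 j) /ball/=.
have -> : proj S q i 0 - proj S q' i 0 = (proj S q - proj S q') i 0.
  by rewrite !mxE.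
apply: le_lt_trans (coord_le_norm2 _ _) _.
apply: le_lt_trans (is_proj_nonexpansive (projP q cS kS S0)
                                         (projP q' cS kS S0)) _.
by rewrite norm2B.
Qed.

Lemma nonneg_orthant_convex m : convex_set (@nonneg_orthant R m).
Proof.
move=> x y s; rewrite !inE => x0 y0 j.
change (0 <= (s%:num *: x + (1 - s%:num) *: y) j 0).
by rewrite !mxE addr_ge0// mulr_ge0//.
Qed.

Lemma is_proj_pos_part m (q : 'cV[R]_m) :
  is_proj (@nonneg_orthant R m) q (pos_part q).
Proof.
split=> [j|y y0]; first by rewrite mxE le_max lexx orbT.
apply: sumr_le0 => j _; rewrite !mxE.
have := y0 j; case: (leP (q j 0) 0) => q0 yj; last by rewrite subrr mul0r.
by rewrite !subr0 mulr_le0_ge0.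
Qed.

End Prox.
(** * The gap along one trajectory *)

Section Pathwise.
Context {R : realType} (n m : nat).
Variables (X : set 'cV[R]_n) (F : 'cV[R]_n -> 'cV[R]_n) (L H : R).
Variables (g : 'cV[R]_n -> 'cV[R]_m) (g' : 'cV[R]_n -> 'M[R]_(n, m)) (Mg : R).
Variables (eta tau : R) (T : nat).
Variables (Fs : nat -> 'cV[R]_n) (gs : nat -> 'cV[R]_m).
Variables (Gs : nat -> 'M[R]_(n, m)) (x : nat -> 'cV[R]_n) (l : nat -> 'cV[R]_m).

Let Fprev t := if t is t'.+1 then Fs t' else Fs 0%N.

Hypothesis X_convex : convex_set X.
Hypothesis L_ge0 : 0 <= L.
Hypothesis F_growth : forall x1 x2, X x1 -> X x2 ->
  norm2 (F x1 - F x2) <= L * norm2 (x1 - x2) + H.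
Hypothesis Mg_ge0 : 0 <= Mg.
Hypothesis g_lip : forall x1 x2, X x1 -> X x2 ->
  norm2 (g x1 - g x2) <= Mg * norm2 (x1 - x2).
Hypothesis g'_sub : forall x y, X x -> X y -> forall j,
  g x j 0 + dot (col j (g' x)) (y - x) <= g y j 0.
Hypothesis g'_bound : forall x l, X x -> norm2 (g' x *m l) <= Mg * norm2 l.
Hypothesis eta_gt0 : 0 < eta.
Hypothesis tau_gt0 : 0 < tau.
Hypothesis L_eta : 25 * L <= 3 * eta.
Hypothesis x0_in : X (x 0%N).
Hypothesis l0 : l 0%N = 0.
Hypothesis dual_step : forall t, (t < T)%N ->
  is_argmin nonneg_orthant
    (fun k => - dot (gs t) k + tau / 2 * norm2 (k - l t) ^+ 2) (l t.+1).
Hypothesis primal_step : forall t, (t < T)%N ->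
  is_argmin X
    (fun y => dot ((1 + 1) *: Fs t - 1 *: Fprev t + Gs t *m l t.+1) y
              + eta / 2 * norm2 (y - x t) ^+ 2) (x t.+1).

Definition F_noise t := Fs t - F (x t).
Definition g_noise t := gs t - g (x t).
Definition G_noise t := (Gs t - g' (x t)) *m l t.+1.

(** What the growth condition leaves of [norm2 (Fs t - Fs t.-1)] besides the
    Lipschitz part; zero at the start because [Fs (-1) = Fs 0]. *)
Definition F_jump t :=
  if t is t'.+1 then H + norm2 (F_noise t - F_noise t') else 0.

Let d t := norm2 (x t - x t.-1).
Let dF t := Fs t - Fprev t.

Lemma iterate_in t : (t <= T)%N -> X (x t).
Proof. by case: t => // t /primal_step[]. Qed.

Lemma multiplier_ge0 t : (t <= T)%N -> nonneg_orthant (l t).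
Proof.
case: t => [_ j|t /dual_step[]//]; by rewrite l0 mxE.
Qed.

Let dF_le t : (t <= T)%N -> norm2 (dF t) <= L * d t + F_jump t.
Proof.
case: t => [_|t tT].
  by rewrite /dF /d /= !subrr /norm2 dot0l sqrtr0 mulr0 addr0.
rewrite /dF /d /=; have Xt := iterate_in tT; have Xt' := iterate_in (ltnW tT).
have -> : Fs t.+1 - Fs t =
    (F (x t.+1) - F (x t)) + (F_noise t.+1 - F_noise t).
  by apply/matrixP => i j; rewrite !mxE; ring.
by apply: le_trans (norm2D _ _) _; rewrite addrA lerD2r; exact: F_growth.
Qed.

Let young_eta (c u v : R) : 0 < c ->
  u * v <= c * (u ^+ 2 / eta) + eta / (4 * c) * v ^+ 2.
Proof.
move=> c0; have a0 : 0 < eta / (4 * c) by rewrite divr_gt0// mulr_gt0.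
apply: le_trans (young u v a0) _; rewrite lerD2r le_eqVlt; apply/orP; left.
by apply/eqP; field; rewrite !gt_eqF.
Qed.

(** The two optimality conditions of one iteration, added up.  The constraint
    terms [dot lam (g (x t))] and [dot (l t.+1) (g (x t))] are traded for the
    ones in the gap through convexity and the Lipschitz bound, and the
    extrapolated operator telescopes. *)
Let one_step t y lam : (t < T)%N -> X y -> nonneg_orthant lam ->
  dot (F (x t.+1)) (x t.+1 - y) + dot lam (g (x t.+1)) - dot (l t.+1) (g y)
  <= eta / 2 * (norm2 (y - x t) ^+ 2 - norm2 (y - x t.+1) ^+ 2
                - d t.+1 ^+ 2)
   + tau / 2 * (norm2 (lam - l t) ^+ 2 - norm2 (lam - l t.+1) ^+ 2)
   + dot (dF t.+1) (x t.+1 - y) - dot (dF t) (x t - y)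
   + (L * d t + F_jump t) * d t.+1
   + (Mg * norm2 (l t.+1)) * d t.+1 + (Mg * norm2 lam) * d t.+1
   + norm2 (G_noise t) * d t.+1 + norm2 (g_noise t) ^+ 2 / (2 * tau)
   - dot (F_noise t.+1) (x t.+1 - y) - dot (G_noise t) (x t - y)
   + dot (g_noise t) (l t - lam).
Proof.
move=> tT Xy lam0.
have Xt := iterate_in (ltnW tT); have Xt1 := iterate_in tT.
have l1 := multiplier_ge0 tT.
have Dm : is_argmin (@nonneg_orthant R m)
    (fun k => dot (- gs t) k + tau / 2 * norm2 (k - l t) ^+ 2) (l t.+1).
  by split=> // k k0; rewrite !dotNl; have [_] := dual_step tT; exact.
have D := prox_ineq (@nonneg_orthant_convex R m) tau_gt0 Dm lam0.
have P := prox_ineq X_convex eta_gt0 (primal_step tT) Xy.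
(* [Fs t] is [Fs t.+1 - dF t.+1]: the operator is moved to the new point and
   the increments [dF] telescope. *)
have E1 : dot ((1 + 1) *: Fs t - 1 *: Fprev t + Gs t *m l t.+1) (x t.+1 - y)
  = dot (F (x t.+1)) (x t.+1 - y) + dot (F_noise t.+1) (x t.+1 - y)
    - dot (dF t.+1) (x t.+1 - y) + dot (dF t) (x t - y)
    + dot (dF t) (x t.+1 - x t)
    + dot (G_noise t) (x t - y) + dot (G_noise t) (x t.+1 - x t)
    + dot (g' (x t) *m l t.+1) (x t - y)
    + dot (g' (x t) *m l t.+1) (x t.+1 - x t).
  rewrite /F_noise /G_noise /dF /= mulmxBl.
  move: (Gs t *m l t.+1) (g' (x t) *m l t.+1) => a b.
  by rewrite !(dotBl, dotDl, dotZl, dotBr); ring.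
have E2 : - dot (gs t) (l t.+1 - lam) = - dot (l t.+1) (g (x t))
    - dot (g_noise t) (l t - lam) - dot (g_noise t) (l t.+1 - l t)
    + dot lam (g (x t)).
  rewrite /g_noise !(dotBl, dotBr) !(dotC (g (x t))); ring.
(* The subgradient inequalities are summed with the weights [l t.+1 >= 0]. *)
have C1 : dot (l t.+1) (g (x t)) - dot (l t.+1) (g y)
    <= dot (g' (x t) *m l t.+1) (x t - y).
  rewrite mulmx_colE dot_suml -dotBr; apply: ler_sum => j _.
  rewrite dotZl; apply: ler_wpM2l; first exact: l1.
  have := g'_sub Xt Xy j; rewrite -(opprB (x t) y) dotNr !mxE; lra.
have C2 : - dot (g' (x t) *m l t.+1) (x t.+1 - x t)
    <= Mg * norm2 (l t.+1) * d t.+1.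
  apply: le_trans (ler_norm _) _; rewrite normrN.
  apply: le_trans (abs_dot_le _ _) _; apply: ler_wpM2r; first exact: norm2_ge0.
  exact: g'_bound.
have C3 : dot lam (g (x t.+1)) - dot lam (g (x t)) <= Mg * norm2 lam * d t.+1.
  rewrite -dotBr; apply: le_trans (dot_le_norm2 _ _) _.
  apply: le_trans (ler_wpM2l (norm2_ge0 _) (g_lip Xt1 Xt)) _.
  by rewrite mulrCA mulrA.
have C4 : - dot (G_noise t) (x t.+1 - x t) <= norm2 (G_noise t) * d t.+1.
  apply: le_trans (ler_norm _) _; rewrite normrN; exact: abs_dot_le.
have C5 : dot (g_noise t) (l t.+1 - l t) <=
    norm2 (g_noise t) ^+ 2 / (2 * tau) + tau / 2 * norm2 (l t.+1 - l t) ^+ 2.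
  apply: le_trans (dot_le_norm2 _ _) _.
  have t2 : 0 < tau / 2 by rewrite divr_gt0.
  apply: le_trans (young _ _ t2) _; rewrite lerD2r.
  by have -> : 4 * (tau / 2) = 2 * tau by field.
have C6 : - dot (dF t) (x t.+1 - x t) <= (L * d t + F_jump t) * d t.+1.
  apply: le_trans (ler_norm _) _; rewrite normrN.
  apply: le_trans (abs_dot_le _ _) _; apply: ler_wpM2r; first exact: norm2_ge0.
  exact/dF_le/ltnW.
move: D; rewrite dotNl E2 => D.
have dE : norm2 (x t.+1 - x t) = d t.+1 by [].
move: P; rewrite E1 dE => P.
move: D P C1 C2 C3 C4 C5 C6; move: (d t.+1) => d1.
lra.
Qed.

(** The squares that Young's inequality produces in one step; [c] stands for
    the norm of the reference multiplier. *)
Definition error_term (c : R) t :=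
  norm2 (g_noise t) ^+ 2 / (2 * tau) + 5 / 4 * (F_jump t.+1 ^+ 2 / eta)
  + 5 / 2 * ((Mg * norm2 (l t.+1)) ^+ 2 / eta)
  + 25 / 4 * (norm2 (G_noise t) ^+ 2 / eta)
  + 25 / 4 * ((Mg * c) ^+ 2 / eta).

Lemma error_term_ge0 c t : 0 <= error_term c t.
Proof.
have e0 : 0 <= eta^-1 by rewrite invr_ge0 ltW.
have t0 : 0 <= (2 * tau)^-1 by rewrite invr_ge0 mulr_ge0// ltW.
have h (a b : R) : 0 <= a -> 0 <= a * (b ^+ 2 / eta).
  by move=> a0; rewrite mulr_ge0// mulr_ge0 ?sqr_ge0.
by rewrite /error_term !addr_ge0 ?h// mulr_ge0 ?sqr_ge0.
Qed.

Lemma error_term_le c1 c2 t : 0 <= c1 -> c1 <= c2 ->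
  error_term c1 t <= error_term c2 t.
Proof.
move=> c0 cc.
have e0 : 0 <= eta^-1 by rewrite invr_ge0 ltW.
have h : (Mg * c1) ^+ 2 <= (Mg * c2) ^+ 2.
  by rewrite !exprMn ler_wpM2l ?sqr_ge0// ler_pXn2r ?nnegrE// (le_trans c0).
by rewrite /error_term lerD2l ler_wpM2l// ler_wpM2r.
Qed.

Definition noise_term (y : 'cV[R]_n) (lam : 'cV[R]_m) t :=
  - dot (F_noise t.+1) (x t.+1 - y) - dot (G_noise t) (x t - y)
  + dot (g_noise t) (l t - lam).

(** Invariant of the telescoping.  Young's inequality spends the negative
    quadratic [- eta / 2 * d ^+ 2] as
    [eta * (1/5 + 1/10 + 1/25 + 1/25) + L <= eta / 2]; the half of [L] that
    is due to the previous step is carried over as [- L / 2 * d k ^+ 2]. *)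
Let partial_sum k y lam : (k <= T)%N -> X y -> nonneg_orthant lam ->
  \sum_(t < k) (dot (F (x t.+1)) (x t.+1 - y) + dot lam (g (x t.+1))
                - dot (l t.+1) (g y))
  <= eta / 2 * (norm2 (y - x 0%N) ^+ 2 - norm2 (y - x k) ^+ 2)
   + tau / 2 * (norm2 lam ^+ 2 - norm2 (lam - l k) ^+ 2)
   + dot (dF k) (x k - y) - L / 2 * d k ^+ 2 - 5 / 4 * (F_jump k ^+ 2 / eta)
   + \sum_(t < k) error_term (norm2 lam) t + \sum_(t < k) noise_term y lam t.
Proof.
move=> + Xy lam0; elim: k => [_|k IH kT].
  rewrite !big_ord0 /dF /d /= !subrr l0 subr0 dot0l /F_jump.
  by rewrite {3}/norm2 dot0l sqrtr0 subrr expr0n/= !mul0r !mulr0 !addr0 !subr0.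
rewrite !big_ord_recr/=; have {}IH := IH (ltnW kT).
have S := one_step kT Xy lam0.
have Y1 := @young_eta (5 / 4) (F_jump k) (d k.+1) ltac:(lra).
have Y2 := @young_eta (5 / 2) (Mg * norm2 (l k.+1)) (d k.+1) ltac:(lra).
have Y3 := @young_eta (25 / 4) (Mg * norm2 lam) (d k.+1) ltac:(lra).
have Y4 := @young_eta (25 / 4) (norm2 (G_noise k)) (d k.+1) ltac:(lra).
have Y5 : L * d k * d k.+1 <= L / 2 * d k ^+ 2 + L / 2 * d k.+1 ^+ 2.
  have := mulr_ge0 L_ge0 (sqr_ge0 (d k - d k.+1)); rewrite sqrrB; lra.
have Y6 : L * d k.+1 ^+ 2 <= 3 / 25 * eta * d k.+1 ^+ 2.
  by apply: ler_wpM2r; [exact: sqr_ge0|move: L_eta; lra].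
rewrite [X in _ <= _ + (_ + X) + _]/error_term [X in _ <= _ + (_ + X)]/noise_term.
have q1 : eta / (4 * (5 / 4)) = eta / 5 by field.
have q2 : eta / (4 * (5 / 2)) = eta / 10 by field.
have q3 : eta / (4 * (25 / 4)) = eta / 25 by field.
move: Y1 Y2 Y3 Y4; rewrite q1 q2 !q3 => Y1 Y2 Y3 Y4.
have Z : (L * d k + F_jump k) * d k.+1 = L * d k * d k.+1 + F_jump k * d k.+1.
  by rewrite mulrDl.
rewrite Z in S.
have Ej : H + norm2 (F_noise k.+1 - F_noise k) = F_jump k.+1 by [].
rewrite Ej; lra.
Qed.

(** The increment [dF k] left at the end of the telescoping is absorbed by the
    distance from [y] to the last iterate. *)
Lemma gap_sum_le k y lam : (k <= T)%N -> X y -> nonneg_orthant lam ->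
  \sum_(t < k) (dot (F (x t.+1)) (x t.+1 - y) + dot lam (g (x t.+1))
                - dot (l t.+1) (g y))
  + tau / 2 * norm2 (lam - l k) ^+ 2
  <= eta / 2 * norm2 (y - x 0%N) ^+ 2 + tau / 2 * norm2 lam ^+ 2
   + \sum_(t < k) error_term (norm2 lam) t + \sum_(t < k) noise_term y lam t.
Proof.
move=> kT Xy lam0; have := partial_sum kT Xy lam0.
have B : dot (dF k) (x k - y) <= L / 2 * d k ^+ 2
    + 5 / 4 * (F_jump k ^+ 2 / eta) + eta / 2 * norm2 (y - x k) ^+ 2.
  rewrite (norm2B y); apply: le_trans (dot_le_norm2 _ _) _.
  have e0 : 0 <= norm2 (x k - y) by exact: norm2_ge0.
  apply: le_trans (ler_wpM2r e0 (dF_le kT)) _.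
  have := @young_eta (5 / 4) (F_jump k) (norm2 (x k - y)) ltac:(lra).
  have -> : eta / (4 * (5 / 4)) = eta / 5 by field.
  have Y5 : L * d k * norm2 (x k - y)
      <= L / 2 * d k ^+ 2 + L / 2 * norm2 (x k - y) ^+ 2.
    have := mulr_ge0 L_ge0 (sqr_ge0 (d k - norm2 (x k - y))).
    rewrite sqrrB; lra.
  have Y6 : L * norm2 (x k - y) ^+ 2 <= 3 / 25 * eta * norm2 (x k - y) ^+ 2.
    by apply: ler_wpM2r; [exact: sqr_ge0|move: L_eta; lra].
  have Y7 := mulr_ge0 (ltW eta_gt0) (sqr_ge0 (norm2 (x k - y))).
  rewrite mulrDl; lra.
lra.
Qed.

End Pathwise.
(** * Borel sets of vectors and independence of the past *)

Section BorelVectors.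
Context {R : realType} (n : nat).

Lemma borelV_open (U : set 'cV[R]_n) :
  open U -> measurable (U : set (borelV R n)).
Proof. exact: sub_sigma_algebra. Qed.

Lemma borelV_compact (X : set 'cV[R]_n) :
  compact X -> measurable (X : set (borelV R n)).
Proof.
move=> cX; have clX : closed X.
  by apply: compact_closed => //; exact: norm_hausdorff.
rewrite -(setCK X); apply: (@measurableC _ (borelV R n)).
by apply: borelV_open; exact: closed_openC.
Qed.

Lemma continuous_borelV (f : 'cV[R]_n -> R) :
  continuous f -> measurable_fun setT (f : borelV R n -> R).
Proof.
move=> /continuousP cf; apply: (measurability _ (RGenOpens.measurableE R)).
move=> _ [_ [a [b ->] <-]]; rewrite setTI.
by apply: borelV_open; apply: cf; exact: interval_open.
Qed.

Lemma measurable_coord i :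
  measurable_fun setT (fun v : borelV R n => v i 0).
Proof. by apply: continuous_borelV; exact: coord_continuous. Qed.

(** Every open set is a countable union of rational boxes, so the Borel
    sigma-algebra is generated by the coordinates. *)
Lemma measurable_borelV d (T : measurableType d) (f : T -> borelV R n) :
  (forall i, measurable_fun setT (fun w => f w i 0)) ->
  measurable_fun setT f.
Proof.
move=> mf; apply: (@measurability _ _ _ (borelV R n) setT _ (@open 'cV[R]_n) erefl).
move=> _ [U oU <-].
rewrite setTI.
pose box (q : 'cV[rat]_n * nat) : set 'cV[R]_n :=
  [set v | forall i, `|v i 0 - ratr (q.1 i 0)| < q.2.+1%:R^-1].
pose B q := if `[< box q `<=` U >] then f @^-1` box q else set0.
have -> : f @^-1` U = \bigcup_q B q.
  apply/seteqP; split => [w /= Uw|w [q _]]; last first.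
    by rewrite /B; case: asboolP => // qU /= /qU.
  have /nbhs_ballP[e /= e0 eU] : nbhs (f w : 'cV[R]_n) U by exact: open_nbhs_nbhs.
  have [k ke] : exists k : nat, k.+1%:R^-1 < e / 2.
    have [k _ /(_ k (leqnn k)) h] := @near_infty_natSinv_lt R (PosNum (divr_gt0 e0 (@ltr0n R 2))).
    by exists k.
  have mid (a b c : R) : b - a < c -> c < b + a -> `|b - c| < a.
    by move=> h1 h2; rewrite ltr_norml; apply/andP; split; lra.
  have tri (a b c r : R) :
      `|a - c| < r -> `|b - c| < r -> r < e / 2 -> `|a - b| < e.
    by rewrite !ltr_norml => /andP[? ?] /andP[? ?] ?; apply/andP; split; lra.
  have ex i : exists q : rat, `|f w i 0 - ratr q| < k.+1%:R^-1 :> R.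
    have [|q] := @rat_in_itvoo R (f w i 0 - k.+1%:R^-1) (f w i 0 + k.+1%:R^-1).
      by rewrite ltrBlDr -addrA ltrDl addr_gt0 ?invr_gt0.
    rewrite in_itv/= => /andP[q1 q2]; exists q.
    exact: mid.
  have [c cP] := choice ex.
  exists (\col_i c i, k) => //; rewrite /B; case: asboolP => [_|].
    by move=> i /=; rewrite mxE.
  move=> []; move=> v /= vc; apply: eU; split => // i j.
  rewrite (ord1 j) /ball/=; have := vc i; rewrite mxE => v1.
  exact: (tri _ _ _ _ (cP i) v1 ke).
apply: countable_bigcupT_measurable => // q; rewrite /B.
case: asboolP => // _.
have -> : f @^-1` box q = \bigcap_(i in [set: 'I_n])
    [set w | `|f w i 0 - ratr (q.1 i 0)| < q.2.+1%:R^-1].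
  by apply/seteqP; split => [w h i _|w h i]; [exact: h|exact: h].
apply: fin_bigcap_measurable => [|i _]; first exact: finite_finset.
have -> : [set w | `|f w i 0 - ratr (q.1 i 0)| < q.2.+1%:R^-1] =
    (fun w => f w i 0) @^-1` ball (ratr (q.1 i 0) : R) q.2.+1%:R^-1.
  by apply/seteqP; split => w /=; rewrite /ball/= distrC.
rewrite -[X in measurable X]setTI; apply: mf => //.
exact: measurable_ball.
Qed.

Lemma measurable_proj (S : set 'cV[R]_n) : convex_set S -> compact S ->
  S !=set0 -> measurable_fun setT (proj S : borelV R n -> borelV R n).
Proof.
move=> cS kS S0; apply: (@measurability _ _ _ (borelV R n) setT _ (@open 'cV[R]_n) erefl).
move=> _ [U oU <-].
rewrite setTI; apply: borelV_open.
by have /continuousP := proj_continuous cS kS S0; exact.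
Qed.

End BorelVectors.

Section Information.
Context d (Om : measurableType d) {R : realType} (P : probability Om R).
Context d' (Xi : measurableType d') (I : eqType) (Z : I -> {RV P >-> Xi}).

(** The sigma-algebra of the samples with index in [J]; it is generated by
    the finite intersections below, which form a pi-system because [J] is a
    fixed finite list. *)
Definition cylinders (J : seq I) : set (set Om) :=
  [set A | exists E : I -> set Xi, (forall i, measurable (E i)) /\
     A = \bigcap_(i in [set` J]) Z i @^-1` E i].

Definition infoT (J : seq I) := g_sigma_algebraType (cylinders J).

Definition adapted (J : seq I) d2 (S : measurableType d2) (f : Om -> S) :=
  measurable_fun setT (f : infoT J -> S).

Lemma cylindersI J : setI_closed (cylinders J).
Proof.
move=> _ _ [E [mE ->]] [E' [mE' ->]]; exists (fun i => E i `&` E' i); split.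
  by move=> i; exact: measurableI.
by rewrite -bigcapI; apply: eq_bigcapr => i _; rewrite preimage_setI.
Qed.

Lemma cylinders_measurable J : cylinders J `<=` measurable.
Proof.
move=> _ [E [mE ->]]; apply: fin_bigcap_measurable => [|i _].
  exact: finite_seq.
by rewrite -[_ @^-1` _]setTI; apply: measurable_funPT.
Qed.

Lemma info_measurable J (A : set Om) : measurable (A : set (infoT J)) ->
  measurable A.
Proof.
apply: smallest_sub; last exact: cylinders_measurable.
exact: sigma_algebra_measurable.
Qed.

Lemma adapted_measurable J d2 (S : measurableType d2) (f : Om -> S) :
  adapted J f -> measurable_fun setT f.
Proof. by move=> mf _ A mA; apply: (@info_measurable J); exact: mf. Qed.

Lemma adapted_sub J J' d2 (S : measurableType d2) (f : Om -> S) :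
  {subset J <= J'} -> adapted J f -> adapted J' f.
Proof.
move=> JJ mf _ A mA; have := mf measurableT A mA.
apply: smallest_sub; first exact: smallest_sigma_algebra.
move=> _ [E [mE ->]]; apply: sub_sigma_algebra.
exists (fun i => if i \in J then E i else setT); split.
  by move=> i; case: ifP.
apply/seteqP; split => w /= h i /= iJ.
- by case: ifP => // iJ'; exact: h.
- by have := h i (JJ _ iJ); rewrite iJ.
Qed.

Lemma adapted_sample J i : i \in J -> adapted J (Z i).
Proof.
move=> iJ _ A mA; rewrite setTI; apply: sub_sigma_algebra.
exists (fun j => if j == i then A else setT); split.
  by move=> j; case: ifP.
apply/seteqP; split => w /= h; last by have := h i iJ; rewrite /= eqxx.
by move=> j _ /=; case: eqP => // ->.
Qed.

Hypothesis indep : mutually_independent P (fun i => Z i : Om -> Xi).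

(** Independence passes from the pi-system to the sigma-algebra it
    generates. *)
Lemma info_independent J i0 (A : set Om) (E : set Xi) : uniq (i0 :: J) ->
  measurable (A : set (infoT J)) -> measurable E ->
  P (A `&` Z i0 @^-1` E) = (P A * P (Z i0 @^-1` E))%E.
Proof.
move=> uJ mA mE; set B := Z i0 @^-1` E.
have mB : measurable B by rewrite -[B]setTI; exact: measurable_funPT.
have fB : P B \is a fin_num by exact: fin_num_measure.
have G_ok : cylinders J `<=` [set A | P (A `&` B) = (P A * P B)%E].
  move=> _ [E' [mE' ->]] /=.
  pose E1 i := if i == i0 then E else E' i.
  have mE1 i : measurable (E1 i) by rewrite /E1; case: eqP.
  have i0J : i0 \notin J by move: uJ => /=/andP[].
  have E1J : \bigcap_(i in [set` J]) Z i @^-1` E1 i =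
             \bigcap_(i in [set` J]) Z i @^-1` E' i.
    apply: eq_bigcapr => i /= iJ; rewrite /E1; case: eqP => // ii.
    by rewrite ii (negbTE i0J) in iJ.
  have := indep uJ mE1; rewrite big_cons {2}/E1 eqxx -/B.
  have uJ' : uniq J by move: uJ => /= /andP[].
  rewrite -(indep uJ' mE1) E1J muleC => <-; congr (P _).
  apply/seteqP; split => [w [h1 h2] i|w h].
    rewrite /= inE => /orP[/eqP ->|iJ]; first by rewrite /E1 eqxx.
    by move: h1; rewrite -E1J; exact.
  split; last by have := h i0; rewrite /= inE eqxx /E1/= eqxx; exact.
  by rewrite -E1J => i /= iJ; apply: h; rewrite /= inE iJ orbT.
apply: (@dynkin_induction _ (infoT J) (cylinders J)
          [set A | P (A `&` B) = (P A * P B)%E]) => //.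
- exact: cylindersI.
- by rewrite /= setTI probability_setT mul1e.
- move=> S mS /= PS; have mS' := info_measurable mS.
  have -> : ~` S `&` B = B `\` (B `&` S).
    by apply/seteqP; split => w /=; tauto.
  rewrite measureD//; last 2 first.
  + exact: measurableI.
  + by rewrite ltey_eq fB.
  have -> : B `&` (B `&` S) = S `&` B by rewrite setIA setIid setIC.
  transitivity (P B - P S * P B)%E; first by congr (_ - _)%E; exact: PS.
  by rewrite probability_setC// muleBl ?mul1e// fin_num_adde_defl.
- move=> S mS tS PS /=.
  have mS' k := info_measurable (mS k).
  rewrite setI_bigcupl measure_semi_bigcup//; last 3 first.
  + by move=> k; exact: measurableI.
  + by apply: trivIset_setIr.
  + by apply: bigcupT_measurable => k; exact: measurableI.
  rewrite measure_semi_bigcup//; last exact: bigcupT_measurable.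
  rewrite muleC -(fineK fB) -nneseriesZl//.
  by apply: eq_eseriesr => k _; rewrite fineK// muleC; exact: PS.
Qed.

End Information.
(** * Square-integrable random variables *)

Section RealExpectation.
Context d (Om : measurableType d) {R : realType} (P : probability Om R).
Implicit Types f h : Om -> R.

Definition mean f : R := \int[P]_w f w.
Definition integ f := P.-integrable setT (EFin \o f).
Definition L2 f := measurable_fun setT f /\ integ (fun w => f w ^+ 2).

Lemma integ_le f h : measurable_fun setT f -> integ h ->
  (forall w, `|f w| <= h w) -> integ f.
Proof.
move=> mf ih fh; apply: (le_integrable measurableT _ _ ih).
  exact/measurable_EFinP.
move=> w _ /=; rewrite lee_fin; exact: le_trans (fh w) (ler_norm _).
Qed.

Lemma eq_integ f h : f =1 h -> integ f -> integ h.
Proof. by move=> /funext ->. Qed.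

Lemma integD f h : integ f -> integ h -> integ (fun w => f w + h w).
Proof. by move=> i1 i2; have := integrableD measurableT i1 i2. Qed.

Lemma integZ c f : integ f -> integ (fun w => c * f w).
Proof. by move=> i1; have := integrableZl measurableT c i1. Qed.

Lemma integB f h : integ f -> integ h -> integ (fun w => f w - h w).
Proof. by move=> i1 i2; have := integrableB measurableT i1 i2. Qed.

Lemma integ_cst c : integ (fun=> c).
Proof. exact: finite_measure_integrable_cst. Qed.

Lemma integ_sum (J : Type) (r : seq J) (Q : pred J) (F : J -> Om -> R) :
  (forall j, Q j -> integ (F j)) -> integ (fun w => \sum_(j <- r | Q j) F j w).
Proof.
move=> iF; elim: r => [|a r IH].
  by apply: eq_integ (integ_cst 0) => w; rewrite big_nil.
have [Qa|Qa] := boolP (Q a).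
  by apply: eq_integ (integD (iF _ Qa) IH) => w; rewrite big_cons Qa.
by apply: eq_integ IH => w; rewrite big_cons (negbTE Qa).
Qed.

Lemma eq_mean f h : f =1 h -> mean f = mean h.
Proof. by move=> /funext ->. Qed.

Lemma meanD f h : integ f -> integ h ->
  mean (fun w => f w + h w) = mean f + mean h.
Proof. by move=> i1 i2; rewrite /mean RintegralD. Qed.

Lemma meanB f h : integ f -> integ h ->
  mean (fun w => f w - h w) = mean f - mean h.
Proof. by move=> i1 i2; rewrite /mean RintegralB. Qed.

Lemma meanZ c f : integ f -> mean (fun w => c * f w) = c * mean f.
Proof. by move=> i1; rewrite /mean RintegralZl. Qed.

Lemma mean_cst c : mean (fun=> c) = c.
Proof.
rewrite /mean Rintegral_cst//; have -> : fine (P setT) = 1 by rewrite probability_setT.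
by rewrite mulr1.
Qed.

Lemma le_mean f h : integ f -> integ h -> (forall w, f w <= h w) ->
  mean f <= mean h.
Proof. by move=> i1 i2 fh; apply: le_Rintegral => // w _; exact: fh. Qed.

Lemma mean_ge0 f : (forall w, 0 <= f w) -> 0 <= mean f.
Proof. by move=> f0; apply: Rintegral_ge0 => w _; exact: f0. Qed.

Lemma mean_sum (J : Type) (r : seq J) (Q : pred J) (F : J -> Om -> R) :
  (forall j, Q j -> integ (F j)) ->
  mean (fun w => \sum_(j <- r | Q j) F j w) = \sum_(j <- r | Q j) mean (F j).
Proof.
move=> iF; elim: r => [|a r IH].
  rewrite big_nil -[RHS](mean_cst 0); apply: eq_mean => w.
  by rewrite big_nil.
rewrite big_cons; have [Qa|Qa] := boolP (Q a).
  rewrite -IH -meanD//; last 2 first.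
  - exact: iF.
  - exact: integ_sum.
  by apply: eq_mean => w; rewrite big_cons Qa.
by rewrite -IH; apply: eq_mean => w; rewrite big_cons (negbTE Qa).
Qed.

Lemma L2_mul f h : L2 f -> L2 h -> integ (fun w => f w * h w).
Proof.
move=> [mf if2] [mh ih2]; apply: (integ_le _ (integD if2 ih2)).
  exact: measurable_funM.
move=> w; rewrite ler_norml; apply/andP; split.
- have := sqr_ge0 (f w + h w); have := sqr_ge0 (f w); have := sqr_ge0 (h w).
  rewrite sqrrD; lra.
- have := sqr_ge0 (f w - h w); have := sqr_ge0 (f w); have := sqr_ge0 (h w).
  rewrite sqrrB; lra.
Qed.

Lemma L2_integ f : L2 f -> integ f.
Proof.
move=> [mf if2]; apply: (integ_le mf (integD (integ_cst 1) if2)) => w.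
rewrite ler_norml; apply/andP; split.
- have := sqr_ge0 (f w + 1); have := sqr_ge0 (f w); rewrite sqrrD; lra.
- have := sqr_ge0 (f w - 1); have := sqr_ge0 (f w); rewrite sqrrB; lra.
Qed.

Lemma L2_le f h : measurable_fun setT f -> integ h ->
  (forall w, f w ^+ 2 <= h w) -> L2 f.
Proof.
move=> mf ih fh; split => //; apply: (integ_le _ ih).
  exact: measurable_funX.
by move=> w; rewrite ger0_norm ?sqr_ge0.
Qed.

Lemma L2_bounded f K : measurable_fun setT f -> (forall w, `|f w| <= K) -> L2 f.
Proof.
move=> mf fK; apply: (L2_le mf (integ_cst (K ^+ 2))) => w.
rewrite -(real_normK (num_real (f w))).
by rewrite ler_pXn2r ?nnegrE// (le_trans _ (fK w)).
Qed.

Lemma L2_cst c : L2 (fun=> c).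
Proof. by apply: (@L2_bounded _ `|c|) => //; exact: measurable_cst. Qed.

Lemma L2D f h : L2 f -> L2 h -> L2 (fun w => f w + h w).
Proof.
move=> Lf Lh; split; first by apply: measurable_funD; [case: Lf|case: Lh].
apply: (eq_integ _ (integD (integD Lf.2 (integZ 2 (L2_mul Lf Lh))) Lh.2)) => w.
by rewrite sqrrD mulr_natl.
Qed.

Lemma L2Z c f : L2 f -> L2 (fun w => c * f w).
Proof.
move=> [mf if2]; split; first by apply: measurable_funM.
by apply: (eq_integ _ (integZ (c ^+ 2) if2)) => w; rewrite exprMn.
Qed.

Lemma L2N f : L2 f -> L2 (fun w => - f w).
Proof.
move=> [mf if2]; split; first exact: measurable_funN.
by apply: (eq_integ _ if2) => w; rewrite sqrrN.
Qed.

Lemma L2_sum (J : Type) (r : seq J) (Q : pred J) (F : J -> Om -> R) :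
  (forall j, Q j -> L2 (F j)) -> L2 (fun w => \sum_(j <- r | Q j) F j w).
Proof.
move=> iF; elim: r => [|a r IH].
  have -> : (fun w => \sum_(j <- [::] | Q j) F j w) = (fun=> 0).
    by apply/funext => w; rewrite big_nil.
  exact: L2_cst.
have [Qa|Qa] := boolP (Q a).
  have -> : (fun w => \sum_(j <- a :: r | Q j) F j w) =
      (fun w => F a w + \sum_(j <- r | Q j) F j w).
    by apply/funext => w; rewrite big_cons Qa.
  by apply: L2D => //; exact: iF.
have -> : (fun w => \sum_(j <- a :: r | Q j) F j w) =
    (fun w => \sum_(j <- r | Q j) F j w).
  by apply/funext => w; rewrite big_cons (negbTE Qa).
exact: IH.
Qed.

(** The expectation of an arbitrary, possibly nonmeasurable, function is
    a difference of lower integrals, which are monotone. *)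
Lemma expectation_le_mean f h : integ h -> (forall w, f w <= h w) ->
  ('E_P[f] <= (mean h)%:E)%E.
Proof.
move=> ih fh.
have mono (u v : Om -> \bar R) : (forall w, 0 <= u w)%E ->
    (forall w, u w <= v w)%E -> (\int[P]_w u w <= \int[P]_w v w)%E.
  move=> u0 uv; have v0 w : (0 <= v w)%E by exact: le_trans (uv w).
  rewrite !ge0_integralTE//; apply: le_ereal_sup => _ [k /= ku <-].
  by exists k => // w; exact: le_trans (uv w).
have -> : ((mean h)%:E = \int[P]_w (h w)%:E)%E.
  by rewrite /mean /Rintegral fineK//; exact: integrable_fin_num.
rewrite unlock integralE [X in (_ <= X)%E]integralE; apply: leeB.
- apply: mono => w; first exact: funepos_ge0.
  by rewrite !funeposE /= ge_max !le_max lee_fin fh/= lexx orbT.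
- apply: mono => w; first exact: funeneg_ge0.
  by rewrite !funenegE /= ge_max !le_max lee_fin lerN2 fh/= lexx orbT.
Qed.

End RealExpectation.

(** * The noise of an oracle at a random query point *)

Section Noise.
Context d (Om : measurableType d) {R : realType} (P : probability Om R).
Context d' (Xi : measurableType d') (mu : probability Xi R).
Context (I : eqType) (Z : I -> {RV P >-> Xi}).
Hypothesis indep : mutually_independent P (fun i => Z i : Om -> Xi).
Hypothesis law : identically_distributed Z mu.

(** Integrating out a fresh sample: given the information [J], the sample
    [Z i0] still has law [mu], because the joint law is the product law. *)
Lemma fresh_sample_tonelli J i0 d2 (S : measurableType d2) (Y : Om -> S)
    (f : S * Xi -> \bar R) :
  uniq (i0 :: J) -> adapted Z J Y -> measurable_fun setT f ->
  (forall z, 0 <= f z)%E ->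
  (\int[P]_w f (Y w, Z i0 w) = \int[P]_w \int[mu]_s f (Y w, s))%E.
Proof.
move=> uJ aY mf f0; have mY := adapted_measurable aY.
have mW : measurable_fun setT (fun w => (Y w, Z i0 w)).
  by apply: measurable_fun_pair => //; exact: measurable_funPT.
pose Yr : {mfun Om >-> S} := mfun_Sub (mem_set mY).
pose Wr : {mfun Om >-> (S * Xi)%type} := mfun_Sub (mem_set mW).
have joint A B : measurable A -> measurable B ->
    distribution P Wr (A `*` B) = (distribution P Yr A * mu B)%E.
  move=> mA mB; rewrite -(law i0 mB).
  have mYA : measurable (Y @^-1` A : set (infoT Z J)).
    by have := aY measurableT A mA; rewrite setTI.
  have := info_independent indep uJ mYA mB; exact.
have prod := product_measure_unique joint.
transitivity (\int[distribution P Wr]_z f z)%E.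
  by rewrite ge0_integral_distribution.
transitivity (\int[distribution P Yr \x mu]_z f z)%E.
  by apply: eq_measure_integral => A mA _; rewrite -prod.
rewrite fubini_tonelli1// /fubini_F ge0_integral_distribution//.
- exact: (@measurable_fun_fubini_tonelli_F _ _ _ _ _ mu f).
- by move=> y; exact: integral_ge0.
Qed.

Section Oracle.
Context (n p : nat) (X : set 'cV[R]_n) (X_compact : compact X).
Variables (O : 'cV[R]_n -> Xi -> 'cV[R]_p) (f : 'cV[R]_n -> 'cV[R]_p).
Variable (sigma : R).
Hypothesis oracle : unbiased_oracle X mu O f sigma.

Let mX : measurable (X : set (borelV R n)).
Proof. exact: borelV_compact. Qed.

Let query i : borelV R n * Xi -> R :=
  (fun z : borelV R n * Xi => O z.1 z.2 i 0) \_ (X `*` setT).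

Let query_measurable i : measurable_fun setT (query i).
Proof.
have [mO _ _] := oracle.
have mXT : measurable ((X : set (borelV R n)) `*` [set: Xi]).
  exact: measurableX.
exact: ((measurable_restrictT _ mXT).1 (mO i)).
Qed.

Let queryE i x s : X x -> query i (x, s) = O x s i 0.
Proof. by move=> Xx; rewrite /query patchE mem_set. Qed.

Let query0 i x s : ~ X x -> query i (x, s) = 0.
Proof.
by move=> Xx; rewrite /query patchE memNset// => -[].
Qed.

Let answer i (x : borelV R n) : R := fine (\int[mu]_s (query i (x, s))%:E)%E.

(** [f] inherits its measurability from the oracle: on [X] it is the integral
    of a jointly measurable function. *)
Let answer_measurable i : measurable_fun setT (answer i).
Proof.
apply: (measurableT_comp (fine_measurable measurableT)) => /=.
have mq : measurable_fun setT (EFin \o query i) by exact/measurable_EFinP.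
have -> : (fun x => \int[mu]_s (query i (x, s))%:E)%E = (fun x =>
    \int[mu]_s ((EFin \o query i)^\+ (x, s))
    - \int[mu]_s ((EFin \o query i)^\- (x, s)))%E.
  apply/funext => x; rewrite integralE.
  by congr (_ - _)%E; apply: eq_integral => s _; rewrite ?funeposE ?funenegE.
apply: emeasurable_funB.
- apply: (@measurable_fun_fubini_tonelli_F _ _ _ _ _ mu ((EFin \o query i)^\+)%E).
  + exact: measurable_funepos.
  + by move=> z; exact: funepos_ge0.
- apply: (@measurable_fun_fubini_tonelli_F _ _ _ _ _ mu ((EFin \o query i)^\-)%E).
  + exact: measurable_funeneg.
  + by move=> z; exact: funeneg_ge0.
Qed.

Let answerE i x : X x -> answer i x = f x i 0.
Proof.
move=> Xx; have [_ mO _] := oracle; rewrite /answer.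
under eq_integral do rewrite queryE//.
by have := mO _ Xx i; rewrite unlock => ->.
Qed.

Let answer0 i x : ~ X x -> answer i x = 0.
Proof.
move=> Xx; rewrite /answer; under eq_integral do rewrite query0//.
by rewrite integral0.
Qed.

(** The noise of the oracle, extended by zero outside [X] so that it is
    jointly measurable on the whole product. *)
Definition noise i (z : borelV R n * Xi) : R := query i z - answer i z.1.

Lemma noiseE i x s : X x -> noise i (x, s) = (O x s - f x) i 0.
Proof. by move=> Xx; rewrite /noise queryE// answerE// !mxE. Qed.

Lemma noise0 i x s : ~ X x -> noise i (x, s) = 0.
Proof. by move=> Xx; rewrite /noise query0// answer0// subrr. Qed.

Lemma noise_measurable i : measurable_fun setT (noise i).
Proof.
by apply: measurable_funB => //; apply: measurableT_comp.
Qed.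

Let noise_section i x : measurable_fun setT (fun s => noise i (x, s)).
Proof.
by apply: (measurableT_comp (noise_measurable i)); exact: pair1_measurable.
Qed.

Lemma noise_variance x :
  (\int[mu]_s (\sum_i noise i (x, s) ^+ 2)%:E <= (sigma ^+ 2)%:E)%E.
Proof.
have [Xx|Xx] := pselect (X x).
  have [_ _ vO] := oracle; have := vO _ Xx; rewrite unlock.
  apply: le_trans; rewrite le_eqVlt; apply/orP; left; apply/eqP.
  apply: eq_integral => s _; rewrite norm2_sqrE; congr (_%:E).
  by apply: eq_bigr => i _; rewrite noiseE.
under eq_integral.
  move=> s _; rewrite big1 => [|i _]; last by rewrite noise0// expr0n.
  over.
by rewrite integral0 lee_fin sqr_ge0.
Qed.

Let sum_noise_measurable x :
  measurable_fun setT (fun s => \sum_i noise i (x, s) ^+ 2).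
Proof. by apply: measurable_sum => i; apply: measurable_funX. Qed.

Let noise_sqr_le i x s : noise i (x, s) ^+ 2 <= \sum_i noise i (x, s) ^+ 2.
Proof.
by rewrite (bigD1 i)//= lerDl sumr_ge0// => j _; rewrite sqr_ge0.
Qed.

Let sum_noise_integ x : integ mu (fun s => \sum_i noise i (x, s) ^+ 2).
Proof.
apply/integrableP; split; first exact/measurable_EFinP.
apply: le_lt_trans (ltry (sigma ^+ 2)).
apply: le_trans (noise_variance x).
rewrite le_eqVlt; apply/orP; left; apply/eqP; apply: eq_integral => s _ /=.
by rewrite ger0_norm// sumr_ge0// => j _; rewrite sqr_ge0.
Qed.

Let noise_integ i x : integ mu (fun s => noise i (x, s)).
Proof.
by apply: L2_integ; apply: (L2_le _ (sum_noise_integ x)).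
Qed.

Let noise_mean i x : (\int[mu]_s (noise i (x, s))%:E = 0)%E.
Proof.
have [Xx|Xx] := pselect (X x); last first.
  by under eq_integral do rewrite noise0//; rewrite integral0.
have qi : integ mu (fun s => query i (x, s)).
  apply: (eq_integ _ (integD (noise_integ i x) (integ_cst mu (answer i x)))).
  by move=> s; rewrite /noise/= subrK.
have : mean mu (fun s => noise i (x, s)) = 0.
  rewrite /noise (meanB qi (integ_cst mu (answer i x))) mean_cst.
  by rewrite subrr.
rewrite /mean /Rintegral => h; rewrite -[LHS]fineK ?h//.
exact: (integrable_fin_num _ (noise_integ i x)).
Qed.

Section AtRandomPoint.
Variables (J : seq I) (i0 : I) (x : Om -> 'cV[R]_n) (r : Om -> R).
Hypothesis uJ : uniq (i0 :: J).
Hypothesis x_adapted : adapted Z J (x : Om -> borelV R n).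
Hypothesis r_adapted : adapted Z J r.

Let Y w : borelV R n * R := (x w, r w).

Let Y_adapted : adapted Z J Y.
Proof. exact: measurable_fun_pair. Qed.

(** [r * noise] and [r ^+ 2 * |noise|^2] as functions of the known part
    [(x, r)] and of the fresh sample. *)
Let lin i (z : (borelV R n * R) * Xi) := z.1.2 * noise i (z.1.1, z.2).
Let quad (z : (borelV R n * R) * Xi) :=
  z.1.2 ^+ 2 * \sum_i noise i (z.1.1, z.2) ^+ 2.

Let noise_comp_measurable i : measurable_fun setT
  (fun z : (borelV R n * R) * Xi => noise i (z.1.1, z.2)).
Proof.
apply: (measurableT_comp (noise_measurable i)).
apply: measurable_fun_pair; last exact: measurable_snd.
exact: (measurableT_comp measurable_fst measurable_fst).
Qed.

Let r_comp_measurable : measurable_fun setT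
  (fun z : (borelV R n * R) * Xi => z.1.2).
Proof. exact: (measurableT_comp measurable_snd measurable_fst). Qed.

Let lin_measurable i : measurable_fun setT (lin i).
Proof. exact: measurable_funM. Qed.

Let quad_measurable : measurable_fun setT quad.
Proof.
apply: measurable_funM; first exact: measurable_funX.
by apply: measurable_sum => i; apply: measurable_funX.
Qed.

Let W_measurable : measurable_fun setT (fun w => (Y w, Z i0 w)).
Proof.
apply: measurable_fun_pair; last exact: measurable_funPT.
exact: adapted_measurable Y_adapted.
Qed.

(** The weight [r] is known before the sample is drawn, so conditionally it
    only scales the variance. *)
Lemma noise_second_moment : integ P (fun w => r w ^+ 2) ->
  integ P (fun w => r w ^+ 2 * \sum_i noise i (x w, Z i0 w) ^+ 2) /\
  mean P (fun w => r w ^+ 2 * \sum_i noise i (x w, Z i0 w) ^+ 2)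
    <= sigma ^+ 2 * mean P (fun w => r w ^+ 2).
Proof.
move=> ir.
have sum0 y s : 0 <= \sum_i noise i (y, s) ^+ 2.
  by apply: sumr_ge0 => i _; exact: sqr_ge0.
have mq : measurable_fun setT (fun w => quad (Y w, Z i0 w)).
  exact: (measurableT_comp quad_measurable W_measurable).
have B : (\int[P]_w (quad (Y w, Z i0 w))%:E <=
    (sigma ^+ 2 * mean P (fun w => r w ^+ 2))%:E)%E.
  rewrite (@fresh_sample_tonelli J i0 _ _ Y (EFin \o quad))//; last 2 first.
  - exact/measurable_EFinP.
  - by move=> z /=; rewrite lee_fin mulr_ge0 ?sqr_ge0.
  have ir' := integZ (sigma ^+ 2) ir.
  rewrite -(meanZ _ ir) /mean /Rintegral fineK; last exact: integrable_fin_num.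
  apply: ge0_le_integral => //.
  - by move=> w _; apply: integral_ge0 => s _;
      rewrite lee_fin mulr_ge0 ?sqr_ge0.
  - have m1 := @measurable_fun_fubini_tonelli_F _ _ _ _ _ mu (EFin \o quad).
    apply: (measurableT_comp (m1 _ _) (adapted_measurable Y_adapted)).
    + exact/measurable_EFinP.
    + by move=> z /=; rewrite lee_fin mulr_ge0 ?sqr_ge0.
  - exact: (measurable_int P ir').
  move=> w _ /=; rewrite /quad/=.
  under eq_integral do rewrite EFinM.
  rewrite ge0_integralZl//.
  - rewrite (mulrC (sigma ^+ 2)) [X in (_ <= X)%E]EFinM; apply: lee_wpmul2l; first by rewrite lee_fin sqr_ge0.
    exact: noise_variance.
  - exact/measurable_EFinP.
  - by move=> s _; rewrite lee_fin.
  - by rewrite lee_fin sqr_ge0.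
have iq : integ P (fun w => r w ^+ 2 * \sum_i noise i (x w, Z i0 w) ^+ 2).
  apply/integrableP; split; first exact/measurable_EFinP.
  apply: le_lt_trans (ltry _); apply: le_trans B.
  rewrite le_eqVlt; apply/orP; left; apply/eqP; apply: eq_integral => w _ /=.
  by rewrite ger0_norm// mulr_ge0 ?sqr_ge0.
split => //; rewrite -lee_fin; apply: le_trans B.
by rewrite /mean /Rintegral fineK//; exact: integrable_fin_num.
Qed.

(** A fresh noise is orthogonal to whatever was known before.  Positive and
    negative part are integrated separately, so that Tonelli suffices. *)
Lemma noise_orthogonal i : integ P r ->
  integ P (fun w => r w * noise i (x w, Z i0 w)) /\
  mean P (fun w => r w * noise i (x w, Z i0 w)) = 0.
Proof.
move=> ir.
have ml : measurable_fun setT (fun w => lin i (Y w, Z i0 w)).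
  exact: (measurableT_comp (lin_measurable i) W_measurable).
have mE : measurable_fun setT (EFin \o lin i) by exact/measurable_EFinP.
have il : integ P (fun w => r w * noise i (x w, Z i0 w)).
  apply/integrableP; split; first exact/measurable_EFinP.
  rewrite (@fresh_sample_tonelli J i0 _ _ Y (abse \o (EFin \o lin i)))//;
    last 2 first.
  - by apply: measurableT_comp.
  - by move=> z /=; rewrite lee_fin.
  have ib := integZ (1 + sigma ^+ 2) (integrable_norm ir : integ P _).
  move/integrableP : ib => [mb]; apply: le_lt_trans.
  apply: ge0_le_integral => //.
  - by move=> w _; apply: integral_ge0 => s _ /=; rewrite lee_fin.
  - have m1 := @measurable_fun_fubini_tonelli_F _ _ _ _ _ mu (abse \o (EFin \o lin i)).
    apply: (measurableT_comp (m1 _ _) (adapted_measurable Y_adapted)).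
    + by apply: measurableT_comp.
    + by move=> z /=; rewrite lee_fin.
  - by apply: measurableT_comp.
  move=> w _ /=; rewrite /lin/=.
  rewrite ger0_norm; last by rewrite mulr_ge0// addr_ge0// sqr_ge0.
  under eq_integral do rewrite normrM EFinM.
  rewrite ge0_integralZl//;
    last by apply/measurable_EFinP; apply: measurableT_comp.
  rewrite (mulrC (1 + sigma ^+ 2)) [X in (_ <= X)%E]EFinM; apply: lee_wpmul2l; first by rewrite lee_fin.
  have -> : ((1 + sigma ^+ 2)%:E = 1 + (sigma ^+ 2)%:E :> \bar R)%E by [].
  apply: (@le_trans _ _ (\int[mu]_s (1 + \sum_i noise i (x w, s) ^+ 2)%:E)%E).
    apply: ge0_le_integral => //.
    - by apply/measurable_EFinP; apply: measurableT_comp.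
    - by apply/measurable_EFinP; apply: measurable_funD.
    move=> s _; rewrite lee_fin.
    apply: (@le_trans _ _ (1 + noise i (x w, s) ^+ 2)).
      rewrite -[X in _ <= 1 + X](real_normK (num_real _)).
      have := sqr_ge0 (`|noise i (x w, s)| - 1).
      have := sqr_ge0 (`|noise i (x w, s)|); rewrite sqrrB; lra.
    by rewrite lerD2l; exact: noise_sqr_le.
  under eq_integral do rewrite EFinD.
  rewrite ge0_integralD//; last 2 first.
  - by move=> s _; rewrite lee_fin sumr_ge0// => j _; exact: sqr_ge0.
  - exact/measurable_EFinP.
  have -> : (\int[mu]_s 1%:E = 1)%E.
    by have := expectation_cst mu 1; rewrite unlock.
  by rewrite leeD2l//; exact: noise_variance.
split => //; rewrite /mean /Rintegral.
have -> : (fun w => (r w * noise i (x w, Z i0 w))%:E) =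
    (fun w => (EFin \o lin i) (Y w, Z i0 w)) by [].
rewrite integralE.
have -> : (\int[P]_w ((fun w => (EFin \o lin i) (Y w, Z i0 w))^\+ w) =
    \int[P]_w (EFin \o lin i)^\+ (Y w, Z i0 w))%E.
  by apply: eq_integral => w _; rewrite !funeposE.
have -> : (\int[P]_w ((fun w => (EFin \o lin i) (Y w, Z i0 w))^\- w) =
    \int[P]_w (EFin \o lin i)^\- (Y w, Z i0 w))%E.
  by apply: eq_integral => w _; rewrite !funenegE.
have E : (\int[P]_w (EFin \o lin i)^\+ (Y w, Z i0 w) =
          \int[P]_w (EFin \o lin i)^\- (Y w, Z i0 w))%E.
  rewrite (@fresh_sample_tonelli J i0 _ _ Y ((EFin \o lin i)^\+)%E)//;
    last exact: measurable_funepos.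
  rewrite (@fresh_sample_tonelli J i0 _ _ Y ((EFin \o lin i)^\-)%E)//;
    last exact: measurable_funeneg.
  apply: eq_integral => w _.
  have is_ : integ mu (fun s => lin i (Y w, s)).
    exact: (integZ (r w) (noise_integ i (x w))).
  have m0 : (\int[mu]_s (lin i (Y w, s))%:E = 0)%E.
    rewrite /lin/=; under eq_integral do rewrite EFinM.
    by rewrite integralZl//= ?noise_mean ?mule0//; exact: noise_integ.
  have pos := integrable_pos_fin_num measurableT is_.
  have neg := integrable_neg_fin_num measurableT is_.
  move: m0; rewrite integralE.
  have -> : (\int[mu]_s ((fun s => (lin i (Y w, s))%:E)^\+ s) =
      \int[mu]_s (EFin \o lin i)^\+ (Y w, s))%E.
    by apply: eq_integral => s _; rewrite !funeposE.
  have -> : (\int[mu]_s ((fun s => (lin i (Y w, s))%:E)^\- s) =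
      \int[mu]_s (EFin \o lin i)^\- (Y w, s))%E.
    by apply: eq_integral => s _; rewrite !funenegE.
  move: pos neg.
  have -> : (\int[mu]_s ((EFin \o (fun s => lin i (Y w, s)))^\+ s) =
      \int[mu]_s (EFin \o lin i)^\+ (Y w, s))%E.
    by apply: eq_integral => s _; rewrite !funeposE.
  have -> : (\int[mu]_s ((EFin \o (fun s => lin i (Y w, s)))^\- s) =
      \int[mu]_s (EFin \o lin i)^\- (Y w, s))%E.
    by apply: eq_integral => s _; rewrite !funenegE.
  move: (integral _ _ _) (integral _ _ _) => [a| |] [b| |] // _ _ [].
  by move=> /subr0_eq ->.
rewrite E subee//; have := integrable_neg_fin_num measurableT il.
suff -> : (\int[P]_w
    ((EFin \o (fun w => (r w * noise i (x w, Z i0 w))%R))^\- w) =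
    \int[P]_w (EFin \o lin i)^\- (Y w, Z i0 w))%E by [].
by apply: eq_integral => w _; rewrite !funenegE.
Qed.

End AtRandomPoint.
(** At points of [X] the extended noise is the error of the oracle. *)
Section AtFeasiblePoint.
Variables (J : seq I) (i0 : I) (x : Om -> 'cV[R]_n).
Hypothesis x_adapted : adapted Z J (x : Om -> borelV R n).
Hypothesis x_in : forall w, X (x w).

Let err w := O (x w) (Z i0 w) - f (x w).

Let errE i w : err w i 0 = noise i (x w, Z i0 w).
Proof. by rewrite noiseE. Qed.

Lemma oracle_adapted i : i0 \in J ->
  adapted Z J (fun w => O (x w) (Z i0 w) i 0).
Proof.
move=> i0J.
have -> : (fun w => O (x w) (Z i0 w) i 0) = (fun w => query i (x w, Z i0 w)).
  by apply/funext => w; rewrite queryE.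
apply: (measurableT_comp (query_measurable i)).
by apply: measurable_fun_pair => //; exact: adapted_sample.
Qed.

Lemma oracle_error_adapted i : i0 \in J -> adapted Z J (fun w => err w i 0).
Proof.
move=> i0J.
have -> : (fun w => err w i 0) = (fun w => noise i (x w, Z i0 w)).
  by apply/funext => w; rewrite errE.
apply: (measurableT_comp (noise_measurable i)).
by apply: measurable_fun_pair => //; exact: adapted_sample.
Qed.

Hypothesis uJ : uniq (i0 :: J).

Lemma oracle_error_second_moment (r : Om -> R) : adapted Z J r ->
  integ P (fun w => r w ^+ 2) ->
  integ P (fun w => r w ^+ 2 * norm2 (err w) ^+ 2) /\
  mean P (fun w => r w ^+ 2 * norm2 (err w) ^+ 2)
    <= sigma ^+ 2 * mean P (fun w => r w ^+ 2).
Proof.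
move=> ar ir.
have -> : (fun w => r w ^+ 2 * norm2 (err w) ^+ 2) =
    (fun w => r w ^+ 2 * \sum_i noise i (x w, Z i0 w) ^+ 2).
  apply/funext => w; rewrite norm2_sqrE; congr (_ * _).
  by apply: eq_bigr => i _; rewrite errE.
exact: (noise_second_moment uJ).
Qed.

Lemma oracle_error_orthogonal (r : Om -> R) i : adapted Z J r -> integ P r ->
  integ P (fun w => r w * err w i 0) /\ mean P (fun w => r w * err w i 0) = 0.
Proof.
move=> ar ir.
have -> : (fun w => r w * err w i 0) =
    (fun w => r w * noise i (x w, Z i0 w)).
  by apply/funext => w; rewrite errE.
exact: (noise_orthogonal uJ).
Qed.

Lemma oracle_error_L2 (r : Om -> R) i : adapted Z J r -> L2 P r ->
  L2 P (fun w => r w * err w i 0).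
Proof.
move=> ar [_ ir]; have [iq _] := oracle_error_second_moment ar ir.
apply: (L2_le _ iq) => [|w].
  apply: measurable_funM; first exact: adapted_measurable ar.
  apply: (@adapted_measurable _ _ _ _ _ _ _ Z (i0 :: J)).
  have -> : (fun w => err w i 0) = (fun w => noise i (x w, Z i0 w)).
    by apply/funext => w; rewrite errE.
  apply: (measurableT_comp (noise_measurable i)).
  apply: measurable_fun_pair; last by apply: adapted_sample; rewrite mem_head.
  by apply: (adapted_sub _ x_adapted) => j jJ; rewrite inE jJ orbT.
rewrite exprMn; apply: ler_wpM2l; first exact: sqr_ge0.
by rewrite norm2_sqrE (bigD1 i)//= lerDl sumr_ge0// => j _; rewrite sqr_ge0.
Qed.

End AtFeasiblePoint.
End Oracle.
End Noise.
(** * Square-integrable random vectors *)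

Section VectorL2.
Context d (Om : measurableType d) {R : realType} (P : probability Om R).
Context {n : nat}.
Implicit Types u v : Om -> 'cV[R]_n.

Lemma measurable_norm2 d0 (T0 : measurableType d0) (v : T0 -> 'cV[R]_n) :
  (forall i, measurable_fun setT (fun w => v w i 0)) ->
  measurable_fun setT (fun w => norm2 (v w)).
Proof.
move=> mv.
apply: (measurableT_comp (continuous_measurable_fun (@sqrt_continuous R))).
by apply: measurable_sum => i; exact: measurable_funM.
Qed.

Definition vL2 v := forall i, L2 P (fun w => v w i 0).

Lemma vL2_dot u v : vL2 u -> vL2 v -> integ P (fun w => dot (u w) (v w)).
Proof. by move=> Lu Lv; apply: integ_sum => i _; exact: L2_mul. Qed.

Lemma vL2_norm2 v : vL2 v -> L2 P (fun w => norm2 (v w)).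
Proof.
move=> Lv; split; first by apply: measurable_norm2 => i; case: (Lv i).
by apply: (eq_integ _ (vL2_dot Lv Lv)) => w; rewrite norm2_sqr.
Qed.

Lemma vL2_cst c : vL2 (fun=> c).
Proof. by move=> i; exact: L2_cst. Qed.

Lemma vL2N v : vL2 v -> vL2 (fun w => - v w).
Proof.
move=> Lv i; have -> : (fun w => (- v w) i 0) = (fun w => - v w i 0).
  by apply/funext => w; rewrite mxE.
exact: L2N.
Qed.

Lemma vL2D u v : vL2 u -> vL2 v -> vL2 (fun w => u w + v w).
Proof.
move=> Lu Lv i.
have -> : (fun w => (u w + v w) i 0) = (fun w => u w i 0 + v w i 0).
  by apply/funext => w; rewrite mxE.
exact: L2D.
Qed.

Lemma vL2B u v : vL2 u -> vL2 v -> vL2 (fun w => u w - v w).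
Proof. by move=> Lu Lv; apply: vL2D => //; exact: vL2N. Qed.

Lemma vL2_sum (J : Type) (r : seq J) (Q : pred J) (F : J -> Om -> 'cV[R]_n) :
  (forall j, Q j -> vL2 (F j)) -> vL2 (fun w => \sum_(j <- r | Q j) F j w).
Proof.
move=> LF i; have -> : (fun w => (\sum_(j <- r | Q j) F j w) i 0) =
    (fun w => \sum_(j <- r | Q j) F j w i 0).
  by apply/funext => w; rewrite summxE.
by apply: L2_sum => j Qj; exact: LF.
Qed.

(** Pythagoras for martingale differences. *)
Lemma mean_norm2_sum (D : nat -> Om -> 'cV[R]_n) k :
  (forall t, (t < k)%N -> vL2 (D t)) ->
  (forall t, (t < k)%N ->
     mean P (fun w => dot (\sum_(s < t) D s w) (D t w)) = 0) ->
  mean P (fun w => norm2 (\sum_(t < k) D t w) ^+ 2) =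
  \sum_(t < k) mean P (fun w => norm2 (D t w) ^+ 2).
Proof.
elim: k => [_ _|k IH LD oD].
  rewrite big_ord0 -[RHS](mean_cst P 0); apply: eq_mean => w.
  by rewrite big_ord0 norm2_sqr dot0l.
rewrite big_ord_recr/= -IH; last 2 first.
- by move=> t tk; apply: LD; exact: ltnW.
- by move=> t tk; apply: oD; exact: ltnW.
have LS : vL2 (fun w => \sum_(t < k) D t w).
  apply: (@vL2_sum _ (index_enum 'I_k) xpredT (fun t : 'I_k => D t)) => t _.
  by apply: LD; apply: ltnW; rewrite ltnS.
have Lk := LD _ (ltnSn k).
transitivity (mean P (fun w => norm2 (\sum_(t < k) D t w) ^+ 2
    + 2 * dot (\sum_(t < k) D t w) (D k w) + norm2 (D k w) ^+ 2)).
  apply: eq_mean => w; rewrite big_ord_recr/= !norm2_sqr dotDl !dotDr.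
  rewrite (dotC (D k w) (\sum_(t < k) _)); ring.
have i1 := (vL2_norm2 LS).2; have i2 := (vL2_norm2 Lk).2.
have i3 := integZ 2 (vL2_dot LS Lk).
rewrite (meanD (integD i1 i3) i2) (meanD i1 i3) meanZ ?oD// ?mulr0 ?addr0//.
exact: vL2_dot.
Qed.

End VectorL2.

Lemma sqr_mean_le d (Om : measurableType d) (R : realType)
    (P : probability Om R) (f : Om -> R) : L2 P f ->
  mean P f ^+ 2 <= mean P (fun w => f w ^+ 2).
Proof.
move=> Lf; have i1 := L2_integ Lf; set m := mean P f.
have : 0 <= mean P (fun w => (f w - m) ^+ 2).
  by apply: mean_ge0 => w; exact: sqr_ge0.
have -> : mean P (fun w => (f w - m) ^+ 2) =
    mean P (fun w => f w ^+ 2 + (- (2 * m) * f w + m ^+ 2)).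
  by apply: eq_mean => w; ring.
have i2 := integZ (- (2 * m)) i1.
have ic := integ_cst P (m ^+ 2).
rewrite (meanD Lf.2 (integD i2 ic)) (meanD i2 ic) (meanZ _ i1) mean_cst -/m.
rewrite expr2; lra.
Qed.
(** * Measurability and noise moments of a run *)

(** The samples drawn before time [t], indexed as in [sample_family]:
    [inl s] for [xi s] and [inr s] for [xibar s]. *)
Definition past (t : nat) : seq (nat + nat) :=
  map inl (iota 0 t) ++ map inr (iota 0 t).

(** The dual step at time [t] has seen the second sample of that time, but not
    yet the first. *)
Definition past_dual (t : nat) : seq (nat + nat) := inr t :: past t.

Lemma mem_past_inl t s : (inl s \in past t) = (s < t)%N.
Proof.
rewrite mem_cat mem_map; last by move=> ? ? [].
rewrite mem_iota add0n /=; case: (s < t)%N => //=.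
by apply/negP => /mapP[].
Qed.

Lemma mem_past_inr t s : (inr s \in past t) = (s < t)%N.
Proof.
rewrite mem_cat orbC mem_map; last by move=> ? ? [].
rewrite mem_iota add0n /=; case: (s < t)%N => //=.
by apply/negP => /mapP[].
Qed.

Lemma uniq_past t : uniq (past t).
Proof.
rewrite cat_uniq !map_inj_uniq ?iota_uniq//=; try by move=> ? ? [].
by rewrite andbT; apply/hasPn => _ /mapP[s _ ->]; apply/negP => /mapP[].
Qed.

Lemma past_fresh_inl t : uniq (inl t :: past t).
Proof. by rewrite /= uniq_past mem_past_inl ltnn. Qed.

Lemma past_fresh_inr t : uniq (inr t :: past t).
Proof. by rewrite /= uniq_past mem_past_inr ltnn. Qed.

Lemma past_dual_fresh t : uniq (inl t :: past_dual t).
Proof.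
by rewrite /past_dual cons_uniq past_fresh_inr inE/= mem_past_inl ltnn.
Qed.

Lemma past_le s t : (s <= t)%N -> {subset past s <= past t}.
Proof.
by move=> st [i|i]; rewrite ?mem_past_inl ?mem_past_inr => /leq_trans; apply.
Qed.

Lemma past_sub_dual t : {subset past t <= past_dual t}.
Proof. by move=> i; rewrite inE => ->; rewrite orbT. Qed.

Lemma past_dual_sub t : {subset past_dual t <= past t.+1}.
Proof.
move=> i; rewrite inE => /orP[/eqP ->|]; first by rewrite mem_past_inr.
exact: past_le.
Qed.

Section Run.
Context {R : realType} {n m : nat}.
Variables (X : set 'cV[R]_n) (F : 'cV[R]_n -> 'cV[R]_n) (L H : R).
Variables (g : 'cV[R]_n -> 'cV[R]_m) (g' : 'cV[R]_n -> 'M[R]_(n, m)) (Mg : R).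
Context {d' : measure_display} {Xi : measurableType d'}.
Variables (mu : probability Xi R).
Variables (FF : 'cV[R]_n -> Xi -> 'cV[R]_n) (gg : 'cV[R]_n -> Xi -> 'cV[R]_m).
Variables (GG : 'cV[R]_n -> Xi -> 'M[R]_(n, m)).
Variables (sigma sigma_g : R) (sigma_G : 'cV[R]_m).
Context {d : measure_display} {Om : measurableType d}.
Variables (P : probability Om R).
Variables (xi xibar : nat -> {RV P >-> Xi}).
Variables (x0 : 'cV[R]_n) (T : nat) (eta tau : R).
Variables (x : nat -> Om -> 'cV[R]_n) (l : nat -> Om -> 'cV[R]_m).

Hypothesis X_convex : convex_set X.
Hypothesis X_compact : compact X.
Hypothesis x0_in : X x0.
Hypothesis Mg_ge0 : 0 <= Mg.
Hypothesis g_lip : forall x1 x2, X x1 -> X x2 ->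
  norm2 (g x1 - g x2) <= Mg * norm2 (x1 - x2).
Hypothesis FF_oracle : unbiased_oracle X mu FF F sigma.
Hypothesis gg_oracle : unbiased_oracle X mu gg g sigma_g.
Hypothesis GG_oracle : forall j, unbiased_oracle X mu
  (fun x s => col j (GG x s)) (fun x => col j (g' x)) (sigma_G j 0).
Hypothesis law : identically_distributed (sample_family xi xibar) mu.
Hypothesis indep : mutually_independent P
  (fun i => sample_family xi xibar i : Om -> Xi).
Hypothesis eta_gt0 : 0 < eta.
Hypothesis tau_gt0 : 0 < tau.
Hypothesis run : forall w, poe_run X FF gg GG (fun=> 1) (fun=> eta)
  (fun=> tau) T x0 (xi^~ w) (xibar^~ w) (x^~ w) (l^~ w).

Let Z := sample_family xi xibar.
Let Fs t w := FF (x t w) (xi t w).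
Let gs t w := gg (x t w) (xibar t w).
Let Gs t w := GG (x t w) (xi t w).

Let nF t w := F_noise F (Fs^~ w) (x^~ w) t.
Let ng t w := g_noise g (gs^~ w) (x^~ w) t.
Let nG t w := G_noise g' (Gs^~ w) (x^~ w) (l^~ w) t.

Lemma run_in t w : (t <= T)%N -> X (x t w).
Proof.
have [x0E _ step] := run w; case: t => [_|t tT]; first by rewrite x0E.
by have [_ []] := step _ tT.
Qed.

Lemma dual_update t w : (t < T)%N ->
  l t.+1 w = pos_part (l t w - tau^-1 *: - gs t w).
Proof.
move=> tT; have [_ _ step] := run w; have [[l1 lm] _] := step _ tT.
apply: is_proj_unique (is_proj_pos_part _).
apply: is_proj_argmin => //; first exact: nonneg_orthant_convex.
by split=> // k k0; rewrite !dotNl; exact: lm.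
Qed.

Let direction t w := (1 + 1) *: Fs t w
  - 1 *: (if t is t'.+1 then Fs t' w else Fs 0%N w) + Gs t w *m l t.+1 w.

Lemma primal_update t w : (t < T)%N ->
  x t.+1 w = proj X (x t w - eta^-1 *: direction t w).
Proof.
move=> tT; have [_ _ step] := run w; have [_ xm] := step _ tT.
apply: (is_proj_unique (is_proj_argmin X_convex eta_gt0 xm)).
by apply: projP => //; exists x0.
Qed.

Let vadapted J p (v : Om -> 'cV[R]_p) := forall i,
  adapted Z J (fun w => v w i 0).

Let vadapted_sub J J' p (v : Om -> 'cV[R]_p) :
  {subset J <= J'} -> vadapted J v -> vadapted J' v.
Proof. by move=> JJ av i; exact: adapted_sub JJ (av i). Qed.

Let vadaptedP J (v : Om -> 'cV[R]_n) :
  vadapted J v <-> adapted Z J (v : Om -> borelV R n).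
Proof.
split => [av|av i]; first exact: (@measurable_borelV _ _ _ (infoT Z J)).
by have := measurableT_comp (@measurable_coord R n i) av.
Qed.

Let oracle_step t : (t < T)%N -> adapted Z (past t) (x t : Om -> borelV R n) ->
  vadapted (past t) (l t) ->
  vadapted (past_dual t) (l t.+1) /\ vadapted (past t.+1) (Fs t) /\
  (forall j, vadapted (past t.+1) (fun w => col j (Gs t w))).
Proof.
move=> tT ax al; have xin w := run_in w (ltnW tT).
have ax1 := adapted_sub (past_sub_dual (t := t)) ax.
have ax2 := adapted_sub (past_dual_sub (t := t)) ax1.
split; last split.
- move=> j.
  have -> : (fun w => l t.+1 w j 0) =
      (fun w => Num.max (l t w j 0 - tau^-1 * - gs t w j 0) 0).
    by apply/funext => w; rewrite dual_update// !mxE.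
  apply: measurable_maxr => //; apply: measurable_funB.
    exact: adapted_sub (past_sub_dual (t := t)) (al j).
  apply: measurable_funM => //; apply: measurable_funN.
  have := oracle_adapted X_compact gg_oracle (i0 := inr t) ax1 xin j.
  by apply; rewrite mem_head.
- move=> i.
  apply: (oracle_adapted X_compact FF_oracle (i0 := inl t) ax2 xin).
  by rewrite mem_past_inl.
- move=> j i.
  apply: (oracle_adapted X_compact (GG_oracle j) (i0 := inl t)
    ax2 xin).
  by rewrite mem_past_inl.
Qed.

(** The iterates are functions of the samples already drawn.  Strong
    induction, because the extrapolation also uses the previous operator
    value. *)
Lemma iterates_adapted t : (t <= T)%N ->
  adapted Z (past t) (x t : Om -> borelV R n) /\ vadapted (past t) (l t).
Proof.
elim/ltn_ind: t => -[_ _|t IH tT].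
  split.
    have -> : x 0%N = (fun=> x0) by apply/funext => w; have [] := run w.
    exact: measurable_cst.
  move=> j; have -> : (fun w => l 0%N w j 0) = (fun=> 0).
    by apply/funext => w; have [_ -> _] := run w; rewrite mxE.
  exact: measurable_cst.
have [ax al] := IH t (ltnSn t) (ltnW tT).
have [al1 [aF aG]] := oracle_step tT ax al.
have al2 := vadapted_sub (past_dual_sub (t := t)) al1.
split => //.
have -> : x t.+1 = (fun w => proj X (x t w - eta^-1 *: direction t w)).
  by apply/funext => w; exact: primal_update.
have mp : measurable_fun setT (proj X : borelV R n -> borelV R n).
  by apply: measurable_proj => //; exists x0.
apply: (measurableT_comp mp); apply/vadaptedP => i.
have -> : (fun w => (x t w - eta^-1 *: direction t w) i 0) =
  (fun w => x t w i 0 - eta^-1 * ((1 + 1) * Fs t w i 0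
     - (if t is t'.+1 then Fs t' w else Fs 0%N w) i 0
     + \sum_j Gs t w i j * l t.+1 w j 0)).
  by apply/funext => w; rewrite /direction !mxE mul1r.
apply: measurable_funB.
  exact: adapted_sub (past_le (leqnSn t)) ((vadaptedP _ _).2 ax i).
apply: measurable_funM => //; apply: measurable_funD.
  apply: measurable_funB; first by apply: measurable_funM => //; exact: aF.
  case: t IH tT ax al al1 aF aG al2 => [|t] IH tT ax al al1 aF aG al2.
    exact: aF.
  have [ax' al'] := IH t (leqnSn _) (ltnW (ltnW tT)).
  have [_ [aF' _]] := oracle_step (ltnW tT) ax' al'.
  by apply: adapted_sub (past_le (leqnSn _)) _; exact: aF'.
apply: measurable_sum => j; apply: measurable_funM; last exact: al2.
have := aG j i; rewrite /adapted.
suff -> : (fun w => col j (Gs t w) i 0) = (fun w => Gs t w i j) by [].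
by apply/funext => w; rewrite mxE.
Qed.

Let ax t : (t <= T)%N -> adapted Z (past t) (x t : Om -> borelV R n).
Proof. by move=> /iterates_adapted[]. Qed.

Let al t : (t <= T)%N -> vadapted (past t) (l t).
Proof. by move=> /iterates_adapted[]. Qed.

Let al1 t : (t < T)%N -> vadapted (past_dual t) (l t.+1).
Proof. by move=> tT; have [] := oracle_step tT (ax (ltnW tT)) (al (ltnW tT)). Qed.

Let vadapted_measurable J p (v : Om -> 'cV[R]_p) i : vadapted J v ->
  measurable_fun setT (fun w => v w i 0).
Proof. by move=> av; exact: adapted_measurable (av i). Qed.

Let one_L2 : L2 P (fun=> 1). Proof. exact: L2_cst. Qed.

Let mul1_L2 (f : Om -> R) : L2 P (fun w => 1 * f w) -> L2 P f.
Proof.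
by have -> : (fun w => 1 * f w) = f by apply/funext => w; rewrite mul1r.
Qed.

Lemma F_noise_L2 t : (t <= T)%N -> vL2 P (nF t).
Proof.
move=> tT i; apply: mul1_L2.
apply: (oracle_error_L2 indep law X_compact FF_oracle (i0 := inl t) (ax tT))
  => //; last exact: measurable_cst.
- by move=> w; exact: run_in.
- exact: past_fresh_inl.
Qed.

Lemma g_noise_L2 t : (t <= T)%N -> vL2 P (ng t).
Proof.
move=> tT i; apply: mul1_L2.
apply: (oracle_error_L2 indep law X_compact gg_oracle (i0 := inr t) (ax tT))
  => //; last exact: measurable_cst.
- by move=> w; exact: run_in.
- exact: past_fresh_inr.
Qed.

Lemma F_noise_moment t : (t <= T)%N ->
  mean P (fun w => norm2 (nF t w) ^+ 2) <= sigma ^+ 2.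
Proof.
move=> tT.
have [||_] := @oracle_error_second_moment _ _ _ _ _ _ _ _ _ indep law _ _ _
  X_compact _ _ _ FF_oracle _ (inl t) _ (ax tT) (fun w => run_in w tT)
  (past_fresh_inl t) (fun=> 1).
- exact: measurable_cst.
- by case: one_L2.
rewrite expr1n mean_cst mulr1; apply: le_trans.
by rewrite le_eqVlt; apply/orP; left; apply/eqP/eq_mean => w; rewrite mul1r.
Qed.

Lemma g_noise_moment t : (t <= T)%N ->
  mean P (fun w => norm2 (ng t w) ^+ 2) <= sigma_g ^+ 2.
Proof.
move=> tT.
have [||_] := @oracle_error_second_moment _ _ _ _ _ _ _ _ _ indep law _ _ _
  X_compact _ _ _ gg_oracle _ (inr t) _ (ax tT) (fun w => run_in w tT)
  (past_fresh_inr t) (fun=> 1).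
- exact: measurable_cst.
- by case: one_L2.
rewrite expr1n mean_cst mulr1; apply: le_trans.
by rewrite le_eqVlt; apply/orP; left; apply/eqP/eq_mean => w; rewrite mul1r.
Qed.

Lemma F_noise_orthogonal t (r : Om -> 'cV[R]_n) : (t <= T)%N ->
  vadapted (past t) r -> vL2 P r -> mean P (fun w => dot (r w) (nF t w)) = 0.
Proof.
move=> tT ar Lr.
have o i := @oracle_error_orthogonal _ _ _ _ _ _ _ _ _ indep law _ _ _
  X_compact _ _ _ FF_oracle _ (inl t) _ (ax tT) (fun w => run_in w tT)
  (past_fresh_inl t) _ i (ar i) (L2_integ (Lr i)).
rewrite /dot mean_sum => [|i _]; last by have [] := o i.
by rewrite big1// => i _; have [] := o i.
Qed.

(** [l t.+1] depends on [xibar t]: only vectors known before the dual step may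
    be paired with [ng t]. *)
Lemma g_noise_orthogonal t (r : Om -> 'cV[R]_m) : (t <= T)%N ->
  vadapted (past t) r -> vL2 P r -> mean P (fun w => dot (r w) (ng t w)) = 0.
Proof.
move=> tT ar Lr.
have o i := @oracle_error_orthogonal _ _ _ _ _ _ _ _ _ indep law _ _ _
  X_compact _ _ _ gg_oracle _ (inr t) _ (ax tT) (fun w => run_in w tT)
  (past_fresh_inr t) _ i (ar i) (L2_integ (Lr i)).
rewrite /dot mean_sum => [|i _]; last by have [] := o i.
by rewrite big1// => i _; have [] := o i.
Qed.

Lemma iterate_L2 t y : (t <= T)%N -> vL2 P (fun w => x t w - y).
Proof.
move=> tT i; have [K HK] := compact_dist_bounded X_compact.
apply: (@L2_bounded _ _ _ _ _ (K + norm2 (x0 - y))).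
  have -> : (fun w => (x t w - y) i 0) = (fun w => x t w i 0 - y i 0).
    by apply/funext => w; rewrite !mxE.
  apply: measurable_funB => //.
  exact: (vadapted_measurable i ((vadaptedP _ _).2 (ax tT))).
move=> w; apply: le_trans (coord_le_norm2 _ _) _.
apply: le_trans (norm2_triangle _ x0 _) _; rewrite lerD2r.
by apply: HK => //; exact: run_in.
Qed.

(** Finiteness of the second moments is needed beforehand: the estimate of the
    multiplier energy has that energy on both sides. *)
Lemma multiplier_L2 t : (t <= T)%N -> vL2 P (l t).
Proof.
elim: t => [_|t IH tT] j.
  have -> : (fun w => l 0%N w j 0) = (fun=> 0).
    by apply/funext => w; have [_ -> _] := run w; rewrite mxE.
  exact: L2_cst.
have tT' := ltnW tT.
have Lg : L2 P (fun w => g (x t w) j 0).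
  have [K HK] := compact_dist_bounded X_compact.
  apply: (@L2_bounded _ _ _ _ _ (Mg * K + norm2 (g x0))).
    have -> : (fun w => g (x t w) j 0) = (fun w => gs t w j 0 - ng t w j 0).
      by apply/funext => w; rewrite /ng /g_noise !mxE; ring.
    have ax1 := adapted_sub (past_sub_dual (t := t)) (ax tT').
    apply: (@adapted_measurable _ _ _ _ _ _ _ Z (past_dual t)).
    apply: measurable_funB.
    - apply: (oracle_adapted X_compact gg_oracle (i0 := inr t) ax1).
        by move=> w; exact: run_in.
      by rewrite mem_head.
    - apply: (oracle_error_adapted X_compact gg_oracle
        (i0 := inr t) ax1).
        by move=> w; exact: run_in.
      by rewrite mem_head.
  move=> w; apply: le_trans (coord_le_norm2 _ _) _.
  have -> : g (x t w) = (g (x t w) - g x0) + g x0 by rewrite subrK.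
  apply: le_trans (norm2D _ _) _; rewrite lerD2r.
  have Xt := run_in w tT'.
  apply: le_trans (g_lip Xt x0_in) _; apply: ler_wpM2l => //; exact: HK.
have Lgs : L2 P (fun w => gs t w j 0).
  have -> : (fun w => gs t w j 0) = (fun w => ng t w j 0 + g (x t w) j 0).
    by apply/funext => w; rewrite /ng /g_noise !mxE; ring.
  by apply: L2D => //; exact: g_noise_L2.
have Ls := L2D (IH tT' j) (L2Z tau^-1 Lgs).
apply: (L2_le _ Ls.2).
  by apply: (@vadapted_measurable (past t.+1)); exact: al.
move=> w; rewrite dual_update// !mxE mulrN opprK.
case: (leP (l t w j 0 + tau^-1 * gs t w j 0) 0) => // _.
by rewrite expr0n sqr_ge0.
Qed.

Let Gcol_moment t j : (t < T)%N ->
  integ P (fun w => norm2 (l t.+1 w) ^+ 2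
    * norm2 (col j (Gs t w) - col j (g' (x t w))) ^+ 2) /\
  mean P (fun w => norm2 (l t.+1 w) ^+ 2
    * norm2 (col j (Gs t w) - col j (g' (x t w))) ^+ 2)
  <= sigma_G j 0 ^+ 2 * mean P (fun w => norm2 (l t.+1 w) ^+ 2).
Proof.
move=> tT.
apply: (@oracle_error_second_moment _ _ _ _ _ _ _ _ _ indep law _ _ _
  X_compact _ _ _ (GG_oracle j) (past_dual t) (inl t)).
- exact: adapted_sub (past_sub_dual (t := t)) (ax (ltnW tT)).
- by move=> w; exact/run_in/ltnW.
- exact: past_dual_fresh.
- by apply: measurable_norm2 => i; exact: al1.
- by have [] := vL2_norm2 (multiplier_L2 tT).
Qed.

Let nGE t w : nG t w =
  \sum_j l t.+1 w j 0 *: (col j (Gs t w) - col j (g' (x t w))).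
Proof.
rewrite /nG /G_noise mulmx_colE; apply: eq_bigr => j _; congr (_ *: _).
by apply/matrixP => a b; rewrite !mxE.
Qed.

Lemma G_noise_L2 t : (t < T)%N -> vL2 P (nG t).
Proof.
move=> tT i.
have -> : (fun w => nG t w i 0) = (fun w => \sum_j
    l t.+1 w j 0 * (col j (Gs t w) - col j (g' (x t w))) i 0).
  apply/funext => w; rewrite nGE summxE; apply: eq_bigr => j _.
  by rewrite mxE.
apply: L2_sum => j _.
apply: (@oracle_error_L2 _ _ _ _ _ _ _ _ _ indep law _ _ _
  X_compact _ _ _ (GG_oracle j) (past_dual t) (inl t)).
- exact: adapted_sub (past_sub_dual (t := t)) (ax (ltnW tT)).
- by move=> w; exact/run_in/ltnW.
- exact: past_dual_fresh.
- exact: al1.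
- exact: multiplier_L2.
Qed.

(** Cauchy-Schwarz over the columns separates the multiplier, which is
    known when the sample is drawn, from the errors of the columns. *)
Lemma G_noise_moment t : (t < T)%N ->
  mean P (fun w => norm2 (nG t w) ^+ 2)
  <= norm2 sigma_G ^+ 2 * mean P (fun w => norm2 (l t.+1 w) ^+ 2).
Proof.
move=> tT.
pose S w := \sum_j norm2 (l t.+1 w) ^+ 2
    * norm2 (col j (Gs t w) - col j (g' (x t w))) ^+ 2.
apply: (@le_trans _ _ (mean P S)).
  apply: le_mean.
  - by have [] := vL2_norm2 (G_noise_L2 tT).
  - by apply: integ_sum => j _; have [] := Gcol_moment j tT.
  move=> w; rewrite /S -mulr_sumr mulrC.
  apply: le_trans (norm2_mulmx_le _ _) _; rewrite le_eqVlt; apply/orP; left.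
  apply/eqP; congr (_ * _); apply: eq_bigr => j _; congr (norm2 _ ^+ 2).
  by apply/matrixP => a b; rewrite !mxE.
rewrite mean_sum => [|j _]; last by have [] := Gcol_moment j tT.
rewrite norm2_sqrE mulr_suml; apply: ler_sum => j _.
by have [] := Gcol_moment j tT.
Qed.

Lemma G_noise_orthogonal t (r : Om -> 'cV[R]_n) : (t < T)%N ->
  vadapted (past_dual t) r -> vL2 P r ->
  mean P (fun w => dot (r w) (nG t w)) = 0.
Proof.
move=> tT ar Lr.
have o i j : integ P (fun w => (r w i 0 * l t.+1 w j 0)
      * (col j (Gs t w) - col j (g' (x t w))) i 0) /\
    mean P (fun w => (r w i 0 * l t.+1 w j 0)
      * (col j (Gs t w) - col j (g' (x t w))) i 0) = 0.
  apply: (@oracle_error_orthogonal _ _ _ _ _ _ _ _ _ indep law _ _ _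
    X_compact _ _ _ (GG_oracle j) (past_dual t) (inl t)).
  - exact: adapted_sub (past_sub_dual (t := t)) (ax (ltnW tT)).
  - by move=> w; exact/run_in/ltnW.
  - exact: past_dual_fresh.
  - by apply: measurable_funM; [exact: ar|exact: al1].
  - by apply: L2_mul => //; exact: multiplier_L2.
transitivity (mean P (fun w => \sum_i \sum_j (r w i 0 * l t.+1 w j 0)
      * (col j (Gs t w) - col j (g' (x t w))) i 0)).
  apply: eq_mean => w; apply: eq_bigr => i _.
  rewrite nGE summxE mulr_sumr; apply: eq_bigr => j _.
  by rewrite -mulrA; congr (_ * _); rewrite mxE.
rewrite mean_sum => [|i _]; last first.
  by apply: integ_sum => j _; have [] := o i j.
rewrite big1// => i _; rewrite mean_sum => [|j _]; last by have [] := o i j.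
by rewrite big1// => j _; have [] := o i j.
Qed.

Let iterate_adapted t y : (t <= T)%N -> vadapted (past t) (fun w => x t w - y).
Proof.
move=> tT i.
have -> : (fun w => (x t w - y) i 0) = (fun w => x t w i 0 - y i 0).
  by apply/funext => w; rewrite !mxE.
by apply: measurable_funB => //; exact: (vadaptedP _ _).2 (ax tT) i.
Qed.

Let multiplier_adapted t lam : (t <= T)%N ->
  vadapted (past t) (fun w => l t w - lam).
Proof.
move=> tT i.
have -> : (fun w => (l t w - lam) i 0) = (fun w => l t w i 0 - lam i 0).
  by apply/funext => w; rewrite !mxE.
by apply: measurable_funB => //; exact: al.
Qed.

Let F_noise_adapted t : (t <= T)%N -> vadapted (past t.+1) (nF t).
Proof.
move=> tT i; have ax1 := adapted_sub (past_le (leqnSn t)) (ax tT).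
apply: (oracle_error_adapted X_compact FF_oracle (i0 := inl t) ax1).
- by move=> w; exact: run_in.
- by rewrite mem_past_inl.
Qed.

Let g_noise_adapted t : (t <= T)%N -> vadapted (past t.+1) (ng t).
Proof.
move=> tT i; have ax1 := adapted_sub (past_le (leqnSn t)) (ax tT).
apply: (oracle_error_adapted X_compact gg_oracle (i0 := inr t) ax1).
- by move=> w; exact: run_in.
- by rewrite mem_past_inr.
Qed.

Let G_noise_adapted t : (t < T)%N -> vadapted (past t.+1) (nG t).
Proof.
move=> tT i; have ax1 := adapted_sub (past_le (leqnSn t)) (ax (ltnW tT)).
have -> : (fun w => nG t w i 0) = (fun w => \sum_j
    l t.+1 w j 0 * (col j (Gs t w) - col j (g' (x t w))) i 0).
  apply/funext => w; rewrite nGE summxE; apply: eq_bigr => j _.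
  by rewrite mxE.
apply: measurable_sum => j; apply: measurable_funM; first exact: al.
apply: (oracle_error_adapted X_compact (GG_oracle j) (i0 := inl t) ax1).
- by move=> w; apply: run_in; exact: ltnW.
- by rewrite mem_past_inl.
Qed.

Let sum_adapted p (D : nat -> Om -> 'cV[R]_p) t J :
  (forall s, (s < t)%N -> vadapted J (D s)) ->
  vadapted J (fun w => \sum_(s < t) D s w).
Proof.
move=> aD i.
have -> : (fun w => (\sum_(s < t) D s w) i 0) =
    (fun w => \sum_(s < t) D s w i 0).
  by apply/funext => w; rewrite summxE.
by apply: measurable_sum => s; exact: aD.
Qed.

Let sum_L2 p (D : nat -> Om -> 'cV[R]_p) t :
  (forall s, (s < t)%N -> vL2 P (D s)) -> vL2 P (fun w => \sum_(s < t) D s w).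
Proof.
move=> LD; apply: (@vL2_sum _ _ _ P _ _ (index_enum 'I_t) xpredT
  (fun s : 'I_t => D s)) => s _; exact: LD.
Qed.

Lemma F_noise_sum_L2 : vL2 P (fun w => \sum_(t < T) nF t.+1 w).
Proof. by apply: (@sum_L2 _ (fun t => nF t.+1)) => t tT; exact: F_noise_L2. Qed.

Lemma G_noise_sum_L2 : vL2 P (fun w => \sum_(t < T) nG t w).
Proof. by apply: sum_L2 => t tT; exact: G_noise_L2. Qed.

Lemma g_noise_sum_L2 : vL2 P (fun w => \sum_(t < T) ng t w).
Proof. by apply: sum_L2 => t tT; apply: g_noise_L2; exact: ltnW. Qed.

Lemma F_noise_sum_moment :
  mean P (fun w => norm2 (\sum_(t < T) nF t.+1 w) ^+ 2) <= T%:R * sigma ^+ 2.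
Proof.
rewrite (@mean_norm2_sum _ _ _ _ _ (fun t => nF t.+1)).
- apply: le_trans (ler_sum _ (fun t _ => F_noise_moment (ltn_ord t))) _.
  by rewrite sumr_const card_ord mulr_natl.
- by move=> t tT; exact: F_noise_L2.
move=> t tT; apply: F_noise_orthogonal => //.
- apply: (@sum_adapted _ (fun s => nF s.+1)) => s st.
  apply: vadapted_sub (F_noise_adapted (t := s.+1) _).
    exact: past_le.
  exact: ltn_trans st tT.
- apply: (@sum_L2 _ (fun s => nF s.+1)) => s st; apply: F_noise_L2.
  exact: ltn_trans st tT.
Qed.

Lemma G_noise_sum_moment :
  mean P (fun w => norm2 (\sum_(t < T) nG t w) ^+ 2) <=
  norm2 sigma_G ^+ 2 * \sum_(t < T) mean P (fun w => norm2 (l t.+1 w) ^+ 2).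
Proof.
rewrite mean_norm2_sum.
- rewrite mulr_sumr; apply: ler_sum => t _; exact: G_noise_moment.
- by move=> t tT; exact: G_noise_L2.
move=> t tT; apply: G_noise_orthogonal => //.
- apply: vadapted_sub (past_sub_dual (t := t)) _.
  apply: sum_adapted => s st.
  by apply: vadapted_sub (past_le st) (G_noise_adapted (ltn_trans st tT)).
- by apply: sum_L2 => s st; exact/G_noise_L2/(ltn_trans st tT).
Qed.

Lemma g_noise_sum_moment :
  mean P (fun w => norm2 (\sum_(t < T) ng t w) ^+ 2) <= T%:R * sigma_g ^+ 2.
Proof.
rewrite mean_norm2_sum.
- apply: le_trans (ler_sum _ (fun t _ => g_noise_moment (ltnW (ltn_ord t)))) _.
  by rewrite sumr_const card_ord mulr_natl.
- by move=> t tT; exact/g_noise_L2/ltnW.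
move=> t tT; apply: g_noise_orthogonal; first exact: ltnW.
- apply: sum_adapted => s st; have sT := ltn_trans st tT.
  by apply: vadapted_sub (past_le st) (g_noise_adapted (ltnW sT)).
- by apply: sum_L2 => s st; exact/g_noise_L2/ltnW/(ltn_trans st tT).
Qed.

Let jump t w := F_jump F H (Fs^~ w) (x^~ w) t.

Let jump_bound t w : jump t.+1 w ^+ 2 <=
  2 * H ^+ 2 + 2 * norm2 (nF t.+1 w - nF t w) ^+ 2.
Proof.
rewrite /jump /F_jump -/(nF t.+1 w) -/(nF t w).
have := sqr_ge0 (H - norm2 (nF t.+1 w - nF t w)); rewrite sqrrB sqrrD; lra.
Qed.

Let jump_dominated t : (t < T)%N ->
  integ P (fun w => 2 * H ^+ 2 + 2 * norm2 (nF t.+1 w - nF t w) ^+ 2).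
Proof.
move=> tT; apply: integD; first exact: integ_cst.
apply: integZ; have [] // := vL2_norm2 (vL2B (F_noise_L2 tT) (F_noise_L2 (ltnW tT))).
Qed.

Lemma jump_integ t : (t < T)%N -> integ P (fun w => jump t.+1 w ^+ 2).
Proof.
move=> tT; apply: (integ_le _ (jump_dominated tT)) => [|w]; last first.
  by rewrite ger0_norm ?sqr_ge0//; exact: jump_bound.
apply: measurable_funX; rewrite /jump /F_jump; apply: measurable_funD => //.
apply: measurable_norm2 => i.
by have [] := vL2B (F_noise_L2 tT) (F_noise_L2 (ltnW tT)) i.
Qed.

(** The consecutive noises are orthogonal, so only their variances add up. *)
Lemma jump_moment t : (t < T)%N ->
  mean P (fun w => jump t.+1 w ^+ 2) <= 2 * (H ^+ 2 + 2 * sigma ^+ 2).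
Proof.
move=> tT; have L1 := F_noise_L2 tT; have L0 := F_noise_L2 (ltnW tT).
apply: le_trans (le_mean (jump_integ tT) (jump_dominated tT) _) _.
  exact: jump_bound.
have i1 := (vL2_norm2 L1).2; have i0 := (vL2_norm2 L0).2.
have id := (vL2_norm2 (vL2B L1 L0)).2.
rewrite (meanD (integ_cst P _) (integZ 2 id)) mean_cst (meanZ _ id).
have -> : mean P (fun w => norm2 (nF t.+1 w - nF t w) ^+ 2) =
    mean P (fun w => norm2 (nF t.+1 w) ^+ 2
      + (- 2 * dot (nF t w) (nF t.+1 w) + norm2 (nF t w) ^+ 2)).
  apply: eq_mean => w; move: (nF t.+1 w) (nF t w) => u v.
  by rewrite !norm2_sqr !(dotBl, dotBr) (dotC u v); ring.
have i2 := integZ (- 2) (vL2_dot L0 L1).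
rewrite (meanD i1 (integD i2 i0)) (meanD i2 i0) (meanZ _ (vL2_dot L0 L1)).
rewrite (F_noise_orthogonal tT (F_noise_adapted (ltnW tT)) L0).
have := F_noise_moment tT; have := F_noise_moment (ltnW tT).
by move: (mean P _) (mean P _) => a b; lra.
Qed.

(** Each of the three noises is paired with a vector that is known before its
    sample is drawn. *)
Lemma noise_term_mean y lam t : (t < T)%N ->
  integ P (fun w => noise_term F g g' (Fs^~ w) (gs^~ w) (Gs^~ w) (x^~ w)
    (l^~ w) y lam t) /\
  mean P (fun w => noise_term F g g' (Fs^~ w) (gs^~ w) (Gs^~ w) (x^~ w)
    (l^~ w) y lam t) = 0.
Proof.
move=> tT; have tT' := ltnW tT.
have Lx1 := iterate_L2 y tT; have Lx := iterate_L2 y tT'.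
have Ll := vL2B (multiplier_L2 tT') (vL2_cst P lam).
have i1 := vL2_dot Lx1 (F_noise_L2 tT).
have i2 := vL2_dot Lx (G_noise_L2 tT).
have i3 := vL2_dot Ll (g_noise_L2 tT').
have E : (fun w => noise_term F g g' (Fs^~ w) (gs^~ w) (Gs^~ w) (x^~ w)
    (l^~ w) y lam t) = (fun w => (dot (l t w - lam) (ng t w)
      - dot (x t.+1 w - y) (nF t.+1 w)) - dot (x t w - y) (nG t w)).
  apply/funext => w; rewrite /noise_term (dotC _ (x t.+1 w - y)).
  rewrite (dotC _ (x t w - y)) (dotC _ (l t w - lam)) addrC addrA.
  by [].
rewrite E; split; first exact: integB (integB i3 i1) i2.
rewrite (meanB (integB i3 i1) i2) (meanB i3 i1).
rewrite (F_noise_orthogonal tT (iterate_adapted y tT) Lx1).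
rewrite (g_noise_orthogonal tT' (multiplier_adapted lam tT') Ll).
rewrite G_noise_orthogonal ?subrr//.
exact: vadapted_sub (past_sub_dual (t := t)) (iterate_adapted y tT').
Qed.

(** * The two bounds in expectation *)

Hypothesis L_ge0 : 0 <= L.
Hypothesis F_growth : forall x1 x2, X x1 -> X x2 ->
  norm2 (F x1 - F x2) <= L * norm2 (x1 - x2) + H.
Hypothesis F_monotone : forall x1 x2, X x1 -> X x2 ->
  0 <= dot (F x1 - F x2) (x1 - x2).
Hypothesis g_convex : forall j, convex_function X (fun x => g x j 0).
Hypothesis g'_sub : forall x y, X x -> X y -> forall j,
  g x j 0 + dot (col j (g' x)) (y - x) <= g y j 0.
Hypothesis g'_bound : forall x l, X x -> norm2 (g' x *m l) <= Mg * norm2 l.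
Hypothesis L_eta : 25 * L <= 3 * eta.
Hypothesis T_gt0 : (0 < T)%N.

Let error c t w := error_term F H g g' Mg eta tau (Fs^~ w) (gs^~ w) (Gs^~ w)
  (x^~ w) (l^~ w) c t.
Let noise_at y lam t w := noise_term F g g' (Fs^~ w) (gs^~ w) (Gs^~ w)
  (x^~ w) (l^~ w) y lam t.

Let trajectory_gap w k y lam : (k <= T)%N -> X y -> nonneg_orthant lam ->
  \sum_(t < k) (dot (F (x t.+1 w)) (x t.+1 w - y) + dot lam (g (x t.+1 w))
                - dot (l t.+1 w) (g y))
  + tau / 2 * norm2 (lam - l k w) ^+ 2
  <= eta / 2 * norm2 (y - x0) ^+ 2 + tau / 2 * norm2 lam ^+ 2
   + \sum_(t < k) error (norm2 lam) t w + \sum_(t < k) noise_at y lam t w.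
Proof.
move=> kT Xy lam0; have [x00 l00 step] := run w; rewrite -x00.
have := @gap_sum_le _ _ _ X F L H g g' Mg eta tau T (Fs^~ w) (gs^~ w) (Gs^~ w)
  (x^~ w) (l^~ w) X_convex L_ge0 F_growth g_lip g'_sub g'_bound eta_gt0 tau_gt0
  L_eta.
apply=> //; first by rewrite x00.
- by move=> t /step[].
- by move=> t /step[_ []] h1 h2; split.
Qed.

Let multiplier_nonneg w t : (t <= T)%N -> nonneg_orthant (l t w).
Proof.
have [_ l00 step] := run w; case: t => [_ j|t /step[[]]//].
by rewrite l00 mxE.
Qed.

(** The quantity through which the errors and the multipliers bound each
    other. *)
Definition multiplier_energy :=
  \sum_(t < T) mean P (fun w => norm2 (l t.+1 w) ^+ 2).

Let V := H ^+ 2 + 2 * sigma ^+ 2.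
Let S := multiplier_energy.
Let sG := norm2 sigma_G.

(** Dominates the mean of the summed error terms; the multiplier energy in it
    is still unknown at this stage. *)
Definition error_bound (c : R) :=
  T%:R * (sigma_g ^+ 2 / (2 * tau)) + 5 / 2 * T%:R * (V / eta)
  + (5 / 2 * Mg ^+ 2 + 25 / 4 * sG ^+ 2) * S / eta
  + 25 / 4 * T%:R * ((Mg * c) ^+ 2 / eta).

Let errorE c t : error c t = fun w =>
  (2 * tau)^-1 * norm2 (ng t w) ^+ 2 + (5 / 4 / eta * jump t.+1 w ^+ 2
  + (5 / 2 * Mg ^+ 2 / eta * norm2 (l t.+1 w) ^+ 2
  + (25 / 4 / eta * norm2 (nG t w) ^+ 2 + 25 / 4 * ((Mg * c) ^+ 2 / eta)))).
Proof.
apply/funext => w; rewrite /error /error_term -/(ng t w) -/(nG t w).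
rewrite -/(jump t.+1 w); field.
by rewrite !gt_eqF.
Qed.

Let error_integ c t : (t < T)%N -> integ P (error c t) /\
  mean P (error c t) <= sigma_g ^+ 2 / (2 * tau) + 5 / 2 * (V / eta)
  + (5 / 2 * Mg ^+ 2 + 25 / 4 * sG ^+ 2)
      * mean P (fun w => norm2 (l t.+1 w) ^+ 2) / eta
  + 25 / 4 * ((Mg * c) ^+ 2 / eta).
Proof.
move=> tT; have tT' := ltnW tT.
have i1 := (vL2_norm2 (g_noise_L2 tT')).2.
have i2 := jump_integ tT.
have i3 := (vL2_norm2 (multiplier_L2 tT)).2.
have i4 := (vL2_norm2 (G_noise_L2 tT)).2.
have i5 := integ_cst P (25 / 4 * ((Mg * c) ^+ 2 / eta)).
have j1 := integZ (2 * tau)^-1 i1.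
have j2 := integZ (5 / 4 / eta) i2.
have j3 := integZ (5 / 2 * Mg ^+ 2 / eta) i3.
have j4 := integZ (25 / 4 / eta) i4.
rewrite errorE; split; first by repeat apply: integD => //.
rewrite (meanD j1 (integD j2 (integD j3 (integD j4 i5)))).
rewrite (meanD j2 (integD j3 (integD j4 i5))) (meanD j3 (integD j4 i5)).
rewrite (meanD j4 i5) (meanZ _ i1) (meanZ _ i2) (meanZ _ i3) (meanZ _ i4).
rewrite mean_cst.
have e0 : 0 <= eta^-1 by rewrite invr_ge0 ltW.
have t0 : 0 <= (2 * tau)^-1 by rewrite invr_ge0 mulr_ge0// ltW.
have h1 := ler_wpM2l t0 (g_noise_moment tT').
have h2 := ler_wpM2l e0 (jump_moment tT).
have h4 := ler_wpM2l e0 (G_noise_moment tT).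
rewrite /V /sG in h1 h2 h4 *.
lra.
Qed.

Let error_sum_integ c : integ P (fun w => \sum_(t < T) error c t w) /\
  mean P (fun w => \sum_(t < T) error c t w) <= error_bound c.
Proof.
split; first by apply: integ_sum => t _; have [] := error_integ c (ltn_ord t).
rewrite mean_sum; last by move=> t _; have [] := error_integ c (ltn_ord t).
apply: le_trans (ler_sum _ (fun t _ => (error_integ c (ltn_ord t)).2)) _.
have sumc (a : R) : \sum_(t < T) a = T%:R * a.
  by rewrite sumr_const card_ord mulr_natl.
rewrite !big_split/= !sumc -mulr_suml -mulr_sumr -/multiplier_energy -/S.
rewrite /error_bound; move: V sG S (T%:R : R) => v s S' k.
rewrite le_eqVlt; apply/orP; left; apply/eqP; ring.
Qed.

Let noise_sum_integ y lam k : (k <= T)%N ->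
  integ P (fun w => \sum_(t < k) noise_at y lam t w) /\
  mean P (fun w => \sum_(t < k) noise_at y lam t w) = 0.
Proof.
move=> kT; have N (t : 'I_k) := noise_term_mean y lam (leq_trans (ltn_ord t) kT).
split; first by apply: integ_sum => t _; have [] := N t.
rewrite mean_sum => [|t _]; last by have [] := N t.
by rewrite big1// => t _; have [] := N t.
Qed.

Section SaddlePoint.
Variables (xstar : 'cV[R]_n) (lstar : 'cV[R]_m).
Hypothesis xstar_feasible : feasible X g xstar.
Hypothesis lstar_ge0 : nonneg_orthant lstar.
Hypothesis kkt : forall y, X y ->
  0 <= dot (F xstar) (y - xstar) + dot lstar (g y).

Let dist2 := norm2 (xstar - x0) ^+ 2.

Let dot_neg_ge0 w t y : (t <= T)%N -> (forall j, g y j 0 <= 0) ->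
  0 <= - dot (l t w) (g y).
Proof.
move=> tT g0; rewrite oppr_ge0; apply: sumr_le0 => j _.
by rewrite mulr_ge0_le0//; exact: multiplier_nonneg.
Qed.

(** The gap at the saddle point is nonnegative, which bounds the distance
    of the multipliers to [lstar] in mean square. *)
Let multiplier_dist k : (k <= T)%N ->
  mean P (fun w => norm2 (lstar - l k w) ^+ 2)
  <= eta / tau * dist2 + norm2 lstar ^+ 2
     + 2 / tau * error_bound (norm2 lstar).
Proof.
move=> kT; have [Xs gs0] := xstar_feasible.
have [ie me] := error_sum_integ (norm2 lstar).
have [in_ mn] := noise_sum_integ xstar lstar kT.
have iL : integ P (fun w => norm2 (lstar - l k w) ^+ 2).
  by have [] := vL2_norm2 (vL2B (vL2_cst P lstar) (multiplier_L2 kT)).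
set c0 := eta / tau * dist2 + norm2 lstar ^+ 2.
have ic := integ_cst P c0.
have je := integZ (2 / tau) ie; have jn := integZ (2 / tau) in_.
apply: (@le_trans _ _ (mean P (fun w => c0
    + (2 / tau * \sum_(t < T) error (norm2 lstar) t w
       + 2 / tau * \sum_(t < k) noise_at xstar lstar t w)))).
  apply: le_mean => //; first by repeat apply: integD => //.
  move=> w; have := trajectory_gap w kT Xs lstar_ge0; rewrite -/dist2.
  have G0 : 0 <= \sum_(t < k) (dot (F (x t.+1 w)) (x t.+1 w - xstar)
      + dot lstar (g (x t.+1 w)) - dot (l t.+1 w) (g xstar)).
    apply: sumr_ge0 => t _; have tT := leq_trans (ltn_ord t) kT.
    have Xt := run_in w tT.
    have := F_monotone Xt Xs; have := kkt Xt; have := dot_neg_ge0 w tT gs0.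
    rewrite dotBl; lra.
  have E0 : \sum_(t < k) error (norm2 lstar) t w
      <= \sum_(t < T) error (norm2 lstar) t w.
    rewrite -(big_mkord xpredT (fun t => error _ t w)).
    rewrite -(big_mkord xpredT (fun t => error _ t w)).
    rewrite [leRHS](big_cat_nat (n := k))//= lerDl sumr_ge0// => t _.
    exact: error_term_ge0.
  move: G0 E0.
  move: (\sum_(t < k) error _ t w) (\sum_(t < T) error _ t w).
  move: (\sum_(t < k) noise_at _ _ t w) (\sum_(t < k) _) (norm2 (lstar - _)).
  move=> b a u e1 e2 a0 e12 h.
  have t2 : 0 <= 2 / tau by rewrite divr_ge0// ltW.
  have h' : tau / 2 * u ^+ 2 <= eta / 2 * dist2 + tau / 2 * norm2 lstar ^+ 2
      + e2 + b by lra.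
  have := ler_wpM2l t2 h'; rewrite /c0.
  have -> : 2 / tau * (tau / 2 * u ^+ 2) = u ^+ 2 by field; rewrite gt_eqF.
  have -> : 2 / tau * (eta / 2 * dist2 + tau / 2 * norm2 lstar ^+ 2 + e2 + b) =
    eta / tau * dist2 + norm2 lstar ^+ 2 + (2 / tau * e2 + 2 / tau * b).
    by field; rewrite gt_eqF.
  by [].
rewrite (meanD ic (integD je jn)) (meanD je jn) mean_cst.
rewrite (meanZ _ ie) (meanZ _ in_) mn mulr0 addr0.
by rewrite lerD2l ler_wpM2l// divr_ge0// ltW.
Qed.

(** [|v|^2 <= 5 |lstar|^2 + 5/4 |lstar - v|^2] puts most of the weight on
    [lstar], for which the final bounds leave more room, and keeps the factor of
    the self-bounding term small. *)
Lemma multiplier_energy_le :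
  S <= T%:R * (5 * norm2 lstar ^+ 2
    + 5 / 4 * (eta / tau * dist2 + norm2 lstar ^+ 2
               + 2 / tau * error_bound (norm2 lstar))).
Proof.
rewrite /S /multiplier_energy mulr_natl -[X in _ *+ X]card_ord -sumr_const.
apply: ler_sum => t _; have tT := ltn_ord t.
have Ll := multiplier_L2 tT.
have iL := (vL2_norm2 (vL2B (vL2_cst P lstar) Ll)).2.
have jL := integZ (5 / 4) iL; have ic := integ_cst P (5 * norm2 lstar ^+ 2).
apply: (@le_trans _ _ (mean P (fun w => 5 * norm2 lstar ^+ 2
    + 5 / 4 * norm2 (lstar - l t.+1 w) ^+ 2))).
  apply: le_mean => [||w]; first exact: (vL2_norm2 Ll).2.
    exact: integD.
  move: (l t.+1 w) => v.
  have := dot_ge0 (2 *: lstar + 2^-1 *: (lstar - v)).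
  have -> : norm2 v ^+ 2 = norm2 (lstar - (lstar - v)) ^+ 2.
    by rewrite opprB addrC subrK.
  rewrite !norm2_sqr; move: (lstar - v) => u.
  rewrite !(dotBl, dotBr, dotDl, dotDr, dotZl, dotZr) (dotC u lstar); lra.
rewrite (meanD ic jL) mean_cst (meanZ _ iL) lerD2l ler_wpM2l//.
exact: multiplier_dist.
Qed.

(** The supremum over [y] is taken inside the expectation.  The noise that
    multiplies [y] is paired with [y - x0], so that only the norm of its
    sum matters, and this grows like [sqrt T]. *)
Let opt_bound (D : R) w := 3 / 2 * (eta * D ^+ 2)
  + (\sum_(t < T) error 0 t w + (\sum_(t < T) noise_at x0 0 t w
  + ((2 * eta)^-1 * norm2 (\sum_(t < T) nF t.+1 w) ^+ 2
     + (2 * eta)^-1 * norm2 (\sum_(t < T) nG t w) ^+ 2))).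

Let half_young (u v : R) : u * v <= (2 * eta)^-1 * u ^+ 2 + eta / 2 * v ^+ 2.
Proof.
have e2 : 0 < eta / 2 by rewrite divr_gt0.
apply: le_trans (young u v e2) _; rewrite lerD2r mulrC.
by have -> : 4 * (eta / 2) = 2 * eta by field.
Qed.

Let average_ergodic w (v y : 'cV[R]_n) :
  \sum_(t < T) dot v (x t.+1 w - y) =
  T%:R * dot v (ergodic_average T (x^~ w) - y).
Proof.
rewrite dotBr dotZr mulrBr mulrA divff ?pnatr_eq0 -?lt0n// mul1r dot_sumr.
under eq_bigr do rewrite dotBr.
by rewrite sumrB sumr_const card_ord mulr_natl.
Qed.

Let opt_pathwise D w y : (forall z, X z -> norm2 (z - x0) <= D) ->
  feasible X g y ->
  T%:R * dot (F y) (ergodic_average T (x^~ w) - y) <= opt_bound D w.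
Proof.
move=> HD [Xy gy0]; have D0 : 0 <= D := le_trans (norm2_ge0 _) (HD _ Xy).
have z0 : nonneg_orthant (0 : 'cV[R]_m) by move=> j; rewrite mxE.
have := trajectory_gap w (leqnn T) Xy z0.
have n0 : norm2 (0 : 'cV[R]_m) = 0 by rewrite /norm2 dot0l sqrtr0.
rewrite n0 expr0n/= mulr0 addr0.
have G : T%:R * dot (F y) (ergodic_average T (x^~ w) - y) <=
    \sum_(t < T) (dot (F (x t.+1 w)) (x t.+1 w - y) + dot 0 (g (x t.+1 w))
      - dot (l t.+1 w) (g y)).
  rewrite -average_ergodic; apply: ler_sum => t _; have tT := ltn_ord t.
  have := F_monotone (run_in w tT) Xy; have := dot_neg_ge0 w tT gy0.
  rewrite dotBl dot0l; lra.
have E : \sum_(t < T) noise_at y 0 t w = \sum_(t < T) noise_at x0 0 t w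
    + dot (\sum_(t < T) nF t.+1 w) (y - x0)
    + dot (\sum_(t < T) nG t w) (y - x0).
  rewrite !dot_suml -!big_split/=; apply: eq_bigr => t _.
  rewrite /noise_at /noise_term -/(nF t.+1 w) -/(nG t w).
  have Ey a : a - y = (a - x0) - (y - x0) by rewrite opprB addrA subrK.
  rewrite (Ey (x t.+1 w)) (Ey (x t w)).
  by move: (nF _ _) (nG _ _) => a b; rewrite !(dotBr _ (y - x0)); ring.
rewrite E.
have Y1 := half_young (norm2 (\sum_(t < T) nF t.+1 w)) D.
have Y2 := half_young (norm2 (\sum_(t < T) nG t w)) D.
have yD := HD _ Xy.
have C1 := dot_le_norm2 (\sum_(t < T) nF t.+1 w) (y - x0).
have C2 := dot_le_norm2 (\sum_(t < T) nG t w) (y - x0).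
have C1' := ler_wpM2l (norm2_ge0 (\sum_(t < T) nF t.+1 w)) yD.
have C2' := ler_wpM2l (norm2_ge0 (\sum_(t < T) nG t w)) yD.
have Y3 : eta / 2 * norm2 (y - x0) ^+ 2 <= eta / 2 * D ^+ 2.
  apply: ler_wpM2l; first by rewrite divr_ge0// ltW.
  by rewrite ler_pXn2r ?nnegrE ?norm2_ge0.
have Y4 := mulr_ge0 (ltW tau_gt0) (sqr_ge0 (norm2 (0 - l T w))).
rewrite /opt_bound; lra.
Qed.

Lemma expected_optimality_gap (D : R) :
  (forall z, X z -> norm2 (z - x0) <= D) ->
  ('E_P[fun w => sup [set dot (F y) (ergodic_average T (x^~ w) - y)
                     | y in feasible X g]]
   <= (T%:R^-1 * (3 / 2 * (eta * D ^+ 2) + error_bound 0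
        + T%:R * sigma ^+ 2 / (2 * eta) + sG ^+ 2 * S / (2 * eta)))%:E)%E.
Proof.
move=> HD.
have T0 : 0 < T%:R :> R by rewrite ltr0n.
have [ie me] := error_sum_integ 0.
have [in_ mn] := noise_sum_integ x0 0 (leqnn T).
have i1 := (vL2_norm2 F_noise_sum_L2).2.
have i2 := (vL2_norm2 G_noise_sum_L2).2.
have j1 := integZ (2 * eta)^-1 i1; have j2 := integZ (2 * eta)^-1 i2.
have ic := integ_cst P (3 / 2 * (eta * D ^+ 2)).
have iB : integ P (opt_bound D) by repeat apply: integD => //.
apply: le_trans (expectation_le_mean (integZ T%:R^-1 iB) _) _.
  move=> w; apply: ge_sup; first by exists (dot (F xstar)
    (ergodic_average T (x^~ w) - xstar)); exists xstar.
  move=> _ [y fy <-]; rewrite ler_pdivlMl//; exact: opt_pathwise.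
rewrite lee_fin (meanZ _ iB); apply: ler_wpM2l.
  by rewrite invr_ge0 ltW.
rewrite /opt_bound.
rewrite (meanD ic (integD ie (integD in_ (integD j1 j2)))).
rewrite (meanD ie (integD in_ (integD j1 j2))) (meanD in_ (integD j1 j2)).
rewrite (meanD j1 j2) mean_cst mn (meanZ _ i1) (meanZ _ i2).
have e0 : 0 <= (2 * eta)^-1 by rewrite invr_ge0 mulr_ge0// ltW.
have h1 := ler_wpM2l e0 F_noise_sum_moment.
have h2 := ler_wpM2l e0 G_noise_sum_moment.
rewrite -/multiplier_energy -/S -/sG in h2; lra.
Qed.

Let feas_bound (c : R) w := (eta / 2 * dist2 + tau / 2 * c ^+ 2)
  + (\sum_(t < T) error c t w + (\sum_(t < T) noise_at xstar 0 t w
  + c * norm2 (\sum_(t < T) ng t w))).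

(** Testing the gap with the multiplier of norm [|lstar| + 1] that points
    along the violation [pos_part (g xbar)]: the part [|lstar|] absorbs the
    possible super-optimality of an infeasible average. *)
Let feas_pathwise w :
  T%:R * norm2 (pos_part (g (ergodic_average T (x^~ w))))
  <= feas_bound (norm2 lstar + 1) w.
Proof.
set xb := ergodic_average T (x^~ w); set p := pos_part (g xb).
set c := norm2 lstar + 1; have [Xs gs0] := xstar_feasible.
have c0 : 0 <= c by rewrite addr_ge0 ?norm2_ge0.
have T0 : 0 <= T%:R :> R by [].
have Xb : X xb.
  by apply: convex_average => // t tT; exact: run_in.
have gb j : T%:R * g xb j 0 <= \sum_(t < T) g (x t.+1 w) j 0.
  have [|_] := jensen_average X_convex (g_convex j) T_gt0 (x := x^~ w).
    by move=> t tT; exact: run_in.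
  by rewrite ler_pdivlMl ?ltr0n.
have p0 : nonneg_orthant p by move=> j; rewrite mxE le_max lexx orbT.
have gp j : g xb j 0 <= p j 0 by rewrite mxE le_max lexx.
pose lam := (c / norm2 p) *: p.
have k0 : 0 <= c / norm2 p by rewrite divr_ge0 ?norm2_ge0.
have lam0 : nonneg_orthant lam by move=> j; rewrite mxE mulr_ge0.
have lamc : norm2 lam <= c.
  rewrite norm2Z//; have [->|q0] := eqVneq (norm2 p) 0; first by rewrite mulr0.
  by rewrite divfK.
have pg : dot p (g xb) = norm2 p ^+ 2.
  rewrite norm2_sqr; apply: eq_bigr => j _; rewrite !mxE.
  by case: leP => // _; rewrite !mul0r.
have lg : dot lam (g xb) = c * norm2 p.
  rewrite dotZl pg; have [->|q0] := eqVneq (norm2 p) 0.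
    by rewrite expr0n !mulr0.
  by rewrite expr2 mulrA divfK.
have := trajectory_gap w (leqnn T) Xs lam0; rewrite -/dist2.
have G : T%:R * norm2 p <= \sum_(t < T) (dot (F (x t.+1 w)) (x t.+1 w - xstar)
    + dot lam (g (x t.+1 w)) - dot (l t.+1 w) (g xstar)).
  apply: (@le_trans _ _ (\sum_(t < T) dot (F xstar) (x t.+1 w - xstar)
      + \sum_(t < T) dot lam (g (x t.+1 w)))); last first.
    rewrite -big_split/=; apply: ler_sum => t _; have tT := ltn_ord t.
    have := F_monotone (run_in w tT) Xs; have := dot_neg_ge0 w tT gs0.
    rewrite dotBl; lra.
  rewrite average_ergodic -/xb.
  have J : T%:R * dot lam (g xb) <= \sum_(t < T) dot lam (g (x t.+1 w)).
    rewrite /dot exchange_big/= mulr_sumr; apply: ler_sum => j _.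
    by rewrite -mulr_sumr mulrCA ler_wpM2l.
  have K : norm2 p <= dot (F xstar) (xb - xstar) + dot lam (g xb).
    have := kkt Xb; have := dot_le_norm2 lstar p.
    have : dot lstar (g xb) <= dot lstar p.
      by apply: ler_sum => j _; rewrite ler_wpM2l.
    rewrite lg /c mulrDl mul1r; lra.
  have := ler_wpM2l T0 K; rewrite mulrDr; lra.
have E : \sum_(t < T) noise_at xstar lam t w =
    \sum_(t < T) noise_at xstar 0 t w - dot (\sum_(t < T) ng t w) lam.
  rewrite dot_suml -sumrB; apply: eq_bigr => t _.
  rewrite /noise_at /noise_term -/(ng t w) !(dotBr (l t w)) dot0r; ring.
have N : - dot (\sum_(t < T) ng t w) lam <= c * norm2 (\sum_(t < T) ng t w).
  apply: le_trans (ler_norm _) _; rewrite normrN.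
  apply: le_trans (abs_dot_le _ _) _; rewrite mulrC.
  by rewrite ler_wpM2r ?norm2_ge0.
have E2 : \sum_(t < T) error (norm2 lam) t w <= \sum_(t < T) error c t w.
  apply: ler_sum => t _; apply: error_term_le => //; exact: norm2_ge0.
have Y : tau / 2 * norm2 lam ^+ 2 <= tau / 2 * c ^+ 2.
  apply: ler_wpM2l; first by rewrite divr_ge0// ltW.
  by rewrite ler_pXn2r ?nnegrE ?norm2_ge0.
have Y4 := mulr_ge0 (ltW tau_gt0) (sqr_ge0 (norm2 (lam - l T w))).
rewrite E /feas_bound -/c; lra.
Qed.

Lemma expected_infeasibility (c := norm2 lstar + 1) : 0 <= sigma_g ->
  ('E_P[fun w => norm2 (pos_part (g (ergodic_average T (x^~ w))))]
   <= (T%:R^-1 * (eta / 2 * dist2 + tau / 2 * c ^+ 2 + error_bound c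
        + c * (Num.sqrt T%:R * sigma_g)))%:E)%E.
Proof.
move=> sg0; have T0 : 0 < T%:R :> R by rewrite ltr0n.
have [ie me] := error_sum_integ c.
have [in_ mn] := noise_sum_integ xstar 0 (leqnn T).
have Ls := vL2_norm2 g_noise_sum_L2.
have i1 := L2_integ Ls; have j1 := integZ c i1.
have ic := integ_cst P (eta / 2 * dist2 + tau / 2 * c ^+ 2).
have iB : integ P (feas_bound c) by repeat apply: integD => //.
apply: le_trans (expectation_le_mean (integZ T%:R^-1 iB) _) _.
  by move=> w; rewrite ler_pdivlMl//; exact: feas_pathwise.
rewrite lee_fin (meanZ _ iB); apply: ler_wpM2l.
  by rewrite invr_ge0 ltW.
rewrite /feas_bound.
rewrite (meanD ic (integD ie (integD in_ j1))) (meanD ie (integD in_ j1)).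
rewrite (meanD in_ j1) mean_cst mn (meanZ _ i1).
have c0 : 0 <= c by rewrite addr_ge0 ?norm2_ge0.
have M1 : mean P (fun w => norm2 (\sum_(t < T) ng t w))
    <= Num.sqrt T%:R * sigma_g.
  rewrite -(ler_pXn2r (ltn0Sn 1)) ?nnegrE ?mulr_ge0 ?sqrtr_ge0//; last first.
    by apply: mean_ge0 => w; exact: norm2_ge0.
  apply: le_trans (sqr_mean_le Ls) _; rewrite exprMn sqr_sqrtr.
    exact: g_noise_sum_moment.
  exact: ltW.
have := ler_wpM2l c0 M1; lra.
Qed.

End SaddlePoint.
End Run.
(** * Arithmetic of the stepsizes *)

Section Stepsizes.
Context {R : realType}.
Variables (t r D A B C Mg sG sg sigma H L q dist2 S lam : R).
Hypothesis t_ge1 : 1 <= t.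
Hypothesis r_gt0 : 0 < r.
Hypothesis r_sqr : r ^+ 2 = 2 * t.
Hypothesis D_gt0 : 0 < D.
Hypothesis A_gt0 : 0 < A.
Hypothesis C_gt0 : 0 < C.
Hypothesis B_ge1 : 1 <= B.
Hypotheses (Mg_ge0 : 0 <= Mg) (sG_ge0 : 0 <= sG).
Hypotheses (L_ge0 : 0 <= L) (S_ge0 : 0 <= S) (dist2_ge0 : 0 <= dist2).
Hypothesis A_ge : B * (3 * Mg + 4 * sG) <= A.
Hypothesis C_ge : 2 * Mg + 5 * sG <= C.

Let eta := r * A / D + 25 * L / 3.
Let tau := 2 * r * C * D / B.
Let V := H ^+ 2 + 2 * sigma ^+ 2.
Let eps := D / (r * A).
Let N (c : R) := t * (sg ^+ 2 / (2 * tau)) + 5 / 2 * t * (V / eta)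
  + (5 / 2 * Mg ^+ 2 + 25 / 4 * sG ^+ 2) * S / eta
  + 25 / 4 * t * ((Mg * c) ^+ 2 / eta).

Hypothesis S_le : S <= t * (5 * q ^+ 2
  + 5 / 4 * (eta / tau * dist2 + q ^+ 2 + 2 / tau * N q)).
Hypothesis lam_ge : 10 * q ^+ 2 + 2 * (eta / tau * dist2) <= lam.

Let t_gt0 : 0 < t. Proof. exact: lt_le_trans ltr01 t_ge1. Qed.
Let B_gt0 : 0 < B. Proof. exact: lt_le_trans ltr01 B_ge1. Qed.

Let V_ge0 : 0 <= V.
Proof. exact: addr_ge0 (sqr_ge0 H) (mulr_ge0 (ler0n _ 2) (sqr_ge0 sigma)). Qed.

Let eta0_gt0 : 0 < r * A / D.
Proof. by rewrite divr_gt0 ?mulr_gt0. Qed.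

Let eta_ge : r * A / D <= eta.
Proof. by rewrite lerDl divr_ge0 ?mulr_ge0. Qed.

Lemma primal_stepsize_gt0 : 0 < eta.
Proof. exact: lt_le_trans eta0_gt0 eta_ge. Qed.

Lemma dual_stepsize_gt0 : 0 < tau.
Proof. by rewrite /tau divr_gt0// !mulr_gt0. Qed.

Let eta_gt0 := primal_stepsize_gt0.
Let tau_gt0 := dual_stepsize_gt0.

Let inv_eta_le : eta^-1 <= eps.
Proof.
have -> : eps = (r * A / D)^-1 by rewrite invf_div.
by rewrite lef_pV2 ?posrE.
Qed.

Let eps_ge0 : 0 <= eps.
Proof. by rewrite divr_ge0 ?ltW ?mulr_gt0. Qed.

(** The dimensionless numbers [Mg^2 T / (eta tau)] and [sG^2 T / (eta tau)]
    are small because [A * C / B] dominates [6 Mg^2 + 20 sG^2]. *)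
Let p := t * Mg ^+ 2 / (eta * tau).
Let w := t * sG ^+ 2 / (eta * tau).

Let p_ge0 : 0 <= p.
Proof.
exact: divr_ge0 (mulr_ge0 (ltW t_gt0) (sqr_ge0 Mg)) (ltW (mulr_gt0 _ _)).
Qed.

Let w_ge0 : 0 <= w.
Proof.
exact: divr_ge0 (mulr_ge0 (ltW t_gt0) (sqr_ge0 sG)) (ltW (mulr_gt0 _ _)).
Qed.

Let pw_le : 24 * p + 80 * w <= 1.
Proof.
have -> : 24 * p + 80 * w =
    4 * t * (6 * Mg ^+ 2 + 20 * sG ^+ 2) / (eta * tau).
  by rewrite /p /w; field; rewrite !gt_eqF.
rewrite (ler_pdivrMr _ _ (mulr_gt0 eta_gt0 tau_gt0)) mul1r.
have AC : B * (6 * Mg ^+ 2 + 20 * sG ^+ 2) <= A * C.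
  have h1 : 0 <= B * (3 * Mg + 4 * sG).
    by rewrite mulr_ge0 ?addr_ge0 ?mulr_ge0// ltW.
  have h2 : 0 <= 2 * Mg + 5 * sG by rewrite addr_ge0 ?mulr_ge0.
  apply: le_trans (ler_pM h1 h2 A_ge C_ge).
  rewrite -mulrA; apply: ler_wpM2l; first exact: ltW.
  have := mulr_ge0 Mg_ge0 sG_ge0; lra.
apply: (@le_trans _ _ (r * A / D * tau)).
  have -> : r * A / D * tau = r ^+ 2 * 2 * (A * C / B).
    by rewrite /tau; field; rewrite !gt_eqF.
  rewrite r_sqr; have -> : 2 * t * 2 * (A * C / B) = 4 * t * (A * C / B).
    by ring.
  apply: ler_wpM2l; first by rewrite mulr_ge0// ltW.
  by rewrite ler_pdivlMr// mulrC.
by apply: ler_wpM2r => //; exact: ltW.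
Qed.

Let s := S / t.
Let s_ge0 : 0 <= s. Proof. by rewrite divr_ge0// ltW. Qed.
Let a := sg ^+ 2 / tau.
Let b := V / eta.
Let a_ge0 : 0 <= a. Proof. exact: divr_ge0 (sqr_ge0 sg) (ltW tau_gt0). Qed.
Let b_ge0 : 0 <= b. Proof. exact: divr_ge0 V_ge0 (ltW eta_gt0). Qed.

(** Solving the self-bounding estimate of the multiplier energy: its
    coefficient on the right is at most 25/96. *)
Let s_le : s <= lam + t / tau * (2 * a + 9 * b).
Proof.
have h : s <= 5 * q ^+ 2 + 5 / 4 * (eta / tau * dist2 + q ^+ 2
    + t / tau * (a + 5 * b) + (5 * (p * s) + 25 / 2 * (w * s))
    + 25 / 2 * (p * q ^+ 2)).
  rewrite ler_pdivrMr// mulrC; apply: le_trans S_le _.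
  rewrite le_eqVlt; apply/orP; left; apply/eqP; congr (_ * (_ + _ * _)).
  by rewrite /N /p /w /s /a /b; field; rewrite !gt_eqF.
have g1 : 24 * (p * s) + 80 * (w * s) <= s.
  by have := ler_wpM2r s_ge0 pw_le; lra.
have g2 : 24 * (p * q ^+ 2) <= q ^+ 2.
  have := ler_wpM2r (sqr_ge0 q) pw_le; have := mulr_ge0 w_ge0 (sqr_ge0 q); lra.
have g3 := mulr_ge0 w_ge0 s_ge0; have g4 := mulr_ge0 p_ge0 s_ge0.
have g5 : 0 <= eta / tau * dist2.
  exact: mulr_ge0 (divr_ge0 (ltW eta_gt0) (ltW tau_gt0)) _.
have tt0 : 0 <= t / tau by rewrite divr_ge0// ltW.
have g6 := mulr_ge0 tt0 a_ge0; have g7 := mulr_ge0 tt0 b_ge0.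
have q2 := sqr_ge0 q.
move: lam_ge h g5 q2; rewrite !mulrDr.
move: (eta / tau * dist2) (q ^+ 2) g1 g2 => d2 qq g1 g2.
have -> : t / tau * (2 * a) = 2 * (t / tau * a) by ring.
have -> : t / tau * (9 * b) = 9 * (t / tau * b) by ring.
have -> : t / tau * (5 * b) = 5 * (t / tau * b) by ring.
move: (t / tau * a) (t / tau * b) (p * s) (w * s) g1 g3 g4 g6 g7.
move: (p * qq) g2 => pq g2 ta tb ps ws; lra.
Qed.

Let lam_ge0 : 0 <= lam.
Proof.
apply: le_trans lam_ge; apply: addr_ge0; first by rewrite mulr_ge0 ?sqr_ge0.
exact: mulr_ge0 (ler0n _ 2) (mulr_ge0 (divr_ge0 (ltW eta_gt0) (ltW tau_gt0)) _).
Qed.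

(** The part of the energy beyond [lam] comes with a second factor
    [t / tau], which turns [Mg^2] and [sG^2] into [p] and [w]. *)
Let energy_over_eta (k1 k2 : R) : 0 <= k1 -> 0 <= k2 ->
  (k1 * Mg ^+ 2 + k2 * sG ^+ 2) * (s / eta) <=
  (k1 * Mg ^+ 2 + k2 * sG ^+ 2) * (lam * eps)
  + (k1 * p + k2 * w) * (2 * a + 9 * b).
Proof.
move=> k10 k20; set K := k1 * _ + _.
have K0 : 0 <= K.
  exact: addr_ge0 (mulr_ge0 k10 (sqr_ge0 Mg)) (mulr_ge0 k20 (sqr_ge0 sG)).
have e0 : 0 <= eta^-1 by rewrite invr_ge0 ltW.
apply: (@le_trans _ _ (K * ((lam + t / tau * (2 * a + 9 * b)) / eta))).
  by apply: ler_wpM2l => //; apply: ler_wpM2r.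
have -> : K * ((lam + t / tau * (2 * a + 9 * b)) / eta) =
    K * (lam / eta) + (k1 * p + k2 * w) * (2 * a + 9 * b).
  by rewrite /K /p /w; field; rewrite !gt_eqF.
rewrite lerD2r; apply: ler_wpM2l => //; exact: ler_wpM2l.
Qed.

Let tauE : sg ^+ 2 * B / (2 * r * C * D) = a.
Proof. by rewrite /a /tau; field; rewrite !gt_eqF. Qed.

Let b_le : b <= V * eps.
Proof. exact: ler_wpM2l. Qed.

Let over_eta (u : R) : 0 <= u -> u / eta <= u * eps.
Proof. by move=> u0; apply: ler_wpM2l. Qed.

Let absorb (k1 k2 : R) : 0 <= k1 -> 0 <= k2 -> k1 <= 5 / 2 -> k2 <= 27 / 4 ->
  (k1 * p + k2 * w) * (2 * a + 9 * b) <= 5 / 24 * a + 15 / 16 * b.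
Proof.
move=> k10 k20 h1 h2.
have h : k1 * p + k2 * w <= 5 / 48.
  have := ler_wpM2r p_ge0 h1; have := ler_wpM2r w_ge0 h2; move: pw_le w_ge0; lra.
have ab0 : 0 <= 2 * a + 9 * b.
  exact: addr_ge0 (mulr_ge0 (ler0n _ 2) a_ge0) (mulr_ge0 (ler0n _ 9) b_ge0).
have := ler_wpM2r ab0 h; lra.
Qed.

Lemma optimality_constants :
  t^-1 * (3 / 2 * (eta * D ^+ 2) + N 0 + t * sigma ^+ 2 / (2 * eta)
          + sG ^+ 2 * S / (2 * eta))
  <= D * (3 * (2 / r) * A / 2 + sg ^+ 2 * B / (2 * r * C * D ^+ 2)
          + 25 * V / (6 * r * A) + V / (t * r * A) + sigma ^+ 2 / (2 * r * A)
          + (15 * Mg ^+ 2 + 28 * sG ^+ 2) * lam / (3 * r * A))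
     + 25 * L * D ^+ 2 / (2 * t).
Proof.
have -> : t^-1 * (3 / 2 * (eta * D ^+ 2) + N 0 + t * sigma ^+ 2 / (2 * eta)
          + sG ^+ 2 * S / (2 * eta)) =
    3 / 2 * (r * A / D * D ^+ 2 / t) + 25 * L * D ^+ 2 / (2 * t)
    + a / 2 + 5 / 2 * b + sigma ^+ 2 / eta / 2
    + (5 / 2 * Mg ^+ 2 + 27 / 4 * sG ^+ 2) * (s / eta).
  have E : 3 / 2 * (eta * D ^+ 2) / t = 3 / 2 * (r * A / D * D ^+ 2 / t)
      + 25 * L * D ^+ 2 / (2 * t).
    by rewrite /eta; field; rewrite !gt_eqF.
  rewrite -E /N /a /b /s; move: eta eta_gt0 tau tau_gt0 => h h0 u u0.
  by field; rewrite !gt_eqF.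
have -> : D * (3 * (2 / r) * A / 2 + sg ^+ 2 * B / (2 * r * C * D ^+ 2)
          + 25 * V / (6 * r * A) + V / (t * r * A) + sigma ^+ 2 / (2 * r * A)
          + (15 * Mg ^+ 2 + 28 * sG ^+ 2) * lam / (3 * r * A)) =
    3 / 2 * (r * A / D * D ^+ 2 / t) + a + 25 / 6 * (V * eps)
    + V * eps / t + sigma ^+ 2 * eps / 2
    + (5 * Mg ^+ 2 + 28 / 3 * sG ^+ 2) * (lam * eps).
  have -> : r * A / D * D ^+ 2 / t = 2 / r * A * D.
    have -> : t = r ^+ 2 / 2 by rewrite r_sqr mulrC mulKf.
    by field; rewrite !gt_eqF.
  rewrite -tauE /eps; field.
  by rewrite !gt_eqF.
have h1 := @energy_over_eta (5 / 2) (27 / 4) ltac:(lra) ltac:(lra).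
have h2 := @absorb (5 / 2) (27 / 4) ltac:(lra) ltac:(lra) ltac:(lra) ltac:(lra).
have h3 := over_eta (sqr_ge0 sigma).
have eps0 := eps_ge0.
have h4 : 0 <= V * eps / t := divr_ge0 (mulr_ge0 V_ge0 eps0) (ltW t_gt0).
have h5 := mulr_ge0 (sqr_ge0 Mg) (mulr_ge0 lam_ge0 eps0).
have h6 := mulr_ge0 (sqr_ge0 sG) (mulr_ge0 lam_ge0 eps0).
move: b_le a_ge0 b_ge0 h1 h2 h3 h4 h5 h6.
move: (V * eps / t) (V * eps) (lam * eps) (s / eta) (sigma ^+ 2 * eps).
move: (sigma ^+ 2 / eta) (r * A / D * D ^+ 2 / t) (25 * L * D ^+ 2 / (2 * t)).
move: a b p w (Mg ^+ 2) (sG ^+ 2) => *. lra.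
Qed.

Lemma feasibility_constants c st : 0 <= c -> 0 < st ->
  st ^+ 2 = t ->
  t^-1 * (eta / 2 * dist2 + tau / 2 * c ^+ 2 + N c + c * (st * sg))
  <= A / (r * D) * dist2 + 25 * L / (6 * t) * dist2
     + 2 / r * C * c ^+ 2 * D / B
     + sg ^+ 2 * B / (2 * r * C * D) + V * D / (t * r * A)
     + 15 * Mg ^+ 2 * D * c ^+ 2 / (r * A)
     + 10 * Mg ^+ 2 * D * lam / (r * A)
     + 25 * D * (2 * V + sG ^+ 2 * lam) / (3 * r * A)
     + c * sg / st.
Proof.
move=> c0 st0 stt.
have -> : t^-1 * (eta / 2 * dist2 + tau / 2 * c ^+ 2 + N c + c * (st * sg)) =
    A / (r * D) * dist2 + 25 * L / (6 * t) * dist2 + 2 / r * C * c ^+ 2 * D / B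
    + a / 2 + 5 / 2 * b
    + (5 / 2 * Mg ^+ 2 + 25 / 4 * sG ^+ 2) * (s / eta)
    + 25 / 4 * ((Mg * c) ^+ 2 / eta) + c * sg / st.
  have E1 : eta / 2 * dist2 / t = A / (r * D) * dist2 + 25 * L / (6 * t) * dist2.
    rewrite /eta; have -> : t = r ^+ 2 / 2 by rewrite r_sqr mulrC mulKf.
    by field; rewrite !gt_eqF.
  have E2 : tau / 2 * c ^+ 2 / t = 2 / r * C * c ^+ 2 * D / B.
    rewrite /tau; have -> : t = r ^+ 2 / 2 by rewrite r_sqr mulrC mulKf.
    by field; rewrite !gt_eqF.
  have E3 : c * (st * sg) / t = c * sg / st.
    by rewrite -stt; field; rewrite gt_eqF.
  rewrite -E1 -E2 -E3 /N /a /b /s.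
  move: eta eta_gt0 tau tau_gt0 => h h0 u u0.
  by field; rewrite !gt_eqF.
rewrite tauE.
have -> : V * D / (t * r * A) = V * eps / t.
  by rewrite /eps; field; rewrite !gt_eqF.
have -> : 15 * Mg ^+ 2 * D * c ^+ 2 / (r * A) = 15 * ((Mg * c) ^+ 2 * eps).
  by rewrite /eps; field; rewrite !gt_eqF.
have -> : 10 * Mg ^+ 2 * D * lam / (r * A) = 10 * (Mg ^+ 2 * (lam * eps)).
  by rewrite /eps; field; rewrite !gt_eqF.
have -> : 25 * D * (2 * V + sG ^+ 2 * lam) / (3 * r * A) =
    50 / 3 * (V * eps) + 25 / 3 * (sG ^+ 2 * (lam * eps)).
  by rewrite /eps; field; rewrite !gt_eqF.
have h1 := @energy_over_eta (5 / 2) (25 / 4) ltac:(lra) ltac:(lra).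
have h2 := @absorb (5 / 2) (25 / 4) ltac:(lra) ltac:(lra) ltac:(lra) ltac:(lra).
have h3 := over_eta (sqr_ge0 (Mg * c)).
have eps0 := eps_ge0.
have h4 : 0 <= V * eps / t := divr_ge0 (mulr_ge0 V_ge0 eps0) (ltW t_gt0).
have h5 := mulr_ge0 (sqr_ge0 Mg) (mulr_ge0 lam_ge0 eps0).
have h6 := mulr_ge0 (sqr_ge0 sG) (mulr_ge0 lam_ge0 eps0).
have h7 := mulr_ge0 (sqr_ge0 (Mg * c)) eps0.
move: b_le a_ge0 b_ge0 h1 h2 h3 h4 h5 h6 h7.
lra.
Qed.

End Stepsizes.
(** * Constraint subgradients and the convergence theorem *)

Section ConstraintGeometry.
Context {R : realType} {n m : nat}.
Variables (X : set 'cV[R]_n) (g : 'cV[R]_n -> 'cV[R]_m) (M : 'I_m -> R).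
Hypothesis M_ge0 : forall j, 0 <= M j.
Hypothesis g_lipschitz : forall j x1 x2, X x1 -> X x2 ->
  `|g x1 j 0 - g x2 j 0| <= M j * norm2 (x1 - x2).

Let Mg := Num.sqrt (\sum_j M j ^+ 2).

Let Mg_sqr : Mg ^+ 2 = \sum_j M j ^+ 2.
Proof. by rewrite sqr_sqrtr// sumr_ge0// => j _; rewrite sqr_ge0. Qed.

Lemma constraint_lipschitz x1 x2 : X x1 -> X x2 ->
  norm2 (g x1 - g x2) <= Mg * norm2 (x1 - x2).
Proof.
move=> X1 X2; have d0 := norm2_ge0 (x1 - x2).
have g0 := norm2_ge0 (g x1 - g x2).
rewrite -(ler_pXn2r (ltn0Sn 1)) ?nnegrE ?mulr_ge0 ?sqrtr_ge0//.
rewrite exprMn Mg_sqr norm2_sqrE mulr_suml; apply: ler_sum => j _.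
rewrite -exprMn -[leLHS]real_normK ?num_real// !mxE.
have d1 := mulr_ge0 (M_ge0 j) d0.
rewrite ler_pXn2r ?nnegrE//.
exact: (g_lipschitz j X1 X2).
Qed.

Lemma jacobian_bound (K : 'M[R]_(n, m)) (v : 'cV[R]_m) :
  (forall j, norm2 (col j K) <= M j) -> norm2 (K *m v) <= Mg * norm2 v.
Proof.
move=> KM; have v0 := norm2_ge0 v.
have g0 := norm2_ge0 (K *m v).
rewrite -(ler_pXn2r (ltn0Sn 1)) ?nnegrE ?mulr_ge0 ?sqrtr_ge0//.
apply: le_trans (norm2_mulmx_le _ _) _; rewrite exprMn Mg_sqr.
apply: ler_wpM2r; first exact: sqr_ge0.
apply: ler_sum => j _; have c0 := norm2_ge0 (col j K).
by rewrite ler_pXn2r ?nnegrE//; exact: KM.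
Qed.

(** The subgradient inequalities are weighted by the multipliers;
    complementarity removes the constraint values at [xs]. *)
Lemma kkt_gap (Fs xs : 'cV[R]_n) (ls : 'cV[R]_m) (v : 'I_m -> 'cV[R]_n)
    (w : 'cV[R]_n) :
  nonneg_orthant ls -> (forall j, ls j 0 * g xs j 0 = 0) ->
  (forall j, subdiff X (fun y => g y j 0) xs (v j)) -> normal_cone X xs w ->
  0 = Fs + \sum_j ls j 0 *: v j + w ->
  forall y, X y -> 0 <= dot Fs (y - xs) + dot ls (g y).
Proof.
move=> l0 lg sv nw E y Xy.
have : 0 = dot (Fs + \sum_j ls j 0 *: v j + w) (y - xs) by rewrite -E dot0l.
rewrite !dotDl dot_suml => E'.
have : \sum_j dot (ls j 0 *: v j) (y - xs) <= dot ls (g y).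
  apply: ler_sum => j _; rewrite dotZl.
  have [sub _] := subdiffP (M_ge0 j) (@g_lipschitz j) (sv j).
  apply: (@le_trans _ _ (ls j 0 * (g y j 0 - g xs j 0))).
    by apply: ler_wpM2l; [exact: l0|have := sub _ Xy; lra].
  by rewrite mulrBr lg subr0.
have := nw _ Xy; lra.
Qed.

End ConstraintGeometry.

Theorem theorem2 (R : realType) (n m : nat)
  (* feasible set *)
  (X : set 'cV[R]_n) (X_convex : convex_set X) (X_compact : compact X)
  (* operator *)
  (F : 'cV[R]_n -> 'cV[R]_n) (L H : R) (L_ge0 : 0 <= L) (H_ge0 : 0 <= H)
  (F_monotone : forall x1 x2, X x1 -> X x2 ->
     0 <= dot (F x1 - F x2) (x1 - x2))
  (F_growth : forall x1 x2, X x1 -> X x2 ->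
     norm2 (F x1 - F x2) <= L * norm2 (x1 - x2) + H)
  (* function constraints *)
  (g : 'cV[R]_n -> 'cV[R]_m) (M : 'I_m -> R) (M_ge0 : forall j, 0 <= M j)
  (g_continuous : forall j, {within X, continuous (fun x => g x j 0)})
  (g_convex : forall j, convex_function X (fun x => g x j 0))
  (g_lipschitz : forall j x1 x2, X x1 -> X x2 ->
     `|g x1 j 0 - g x2 j 0| <= M j * norm2 (x1 - x2))
  (g' : 'cV[R]_n -> 'M[R]_(n, m))
  (g'_selection : forall x, X x -> forall j,
     subdiff X (fun y => g y j 0) x (col j (g' x)))
  (* solution and multiplier *)
  (xstar : 'cV[R]_n) (xstar_feasible : feasible X g xstar)
  (xstar_vi : forall x, feasible X g x -> 0 <= dot (F xstar) (x - xstar))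
  (lstar : 'cV[R]_m) (lstar_ge0 : nonneg_orthant lstar)
  (stationarity : exists (v : 'I_m -> 'cV[R]_n) (w : 'cV[R]_n),
     [/\ forall j, subdiff X (fun y => g y j 0) xstar (v j),
         normal_cone X xstar w &
         0 = F xstar + \sum_j lstar j 0 *: v j + w])
  (complementarity : forall j, lstar j 0 * g xstar j 0 = 0)
  (* stochastic oracle *)
  (d' : measure_display) (Xi : measurableType d') (mu : probability Xi R)
  (FF : 'cV[R]_n -> Xi -> 'cV[R]_n) (gg : 'cV[R]_n -> Xi -> 'cV[R]_m)
  (GG : 'cV[R]_n -> Xi -> 'M[R]_(n, m))
  (sigma sigma_g : R) (sigma_G : 'cV[R]_m)
  (sigma_ge0 : 0 <= sigma) (sigma_g_ge0 : 0 <= sigma_g)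
  (sigma_G_ge0 : forall j, 0 <= sigma_G j 0)
  (FF_oracle : unbiased_oracle X mu FF F sigma)
  (gg_oracle : unbiased_oracle X mu gg g sigma_g)
  (GG_oracle : forall j, unbiased_oracle X mu
     (fun x s => col j (GG x s)) (fun x => col j (g' x)) (sigma_G j 0))
  (gg_convex : forall s j, convex_function X (fun x => gg x s j 0))
  (gg_lsc : forall s j,
     @lower_semicontinuous (subspace X) R (fun x => (gg x s j 0)%:E))
  (* samples *)
  (d : measure_display) (Om : measurableType d) (P : probability Om R)
  (xi xibar : nat -> {RV P >-> Xi})
  (samples_law : identically_distributed (sample_family xi xibar) mu)
  (samples_indep : mutually_independent P
     (fun i => sample_family xi xibar i : Om -> Xi))
  (* the method *)
  (x0 : 'cV[R]_n) (x0_in : X x0) (T : nat) (T_gt0 : (0 < T)%N)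
  (B : R) (B_ge1 : 1 <= B)
  (x : nat -> Om -> 'cV[R]_n) (l : nat -> Om -> 'cV[R]_m) :
  let D := diameter X in
  let Mg := Num.sqrt (\sum_j M j ^+ 2) in
  let sG := norm2 sigma_G in
  let A := B * (3 * Mg + 4 * sG * (1 + sigma_g)) + H + sigma in
  let C := 2 * Mg + 5 * sG + sigma_g in
  let r2T := Num.sqrt (2 * T%:R) in
  let eta := r2T * A / D + 25 * L / 3 in
  let tau := 2 * r2T * C * D / B in
  let dist2 := norm2 (xstar - x0) ^+ 2 in
  let V := H ^+ 2 + 2 * sigma ^+ 2 in
  let Rf := eta / tau * dist2 + 3 * norm2 lstar ^+ 2
            + 2 * sigma_g ^+ 2 + 9 * V in
  let lam := norm2 lstar ^+ 2 + 2 * Rf * expR 1 in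
  let xbar := fun w => ergodic_average T (x^~ w) in
  0 < D -> 0 < A -> 0 < C ->
  (forall w, poe_run X FF gg GG (fun=> 1) (fun=> eta) (fun=> tau) T x0
     (xi^~ w) (xibar^~ w) (x^~ w) (l^~ w)) ->
  ('E_P[fun w => sup [set dot (F y) (xbar w - y) | y in feasible X g]]
    <= (D * (3 * Num.sqrt 2 * A / (2 * Num.sqrt T%:R)
             + sigma_g ^+ 2 * B / (2 * r2T * C * D ^+ 2)
             + 25 * V / (6 * r2T * A)
             + V / (T%:R * r2T * A)
             + sigma ^+ 2 / (2 * r2T * A)
             + (15 * Mg ^+ 2 + 28 * sG ^+ 2) * lam / (3 * r2T * A))
        + 25 * L * D ^+ 2 / (2 * T%:R))%:E)%E
  /\
  ('E_P[fun w => norm2 (pos_part (g (xbar w)))]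
    <= (A / (r2T * D) * dist2
        + 25 * L / (6 * T%:R) * dist2
        + Num.sqrt 2 * C * (norm2 lstar + 1) ^+ 2 * D / (Num.sqrt T%:R * B)
        + sigma_g ^+ 2 * B / (2 * r2T * C * D)
        + V * D / (T%:R * r2T * A)
        + 15 * Mg ^+ 2 * D * (norm2 lstar + 1) ^+ 2 / (r2T * A)
        + 10 * Mg ^+ 2 * D * lam / (r2T * A)
        + 25 * D * (2 * V + sG ^+ 2 * lam) / (3 * r2T * A)
        + (norm2 lstar + 1) * sigma_g / Num.sqrt T%:R)%:E)%E.

Proof.
move=> D Mg sG A C r2T eta tau dist2 V Rf lam xbar D_gt0 A_gt0 C_gt0 run.
have Mg_ge0 : 0 <= Mg by exact: sqrtr_ge0.
have sG_ge0 : 0 <= sG by exact: norm2_ge0.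
have t_ge1 : 1 <= T%:R :> R by rewrite ler1n.
have r_gt0 : 0 < r2T by rewrite sqrtr_gt0 mulr_gt0// ltr0n.
have r_sqr : r2T ^+ 2 = 2 * T%:R by rewrite sqr_sqrtr// mulr_ge0.
have B_ge0 : 0 <= B := le_trans ler01 B_ge1.
have A_ge : B * (3 * Mg + 4 * sG) <= A.
  rewrite /A -addrA; apply: ler_wpDr; first exact: addr_ge0.
  apply: ler_wpM2l => //; rewrite lerD2l ler_peMr ?mulr_ge0//.
  by rewrite lerDl.
have C_ge : 2 * Mg + 5 * sG <= C by rewrite lerDl.
have eta_gt0 : 0 < eta by exact: primal_stepsize_gt0.
have tau_gt0 : 0 < tau by exact: dual_stepsize_gt0.
have L_eta : 25 * L <= 3 * eta.
  have : 0 <= r2T * A / D by rewrite divr_ge0 ?mulr_ge0 ?ltW.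
  rewrite /eta; lra.
have g'P x1 j (X1 : X x1) := subdiffP (M_ge0 j) (@g_lipschitz j)
  (g'_selection x1 X1 j).
have g'_sub x1 y : X x1 -> X y -> forall j,
    g x1 j 0 + dot (col j (g' x1)) (y - x1) <= g y j 0.
  by move=> X1 Xy j; have [sub _] := g'P x1 j X1; exact: sub.
have g'_bound x1 v : X x1 -> norm2 (g' x1 *m v) <= Mg * norm2 v.
  by move=> X1; apply: jacobian_bound => j; have [] := g'P x1 j X1.
have g_lip x1 x2 : X x1 -> X x2 ->
    norm2 (g x1 - g x2) <= Mg * norm2 (x1 - x2).
  exact: constraint_lipschitz.
have kkt y : X y -> 0 <= dot (F xstar) (y - xstar) + dot lstar (g y).
  have [v [w [sv nw E]]] := stationarity.
  exact: (kkt_gap M_ge0 g_lipschitz lstar_ge0 complementarity sv nw E).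
have S_le := multiplier_energy_le X_convex X_compact x0_in Mg_ge0 g_lip
  FF_oracle gg_oracle GG_oracle samples_law samples_indep eta_gt0 tau_gt0 run
  L_ge0 F_growth F_monotone g'_sub g'_bound L_eta xstar_feasible lstar_ge0 kkt.
have S_ge0 : 0 <= multiplier_energy P T l.
  by apply: sumr_ge0 => t _; apply: mean_ge0 => w; exact: sqr_ge0.
have dist2_ge0 : 0 <= dist2 by exact: sqr_ge0.
have lam_ge : 10 * norm2 lstar ^+ 2 + 2 * (eta / tau * dist2) <= lam.
  have e2 : 2 <= expR 1 :> R by have := @expR_ge1Dx R 1; lra.
  have u0 : 0 <= eta / tau * dist2.
    exact: mulr_ge0 (divr_ge0 (ltW eta_gt0) (ltW tau_gt0)) dist2_ge0.
  have q0 := sqr_ge0 (norm2 lstar).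
  have Rf_ge : eta / tau * dist2 + 3 * norm2 lstar ^+ 2 <= Rf.
    rewrite /Rf /V; have := sqr_ge0 sigma_g; have := sqr_ge0 sigma.
    have := sqr_ge0 H; lra.
  have Rf0 : 0 <= Rf by apply: le_trans Rf_ge; lra.
  have := ler_wpM2l Rf0 e2; rewrite /lam; lra.
have s2_gt0 : 0 < Num.sqrt 2 :> R by rewrite sqrtr_gt0.
have sT_gt0 : 0 < Num.sqrt T%:R :> R by rewrite sqrtr_gt0 ltr0n.
have sTE : 2 / r2T = Num.sqrt 2 / Num.sqrt T%:R.
  have {1}-> : (2 : R) = Num.sqrt 2 ^+ 2 by rewrite sqr_sqrtr.
  rewrite /r2T sqrtrM//; field.
  by rewrite !gt_eqF.
split.
- have HD z : X z -> norm2 (z - x0) <= D by move=> Xz; exact: le_diameter.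
  apply: le_trans (expected_optimality_gap X_convex X_compact x0_in Mg_ge0 g_lip
    FF_oracle gg_oracle GG_oracle samples_law samples_indep eta_gt0 tau_gt0 run
    L_ge0 F_growth F_monotone g'_sub g'_bound L_eta T_gt0 xstar_feasible HD) _.
  rewrite lee_fin.
  have := optimality_constants t_ge1 r_gt0 r_sqr D_gt0 A_gt0 C_gt0 B_ge1 Mg_ge0
    sG_ge0 L_ge0 S_ge0 dist2_ge0 A_ge C_ge S_le lam_ge.
  move/le_trans; apply; rewrite sTE.
  have -> : 3 * (Num.sqrt 2 / Num.sqrt T%:R) * A / 2 =
      3 * Num.sqrt 2 * A / (2 * Num.sqrt T%:R).
    by field; rewrite gt_eqF.
  exact: lexx.
- apply: le_trans (expected_infeasibility X_convex X_compact x0_in Mg_ge0 g_lip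
    FF_oracle gg_oracle GG_oracle samples_law samples_indep eta_gt0 tau_gt0 run
    L_ge0 F_growth F_monotone g_convex g'_sub g'_bound L_eta T_gt0
    xstar_feasible lstar_ge0 kkt sigma_g_ge0) _.
  rewrite lee_fin.
  have c_ge0 : 0 <= norm2 lstar + 1 by rewrite addr_ge0 ?norm2_ge0.
  have := feasibility_constants t_ge1 r_gt0 r_sqr D_gt0 A_gt0 C_gt0 B_ge1 Mg_ge0
    sG_ge0 L_ge0 S_ge0 dist2_ge0 A_ge C_ge S_le lam_ge c_ge0 sT_gt0
    (sqr_sqrtr (ler0n R T)).
  move/le_trans; apply; rewrite sTE.
  have -> : Num.sqrt 2 / Num.sqrt T%:R * C * (norm2 lstar + 1) ^+ 2 * D / B =
      Num.sqrt 2 * C * (norm2 lstar + 1) ^+ 2 * D / (Num.sqrt T%:R * B).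
    by field; rewrite !gt_eqF// (lt_le_trans ltr01).
  exact: lexx.
Qed.
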